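(* Let $G\cong\mathbb Z/k\mathbb Z$ be the finite cyclic subgroup of $\mathrm{SL}(2,\mathbb C)$ generated by $\mathrm{diag}(\xi_k^{-1},\xi_k)$, where $\xi_k$ is a primitive $k$-th root of unity. The following properties are true. (1) Any toric $G$-constellation is $C$-stable for some simple chamber $C$. (2) Given a simple chamber $C$ and a $C$-characteristic $G$-constellation $\mathscr F$, there is an algorithm which, starting from (the abstract $G$-stair of) $\mathscr F$, produces (the abstract $G$-stairs of) all the toric $C$-stable $G$-constellations. (3) If $C$ is a simple chamber, all the toric $G$-constellations that admit a $G$-stair with the same generators as the $C$-stair are $C$-stable. In particular, they are $C$-characteristic.
   Context: Basic setting. Everything is over $\mathbb C$, and $\mathbb N=\{0,1,2,\dots\}$. $G$ is generated by $g_k=\mathrm{diag}(\xi_k^{-1},\xi_k)$ and acts on $\mathbb C[x,y]$ by $g\cdot p=p\circ g^{-1}$. Its irreducible representations are $\rho_i$, $\rho_i(g_k)=\xi_k^i$, $i=0,\dots,k-1$ (indices modulo $k$); thus $x^iy^j$ belongs to $\rho_{i-j}$. A $G$-constellation is a coherent $G$-equivariant sheaf $\mathscr F$ on $\mathbb A^2$ with $H^0(\mathbb A^2,\mathscr F)\cong\mathbb C[G]$ as representations; it is identified with the $G$-equivariant $\mathbb C[x,y]$-module $H^0(\mathbb A^2,\mathscr F)$. It is indecomposable if it is not a direct sum of two proper $G$-subsheaves. It is toric if it is indecomposable and admits a structure of equivariant sheaf for the standard torus $\mathbb T^2=(\mathbb C^* )^2$ acting diagonally on $\mathbb A^2$ (equivalently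 it is a torus-fixed point of a moduli space of stable $G$-constellations). Stability. $\Theta=\{\theta\in\mathrm{Hom}_{\mathbb Z}(R(G),\mathbb Q)\mid \theta(\mathbb C[G])=0\}$, with $R(G)$ the representation ring. $\mathscr F$ is $\theta$-(semi)stable if $\theta(H^0(\mathscr E))>0$ ($\ge0$) for every $G$-equivariant subsheaf $0\subsetneq\mathscr E\subsetneq\mathscr F$; $\theta$ is generic if $\theta$-semistability is equivalent to $\theta$-stability; $\Theta^{\mathrm{gen}}$ is the set of generic $\theta$. It is a disjoint union of finitely many open convex polyhedral cones (its connected components), called chambers; stability is constant on a chamber $C$, so one speaks of $C$-stable $G$-constellations. Stairs. The representation tableau is $\mathscr T_G=\{(i,j,t)\in\mathbb N^2\times\{0,\dots,k-1\}\mid i-j\equiv t \bmod k\}$: boxes of the plane $\mathbb N^2$, the box $(i,j)$ carrying the monomial $x^iy^j$ and the label $\rho_{i-j}$. A Ferrers diagram is a finite $A\subset\mathbb N^2$ with $(\mathbb N^2\smallsetminus A)+\mathbb N^2\subset\mathbb N^2\smallsetminus A$; a skew Ferrers diagram is a difference $A_1\smallsetminus A_2$ of two Ferrers diagrams; it is connected if, for any decomposition of it into two disjoint nonempty subsets, some box of one shares an edge with some box of the other. A stair is a connected skew Ferrers diagram $\Gamma$ (with the labels of $\mathscr T_G$) such that $(m,n)\in\Gamma$ implies $(m\pm1,n\pm1)\notin\Gamma$ (same sign). Its boxes are totally ordered from the upper left (first) to the lower right (last): each successive box is immediately to the right of or immediately below the previous one. A $G$-stair is a stair with exactly $k$ boxes.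 An abstract stair is a labelled diagram that can be realized in $\mathscr T_G$ as a stair. The generators of a stair are its boxes having neither the box immediately to the left nor the box immediately below in the stair. For a skew Ferrers diagram $\Gamma=A_1\smallsetminus A_2$, put $M_\Gamma=I_{A_2}/(I_{A_2}\cap I_{A_1})$ where $I_A$ is the ideal generated by the monomials not in $A$. Each toric $G$-constellation is isomorphic to $M_\Gamma$ for a $G$-stair $\Gamma$, unique as an abstract $G$-stair. The width of a stair is the width of the smallest rectangle containing it. Chamber stairs. For each chamber $C$ there are exactly $k$ toric $C$-stable $G$-constellations $\mathscr F_1,\dots,\mathscr F_k$, ordered so that the abstract $G$-stair $\Gamma_j$ of $\mathscr F_j$ has width $j$. Let $L_j$ be the abstract stair of $2k$ boxes obtained from two copies of $\Gamma_j$ by gluing the right edge of the last box of the first copy to the left edge of the first box of the second copy. Then $\Gamma_{j+1}$ is a substair of $L_j$ meeting the first copy of $\Gamma_j$ in a nonempty final segment of $\Gamma_j$. The abstract $C$-stair $\Gamma_C$ is the abstract stair obtained by gluing, for all $j=1,\dots,k-1$, the stairs $\Gamma_j$ and $\Gamma_{j+1}$ along this common part; a $C$-stair is any realization of $\Gamma_C$ in $\mathscr T_G$. Two abstract stairs have the same generators if they admit realizations in $\mathscr T_G$ whose sets of generators coincide. A toric $C$-stable $G$-constellation is $C$-characteristic if its abstract $G$-stair has the same generators as the abstract $C$-stair. A chamber $C$ is simple if there is at least one $C$-characteristic $G$-constellation. *)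

(* Defs.v *)
From Stdlib Require Import Relation_Operators.
From HB Require Import structures.
From mathcomp Require Import all_boot all_order all_algebra finmap.
From mathcomp Require Import reals complex mpoly.

Set Implicit Arguments.
Unset Strict Implicit.
Unset Printing Implicit Defensive.

Import Order.TTheory GRing.Theory Num.Theory.

Local Open Scope fset_scope.
Local Open Scope ring_scope.

(* Stairs. The box (i, j) of the plane carries the monomial x^i y^j; "right"
   increases i, "above" increases j.                                          *)

Definition box := (nat * nat)%type.

Definition addb (b c : box) : box := ((b.1 + c.1)%N, (b.2 + c.2)%N).

Definition ferrers (A : {fset box}) : Prop :=
  forall b c : box, b \notin A -> addb b c \notin A.

Definition skew_ferrers (Gam : {fset box}) : Prop :=
  exists A1 A2 : {fset box}, [/\ ferrers A1, ferrers A2 & Gam = A1 `\` A2].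

Definition share_edge (b c : box) : bool :=
  ((b.1 == c.1) && ((c.2 == b.2.+1) || (b.2 == c.2.+1))) ||
  ((b.2 == c.2) && ((c.1 == b.1.+1) || (b.1 == c.1.+1))).

Definition connected_diagram (Gam : {fset box}) : Prop :=
  forall B1 B2 : {fset box}, B1 != fset0 -> B2 != fset0 ->
    B1 `|` B2 = Gam -> B1 `&` B2 = fset0 ->
    exists b c, [/\ b \in B1, c \in B2 & share_edge b c].

(* The condition on (m - 1, n - 1) is the last one below, read from the other
   box.                                                                       *)
Definition stair (Gam : {fset box}) : Prop :=
  [/\ skew_ferrers Gam, connected_diagram Gam &
      forall m n, (m, n) \in Gam -> (m.+1, n.+1) \notin Gam].

Definition Gstair (k : nat) (Gam : {fset box}) : Prop :=
  stair Gam /\ #|` Gam| = k.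

(* The order of the boxes of a stair, from upper left to lower right. *)
Definition before (b c : box) : bool := (b.1 <= c.1)%N && (c.2 <= b.2)%N.

Definition first_box (Gam : {fset box}) (f : box) : Prop :=
  f \in Gam /\ forall b, b \in Gam -> before f b.

Definition last_box (Gam : {fset box}) (l : box) : Prop :=
  l \in Gam /\ forall b, b \in Gam -> before b l.

Definition lists (s : seq box) (Gam : {fset box}) : Prop :=
  [/\ uniq s, sorted before s & s =i Gam].

(* Horizontal extent: largest abscissa - smallest abscissa + 1. *)
Definition width (Gam : {fset box}) : nat :=
  \max_(b <- Gam) \max_(c <- Gam) (b.1.+1 - c.1)%N.

Definition generators (Gam : {fset box}) : {fset box} :=
  [fset b in Gam | ~~ ((0 < b.1)%N && ((b.1.-1, b.2) \in Gam)) &&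
                   ~~ ((0 < b.2)%N && ((b.1, b.2.-1) \in Gam))].

(* The index t of the irreducible representation rho_t labelling a box. *)
Definition label (k : nat) (b : box) : int := ((b.1%:Z - b.2%:Z) %% k%:Z)%Z.

(* Two diagrams of the tableau realize the same abstract (labelled) diagram iff
   they differ by a translation, by u - v, that preserves the labels.         *)
Definition same_abstract (k : nat) (Gam Del : {fset box}) : Prop :=
  exists u v : box, label k u = label k v /\
    [fset addb b u | b in Gam] = [fset addb b v | b in Del].

Definition same_generators (k : nat) (Gam Del : {fset box}) : Prop :=
  exists Gam' Del' : {fset box}, [/\ same_abstract k Gam Gam',
    same_abstract k Del Del' & generators Gam' = generators Del'].

(* Del is placed in the stair of two copies of Gam, the second copy being
   Gam + (l + (1, 0) - f), where f and l are the first and last boxes of Gam;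
   Del meets the first copy, Gam itself, in a nonempty final segment. Boxes of
   the second copy outside the quadrant play no role, as Del lies inside.     *)
Definition glued (Gam Del : {fset box}) : Prop :=
  exists f l : box, [/\ first_box Gam f, last_box Gam l,
    forall b, b \in Del -> b \in Gam \/
      exists2 b', b' \in Gam & addb b f = addb b' (addb l (1%N, 0%N)),
    Gam `&` Del != fset0 &
    forall b c, b \in Gam `&` Del -> c \in Gam -> before b c -> c \in Del].

Section Constellations.

Variables (R : realType) (k : nat) (xi : R[i]).

(* In this section xi stands for a primitive k-th root of unity, and G is
   generated by g = diag(xi^-1, xi).                                          *)

(* The diagonal matrix diag(a, b) acts on polynomials by p |-> p o diag(a, b)^-1,
   so x |-> a^-1 x and y |-> b^-1 y; f is a semilinear lift of that action to a
   module on which x and y act by X and Y.                                    *)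
Definition equivariant (V : vectType R[i]) (X Y : 'End(V)) (a b : R[i])
    (f : 'End(V)) : Prop :=
  forall v, f (X v) = a^-1 *: X (f v) /\ f (Y v) = b^-1 *: Y (f v).

Definition act_poly (a b : R[i]) (p : {mpoly R[i][2]}) : {mpoly R[i][2]} :=
  p \mPo [tuple a^-1 *: 'X_0; b^-1 *: 'X_1].

(* A finite-dimensional G-equivariant C[x,y]-module, x, y and the generator g
   acting by opx, opy and opg, isomorphic to the regular representation C[G]:
   it has a basis which g permutes as it permutes the elements of G by
   translation.                                                               *)
Record constellation := Constellation {
  space : vectType R[i];
  opx : 'End(space);
  opy : 'End(space);
  opg : 'End(space);
  opxy_comm : forall v, opx (opy v) = opy (opx v);
  opg_order : forall v, iter k opg v = v;
  opg_equivariant : equivariant opx opy xi^-1 xi opg;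
  opg_regular : exists2 e : 'I_k -> space,
    basis_of fullv [seq e i | i <- enum 'I_k] &
    forall i, opg (e i) = e (ordS i) }.

Definition Gsub (F : constellation) (U : {vspace space F}) : Prop :=
  [/\ (opx F @: U <= U)%VS, (opy F @: U <= U)%VS & (opg F @: U <= U)%VS].

Definition indecomposable (F : constellation) : Prop :=
  ~ exists U W : {vspace space F}, [/\ Gsub U, Gsub W,
      U != fullv /\ W != fullv, (U + W = fullv)%VS & (U :&: W = 0)%VS].

(* An algebraic representation of the torus (C^* )^2, i.e. a homomorphism whose
   coefficients are Laurent polynomials, compatible with the module structure. *)
Definition torus_structure (F : constellation)
    (tau : R[i] -> R[i] -> 'End(space F)) : Prop :=
  [/\ tau 1 1 = \1%VF,
      forall a b c d, a != 0 -> b != 0 -> c != 0 -> d != 0 ->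
        tau (a * c) (b * d) = (tau a b \o tau c d)%VF,
      exists n m (A : 'I_m -> 'I_m -> 'End(space F)), forall a b,
        a != 0 -> b != 0 ->
        tau a b = (a * b) ^- n *:
          \sum_(i < m) \sum_(j < m) (a ^+ i * b ^+ j) *: A i j &
      forall a b, a != 0 -> b != 0 ->
        equivariant (opx F) (opy F) a b (tau a b)].

Definition toric (F : constellation) : Prop :=
  indecomposable F /\ exists tau, @torus_structure F tau.

(* Stability. As R(G) is free on rho_0, ..., rho_(k-1), a homomorphism from R(G)
   to Q is the vector of its values on the rho_i.                             *)

Definition in_Theta (theta : 'rV[rat]_k) : Prop := \sum_i theta 0 i = 0.

(* The multiplicity of rho_i in U is the dimension of the eigenspace of g in U
   for the eigenvalue rho_i(g) = xi^i.                                        *)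
Definition theta_val (theta : 'rV[rat]_k) (F : constellation)
    (U : {vspace space F}) : rat :=
  \sum_(i < k)
    theta 0 i * (\dim (U :&: passmx.leigenspace (opg F) (xi ^+ i))%VS)%:R.

Definition stable (theta : 'rV[rat]_k) (F : constellation) : Prop :=
  forall U : {vspace space F}, Gsub U -> U != 0%VS -> U != fullv ->
    0 < theta_val theta U.

Definition semistable (theta : 'rV[rat]_k) (F : constellation) : Prop :=
  forall U : {vspace space F}, Gsub U -> U != 0%VS -> U != fullv ->
    0 <= theta_val theta U.

Definition generic (theta : 'rV[rat]_k) : Prop :=
  in_Theta theta /\ forall F, semistable theta F <-> stable theta F.

Definition generic_segment (theta theta' : 'rV[rat]_k) : Prop :=
  forall t : rat, 0 <= t <= 1 -> generic ((1 - t) *: theta + t *: theta').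

(* A connected component of the set of generic parameters, these being
   connected by polygonal lines (Q^k is totally disconnected as a topological
   space).                                                                    *)
Definition chamber (C : 'rV[rat]_k -> Prop) : Prop :=
  exists2 theta0, generic theta0 &
    forall theta, C theta <-> clos_refl_trans _ generic_segment theta0 theta.

Definition Cstable (C : 'rV[rat]_k -> Prop) (F : constellation) : Prop :=
  forall theta, C theta -> stable theta F.

(* I_A *)
Definition mon_ideal (A : {fset box}) (p : {mpoly R[i][2]}) : Prop :=
  exists n (q : 'I_n -> {mpoly R[i][2]}) (m : 'I_n -> box),
    (forall i, m i \notin A) /\
    p = \sum_(i < n) q i * ('X_0 ^+ (m i).1 * 'X_1 ^+ (m i).2).

(* phi restricts to a surjective morphism of G-equivariant modules from I_A2 to
   F with kernel the intersection of I_A2 and I_A1, i.e. it induces an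
   isomorphism from M_Gam to F; its values outside I_A2 are irrelevant.       *)
Definition iso_M (F : constellation) (Gam : {fset box}) : Prop :=
  exists A1 A2 : {fset box},
  [/\ ferrers A1, ferrers A2, Gam = A1 `\` A2 &
  exists phi : {linear {mpoly R[i][2]} -> space F},
  [/\ forall v, exists2 p, mon_ideal A2 p & phi p = v,
      forall p, mon_ideal A2 p -> (phi p = 0 <-> mon_ideal A1 p) &
      forall p, mon_ideal A2 p ->
        [/\ phi ('X_0 * p) = opx F (phi p), phi ('X_1 * p) = opy F (phi p) &
            phi (act_poly xi^-1 xi p) = opg F (phi p)]]].

(* Gam is a realization of the abstract G-stair of the toric constellation F. *)
Definition has_Gstair (F : constellation) (Gam : {fset box}) : Prop :=
  Gstair k Gam /\ iso_M F Gam.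

(* S is a C-stair: the union of compatibly placed realizations of Gamma_1, ...,
   Gamma_k.                                                                   *)
Definition Cstair (C : 'rV[rat]_k -> Prop) (S : {fset box}) : Prop :=
  exists Gam : nat -> {fset box},
  [/\ forall j, (0 < j <= k)%N -> width (Gam j) = j /\
        exists F, [/\ toric F, Cstable C F & has_Gstair F (Gam j)],
      forall j, (0 < j < k)%N -> glued (Gam j) (Gam j.+1) &
      forall b, b \in S <-> exists2 j, (0 < j <= k)%N & b \in Gam j].

Definition same_generators_as_Cstair (C : 'rV[rat]_k -> Prop)
    (F : constellation) : Prop :=
  exists Gam S : {fset box},
    [/\ has_Gstair F Gam, Cstair C S & same_generators k Gam S].

Definition characteristic (C : 'rV[rat]_k -> Prop) (F : constellation) : Prop :=
  [/\ toric F, Cstable C F & same_generators_as_Cstair C F].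

Definition simple_chamber (C : 'rV[rat]_k -> Prop) : Prop :=
  chamber C /\ exists F, characteristic C F.

End Constellations.

(* Algorithms: partial recursive functions on natural numbers, pairs and lists,
   so that stairs can be handled as lists of boxes without a Goedel numbering. *)

Inductive ty := Nat | Pair of ty & ty | List of ty.

Fixpoint den (A : ty) : Type :=
  match A with
  | Nat => nat
  | Pair A B => (den A * den B)%type
  | List A => seq (den A)
  end.

Inductive prog : ty -> ty -> Type :=
| Id A : prog A A
| Comp A B C : prog A B -> prog B C -> prog A C
| MkPair A B C : prog A B -> prog A C -> prog A (Pair B C)
| Fst A B : prog (Pair A B) A
| Snd A B : prog (Pair A B) B
| Zero A : prog A Nat
| Succ : prog Nat Nat
| NatRec A B : prog A B -> prog (Pair A (Pair Nat B)) B -> prog (Pair A Nat) B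
| Nil A B : prog A (List B)
| Cons A : prog (Pair A (List A)) (List A)
| ListRec A B E : prog A B -> prog (Pair A (Pair E (Pair (List E) B))) B ->
    prog (Pair A (List E)) B
| Mu A : prog (Pair A Nat) Nat -> prog A Nat.

(* runs p a b: the program p, on input a, terminates with output b. *)
Fixpoint runs A B (p : prog A B) : den A -> den B -> Prop :=
  match p in prog A B return den A -> den B -> Prop with
  | Id _ => fun a b => b = a
  | Comp _ _ _ p q => fun a c => exists2 b, runs p a b & runs q b c
  | MkPair _ _ _ p q => fun a bc => runs p a bc.1 /\ runs q a bc.2
  | Fst _ _ => fun a b => b = a.1
  | Snd _ _ => fun a b => b = a.2
  | Zero _ => fun _ n => n = 0%N
  | Succ => fun n m => m = n.+1
  | NatRec _ _ p q => fun an =>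
      (fix go n b := match n with
        | 0%N => runs p an.1 b
        | n'.+1 => exists2 b', go n' b' & runs q (an.1, (n', b')) b
        end) an.2
  | Nil _ _ => fun _ s => s = [::]
  | Cons _ => fun xs s => s = xs.1 :: xs.2
  | ListRec _ _ _ p q => fun al =>
      (fix go s b := match s with
        | [::] => runs p al.1 b
        | x :: s' => exists2 b', go s' b' & runs q (al.1, (x, (s', b'))) b
        end) al.2
  | Mu _ p => fun a n => runs p (a, n) 0%N /\
      forall m, (m < n)%N -> exists r, runs p (a, m) r.+1
  end.

Definition Box : ty := Pair Nat Nat.

(* Main.v *)
(* Idea. The McKay quiver of G is a cycle, and a toric constellation is given by
   the edge at which both x and y vanish and, on every other edge, the choice of
   the one of x, y that does not: this is the stair read as a word of steps to the
   right (x) and down (y). With P(n) = theta(rho_0) + ... + theta(rho_(n-1)), which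
   is k-periodic, the constellation with zero edge z is theta-stable iff P < P(z)
   on the x-edges and P > P(z) on the y-edges; theta is generic iff P is injective
   modulo k; a chamber is thus a linear order on the k edges, and its k stairs are
   indexed by z. Gluing them gives a walk in which the stairs are windows. A stair
   with the same generators as this walk is a window preceded only by steps down
   and followed only by steps right, hence one of the stairs of the chamber, and
   the order must then be: x-edges from z on, z, y-edges from z on. Conversely this
   order makes any given stair characteristic, and the stairs of its chamber are
   the windows, preceded by a step down and followed by a step right, of the stair
   prolonged upwards from its first box and rightwards from its last one. *)
From HB Require Import structures.
From Stdlib Require Import Relation_Operators.
Require Import Defs.
From mathcomp Require Import all_boot all_order all_algebra finmap zify ring lra.
From mathcomp Require Import reals complex mpoly.

Set Implicit Arguments.
Unset Strict Implicit.
Unset Printing Implicit Defensive.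

Import Order.TTheory GRing.Theory Num.Theory.

Local Open Scope fset_scope.
Local Open Scope nat_scope.

(** Potentials enter because theta is the discrete derivative of P: after summation by parts, theta
    of a submodule is a sum over the edges at which membership in it changes, and for a string each
    such edge contributes with a fixed sign. Genericity quantifies over all constellations, not only
    the toric ones, so injectivity of P has to be exploited on arbitrary submodules; this is done by
    splitting off a cyclic interval of weights. That a toric constellation has an edge where x and y
    both vanish comes from the one-parameter subgroup (a, a^-1), whose weights could not otherwise
    close up around the cycle. The link with the gluing is the width: the stair with first label z
    has width one more than the number of potentials below P(z), so consecutive stairs start at
    labels of consecutive rank. A window preceded by a step down, followed by a step right and lying
    strictly between two of them would need a rank strictly between consecutive integers. Positions
    are controlled by the content, abscissa minus ordinate, which grows by one at each step. *)

(** * Walks and stairs *)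

(* Edge [m] of [p] is the step from [p m.-1] to [p m]. *)
Definition right_edge (p : nat -> box) m := (p m.-1).1 < (p m).1.

Definition walk (p : nat -> box) a b := forall m, a < m < b ->
  if right_edge p m then p m = ((p m.-1).1.+1, (p m.-1).2)
  else p m.-1 = ((p m).1, (p m).2.+1).

Definition wset (p : nat -> box) a b : {fset box} := [fset p i | i in index_iota a b].

Lemma wsetP p a b x : reflect (exists2 i, a <= i < b & x = p i) (x \in wset p a b).
Proof.
apply: (iffP (imfsetP _ _ _ _)) => [[i ib ->]|[i ib ->]]; exists i => //.
  by rewrite -mem_index_iota.
by rewrite /= mem_index_iota.
Qed.

Lemma mem_wset p a b i : a <= i < b -> p i \in wset p a b.
Proof. by move=> ib; apply/wsetP; exists i. Qed.

Lemma eq_wset p q a b : (forall i, a <= i < b -> p i = q i) ->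
  wset p a b = wset q a b.
Proof.
move=> pq; apply/fsetP => x; apply/wsetP/wsetP => -[i ib ->]; exists i => //.
  exact: pq.
by rewrite pq.
Qed.

Lemma wset_shift p a b o : wset p (a + o) (b + o) = wset (fun i => p (i + o)) a b.
Proof.
apply/fsetP => x; apply/wsetP/wsetP => -[i ib ->].
  by exists (i - o); [lia | rewrite subnK //; lia].
by exists (i + o); [lia | ].
Qed.

Lemma sub_walk p a b a' b' : walk p a b -> a <= a' -> b' <= b -> walk p a' b'.
Proof. by move=> pw aa bb m mb; apply: pw; lia. Qed.

Lemma walk_shift p a b o : walk p (a + o) (b + o) -> walk (fun i => p (i + o)) a b.
Proof.
move=> pw m mb; have := pw (m + o); rewrite /right_edge.
have -> : (m + o).-1 = m.-1 + o by lia.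
by apply; lia.
Qed.

(** A step to the right or down raises the content, abscissa minus ordinate, by one. The last clause
    says so additively, since coordinates are natural numbers. *)
Lemma walk_diff p a b i j : walk p a b -> a <= i -> i <= j -> j < b ->
  [/\ (p i).1 <= (p j).1, (p j).2 <= (p i).2 &
      (p j).1 + (p i).2 = (p i).1 + (p j).2 + (j - i)].
Proof.
move=> pw ai; elim: j => [|j IHj] ij jb.
  by have -> : i = 0 ; [lia|split; lia].
have [<-|ij'] := eqVneq i j.+1; first by split; lia.
have [||h1 h2 h3] := IHj; try lia.
have := pw j.+1; rewrite /=; case: ifP => _ E.
  by rewrite E /=; [split; lia | lia].
by rewrite E /= in h1 h2 h3; [split; lia | lia].
Qed.

Lemma walk_content p a b i j : walk p a b -> a <= i < b -> a <= j < b ->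
  (p j).1 + (p i).2 + i = (p i).1 + (p j).2 + j.
Proof.
move=> pw ib jb; have [ij|ji] := leqP i j.
  by have [|||h1 h2 h3] := walk_diff (i := i) (j := j) pw; lia.
by have [|||h1 h2 h3] := walk_diff (i := j) (j := i) pw; lia.
Qed.

Lemma walk_eq_content p a b i j : walk p a b -> a <= i < b -> a <= j < b ->
  (p i).1 + (p j).2 = (p j).1 + (p i).2 -> i = j.
Proof. by move=> pw ib jb; have := walk_content pw ib jb; lia. Qed.

Lemma walk_inj p a b i j : walk p a b -> a <= i < b -> a <= j < b -> p i = p j -> i = j.
Proof. by move=> pw ib jb pp; apply: walk_eq_content pw ib jb _; rewrite pp; lia. Qed.

Lemma mem_wset_walk p a b c d i : walk p a b -> a <= c -> d <= b -> a <= i < b ->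
  (p i \in wset p c d) = (c <= i < d).
Proof.
move=> pw ac db ib; apply/wsetP/idP => [[j jd pp]|id]; last by exists i.
by have -> // : i = j; apply: walk_inj pw _ _ pp; lia.
Qed.

Lemma card_wset p a b : walk p a b -> #|` wset p a b| = b - a.
Proof.
move=> pw; rewrite card_in_imfset /=; last first.
  by move=> i j; rewrite !mem_index_iota => ib jb; apply: walk_inj pw ib jb.
by rewrite undup_id ?iota_uniq // size_iota.
Qed.

Lemma walk_before p a b i j : walk p a b -> a <= i < b -> a <= j < b ->
  before (p i) (p j) = (i <= j).
Proof.
move=> pw ib jb; rewrite /before; have [ij|ji] := leqP i j.
  by have [|||h1 h2 h3] := walk_diff (i := i) (j := j) pw; lia.
by have [|||h1 h2 h3] := walk_diff (i := j) (j := i) pw; lia.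
Qed.

Lemma first_box_wset p a b f : walk p a b -> a < b -> first_box (wset p a b) f -> f = p a.
Proof.
move=> pw ab [/wsetP[i ib ->]] /(_ (p a)); rewrite mem_wset ?leqnn // => /(_ isT).
by rewrite (walk_before pw) ?leqnn // => ia; congr p; lia.
Qed.

Lemma last_box_wset p a b l : walk p a b -> a < b -> last_box (wset p a b) l -> l = p b.-1.
Proof.
move=> pw ab [/wsetP[i ib ->]] /(_ (p b.-1)); rewrite mem_wset; last by lia.
by move=> /(_ isT); rewrite (walk_before pw); try lia; move=> ia; congr p; lia.
Qed.

Lemma wset_first p a b : walk p a b -> a < b -> first_box (wset p a b) (p a).
Proof.
move=> pw ab; split=> [|x /wsetP[i ib ->]]; first by rewrite mem_wset ?leqnn.
by rewrite (walk_before pw) //; lia.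
Qed.

Lemma wset_last p a b : walk p a b -> a < b -> last_box (wset p a b) (p b.-1).
Proof.
move=> pw ab; split=> [|x /wsetP[i ib ->]]; first by rewrite mem_wset //; lia.
by rewrite (walk_before pw) //; lia.
Qed.

Lemma width_wset p a b : walk p a b -> a < b ->
  width (wset p a b) = ((p b.-1).1 - (p a).1).+1.
Proof.
move=> pw ab; apply/eqP; rewrite eqn_leq; apply/andP; split.
  apply/bigmax_leqP_seq => x /wsetP[i ib ->] _.
  apply/bigmax_leqP_seq => y /wsetP[j jb ->] _.
  have [|||h1 _ _] := walk_diff (i := i) (j := b.-1) pw; try lia.
  have [|||h2 _ _] := walk_diff (i := a) (j := j) pw; try lia.
  by apply: leq_trans (leq_sub (h1 : (p i).1.+1 <= (p b.-1).1.+1) h2) _; lia.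
have pa : p a \in wset p a b by rewrite mem_wset //; lia.
have pb : p b.-1 \in wset p a b by rewrite mem_wset //; lia.
apply: (bigmaxn_sup_seq (p b.-1)) => //; apply: (bigmaxn_sup_seq (p a)) => //.
have [|||h1 h2 h3] := walk_diff (i := a) (j := b.-1) pw; try lia.
by rewrite subSn.
Qed.

Lemma walk_abscissa p a b i : walk p a b -> a <= i < b ->
  (p i).1 = (p a).1 + \sum_(a.+1 <= m < i.+1) right_edge p m.
Proof.
move=> pw; elim: i => [|i IHi] ib.
  by have -> : a = 0; [lia | rewrite big_geq ?addn0].
have [<-|ai] := eqVneq a i.+1; first by rewrite big_geq ?addn0.
rewrite big_nat_recr /=; last by lia.
rewrite addnA -IHi; last by lia.
have := pw i.+1; rewrite /=; case: ifP => _ E.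
  by rewrite E /=; lia.
by rewrite [in RHS]E /=; lia.
Qed.

Lemma width_right_edges p a b : walk p a b -> a < b ->
  width (wset p a b) = (\sum_(a.+1 <= m < b) right_edge p m).+1.
Proof.
move=> pw ab; rewrite width_wset // (walk_abscissa (i := b.-1) pw); last by lia.
by rewrite prednK ?addKn //; lia.
Qed.

(** The outer diagram consists of the boxes weakly below and left of the walk, the inner one of the
    same boxes without the walk, which runs along the border. *)
Lemma wset_skew p a b : walk p a b -> skew_ferrers (wset p a b).
Proof.
move=> pw.
pose dn : {fset box} := \bigcup_(m <- index_iota a b)
  [fset x in [seq (x, y) | x <- iota 0 (p m).1.+1, y <- iota 0 (p m).2.+1]].
have dnP x : reflect (exists2 m, a <= m < b & (x.1 <= (p m).1) && (x.2 <= (p m).2)) (x \in dn).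
  apply: (iffP (bigfcupP _ _ _ _)) => [[m]|[m mb xm]].
    rewrite mem_index_iota andbT => mb; rewrite in_fset => /allpairsP[z [z1 z2 ->]].
    by exists m => //=; move: z1 z2; rewrite !mem_iota !add0n !ltnS /= => -> ->.
  exists m; first by rewrite mem_index_iota mb.
  rewrite in_fset; apply/allpairsP; exists x; rewrite !mem_iota !add0n !ltnS /=.
  by case/andP: xm => -> ->; case: x.
exists dn, (dn `\` wset p a b); split.
- move=> x y; apply: contra => /dnP[m mb xym]; apply/dnP; exists m => //.
  by rewrite /Defs.addb /= in xym; lia.
- move=> x y; apply: contra; rewrite !inE => /andP[xyw /dnP[m mb xym]].
  rewrite /Defs.addb /= in xym; have xdn : x \in dn by apply/dnP; exists m => //; lia.
  rewrite xdn andbT; apply: contra xyw => /wsetP[i ib xi].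
  (* [Defs.addb x y] lies between [p i] and [p m], hence on the walk. *)
  apply/wsetP; rewrite {x xdn}xi in xym *; have [im|mi] := leqP i m.
    have [|||h1 h2 h3] := walk_diff (i := i) (j := m) pw; try lia.
    have [|||k1 k2 k3] := walk_diff (i := i) (j := i + y.1) pw; try lia.
    have [|||l1 l2 l3] := walk_diff (i := i + y.1) (j := m) pw; try lia.
    by exists (i + y.1); [lia | rewrite [RHS]surjective_pairing; congr pair; lia].
  have [|||h1 h2 h3] := walk_diff (i := m) (j := i) pw; try lia.
  have [|||k1 k2 k3] := walk_diff (i := i - y.2) (j := i) pw; try lia.
  have [|||l1 l2 l3] := walk_diff (i := m) (j := i - y.2) pw; try lia.
  by exists (i - y.2); [lia | rewrite [RHS]surjective_pairing; congr pair; lia].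
- apply/fsetP => x; rewrite !inE negb_and negbK.
  case: (boolP (x \in wset p a b)) => //= [|_]; last by case: (x \in dn).
  by move=> /wsetP[i ib ->]; symmetry; apply/dnP; exists i => //; rewrite !leqnn.
Qed.

Lemma share_edgeC b c : share_edge b c = share_edge c b.
Proof. by rewrite /share_edge; lia. Qed.

Lemma walk_share_edge p a b m : walk p a b -> a < m < b -> share_edge (p m.-1) (p m).
Proof.
move=> pw mb; have := pw m mb; rewrite /share_edge; case: ifP => _ -> /=.
  by rewrite !eqxx orbT.
by rewrite !eqxx orbT.
Qed.

Lemma exists_switch (P : pred nat) i j : i <= j -> P i -> ~~ P j ->
  exists2 m, i < m <= j & P m.-1 && ~~ P m.
Proof.
elim: j => [|j IHj] ij Pi; first by have <- : i = 0; [lia | rewrite Pi].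
move=> Pj1; have [ij'|ij'] := eqVneq i j.+1; first by rewrite -ij' Pi in Pj1.
have [Pj|/IHj[]//] := boolP (P j); first by exists j.+1; [lia | rewrite Pj].
  by lia.
by move=> m mb Pm; exists m => //; lia.
Qed.

Lemma wset_connected p a b : walk p a b -> connected_diagram (wset p a b).
Proof.
move=> pw B1 B2 /fset0Pn[x xB] /fset0Pn[y yB] BU BI.
have [i ib xi] : exists2 i, a <= i < b & x = p i by apply/wsetP; rewrite -BU inE xB.
have [j jb yj] : exists2 j, a <= j < b & y = p j by apply/wsetP; rewrite -BU inE yB orbT.
have B12 z : z \in B1 -> z \notin B2.
  by move=> z1; apply/negP => z2; have := in_fset0 z; rewrite -BI inE z1 z2.
have B2N m : a <= m < b -> p m \notin B1 -> p m \in B2.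
  by move=> mb; have := mem_wset p mb; rewrite -BU inE => /orP[->|].
have [ij|ji] := leqP i j.
  have [||m mb /andP[m1 m2]] := exists_switch (P := fun m => p m \in B1) ij.
  - by rewrite -xi.
  - by apply/negP; rewrite -yj => /B12; rewrite yB.
  exists (p m.-1), (p m); split => //; first by apply: B2N => //; lia.
  by apply: walk_share_edge pw _; lia.
have [||m mb /andP[m1 m2]] := exists_switch (P := fun m => p m \notin B1) (ltnW ji).
- by apply/negP; rewrite -yj => /B12; rewrite yB.
- by rewrite negbK -xi.
exists (p m), (p m.-1); split; [by rewrite negbK in m2|by apply: B2N m1; lia|].
by rewrite share_edgeC; apply: walk_share_edge pw _; lia.
Qed.

Lemma wset_Gstair p a b : walk p a b -> Gstair (b - a) (wset p a b).
Proof.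
move=> pw; split; last exact: card_wset.
split; [exact: wset_skew pw | exact: wset_connected pw |].
move=> m n /wsetP[i ib pi]; apply/negP => /wsetP[j jb pj].
have ij : i = j by apply: walk_eq_content pw ib jb _; rewrite -pi -pj /=; lia.
by move: pj; rewrite -ij -pi => -[]; lia.
Qed.

Lemma skew_convex Gam (x y z : box) : skew_ferrers Gam -> x \in Gam -> z \in Gam ->
  x.1 <= y.1 <= z.1 -> x.2 <= y.2 <= z.2 -> y \in Gam.
Proof.
move=> [A1 [A2 [f1 f2 ->]]]; rewrite !inE => /andP[x2 _] /andP[_ z1] h1 h2.
have split_add (u v : box) : u.1 <= v.1 -> u.2 <= v.2 -> v = Defs.addb u (v.1 - u.1, v.2 - u.2).
  by case: u v => [u1 u2] [v1 v2] /= *; rewrite /Defs.addb /=; congr pair; lia.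
apply/andP; split.
  by rewrite (split_add x y); [apply: f2 | lia | lia].
by apply: contraLR z1; rewrite (split_add y z); [apply: f1 | lia | lia].
Qed.

(* A box of a stair is determined by its content, shifted to a natural number
   [i + (M - j)] by a bound [M] on the ordinates. *)
Lemma stair_walk Gam : stair Gam ->
  exists2 p, walk p 0 #|` Gam| & Gam = wset p 0 #|` Gam|.
Proof.
case=> skew conn diag.
pose M := \max_(x <- Gam) x.2; pose c (x : box) := x.1 + (M - x.2).
have leM (x : box) : x \in Gam -> x.2 <= M.
  by move=> xG; apply: (bigmaxn_sup_seq x).
have cE (x y : box) : x \in Gam -> y \in Gam -> c x + x.2 + y.1 = x.1 + c y + y.2.
  by move=> /leM xM /leM yM; rewrite /c; lia.
(* Of two boxes with equal content, the upper right one would by convexity bring the diagonal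
   successor of the other into [Gam], which [diag] forbids. *)
have cinj (x y : box) : x \in Gam -> y \in Gam -> c x = c y -> x = y.
  have wl : forall x y : box, x \in Gam -> y \in Gam -> c x = c y -> x.1 < y.1 -> False.
    move=> {}x {}y xG yG cxy xy; have h := cE x y xG yG.
    have xG' : (x.1, x.2) \in Gam by rewrite -surjective_pairing.
    have /negP[] := diag _ _ xG'.
    by apply: (skew_convex skew xG yG) => /=; lia.
  move=> xG yG cxy; have h := cE x y xG yG.
  have [xy|xy|xy] := ltngtP x.1 y.1.
  - by case: (wl x y).
  - by case: (wl y x).
  - by rewrite [x]surjective_pairing [y]surjective_pairing; congr pair; lia.
have [G0|] := eqVneq Gam fset0.
  exists (fun=> (0, 0)) => [m|]; rewrite G0 cardfs0; first lia.
  by apply/esym/eqP; rewrite -cardfs_eq0; apply/eqP; rewrite (@card_wset _ 0 0) // => m; lia.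
case/fset0Pn => x0 x0G.
pose img n := [exists x : Gam, c (val x) == n].
have imgP n : reflect (exists2 x, x \in Gam & c x = n) (img n).
  apply: (iffP existsP) => [[x /eqP]|[x xG xn]]; first by exists (val x) => //; exact: fsvalP.
  by exists [` xG]; apply/eqP.
have iex : exists n, img n by exists (c x0); apply/imgP; exists x0.
case: (ex_minnP iex) => lo /imgP[xlo xloG clo] lomin.
have lole (x : box) : x \in Gam -> lo <= c x by move=> xG; apply: lomin; apply/imgP; exists x.
have splitc n : (exists2 x : box, x \in Gam & c x < n) -> (exists2 x : box, x \in Gam & n <= c x) ->
    exists x y : box, [/\ x \in Gam, y \in Gam, share_edge x y & c x < n <= c y].
  move=> [x xG xn] [y yG yn].
  have [||||z [t]] := conn [fset z in Gam | c z < n] [fset z in Gam | n <= c z].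
  - by apply/fset0Pn; exists x; rewrite !inE xG.
  - by apply/fset0Pn; exists y; rewrite !inE yG.
  - by apply/fsetP => z; rewrite !inE; case: (z \in Gam); rewrite ?andbF //=; lia.
  - by apply/fsetP => z; rewrite !inE; case: (z \in Gam); rewrite ?andbF //=; lia.
  by rewrite !inE => -[/andP[zG zn] /andP[tG tn] e]; exists z, t; split=> //; lia.
have edge_c (x y : box) : x \in Gam -> y \in Gam -> share_edge x y -> c x < c y ->
    c y = (c x).+1 /\ (y = (x.1.+1, x.2) \/ x = (y.1, y.2.+1)).
  move=> xG yG; have h := cE x y xG yG; rewrite /share_edge => e cxy; split; first lia.
  move: e => /orP[] /andP[/eqP e1 e2].
    right; rewrite [x]surjective_pairing; congr pair; lia.
  left; rewrite [y]surjective_pairing; congr pair; lia.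
(* No content is skipped: connectedness forbids boxes beyond a missing content [lo + i], so at most
   [i] boxes would remain. *)
have full i : i < #|` Gam| -> img (lo + i).
  move=> iG; apply: contraT => nimg.
  have /fsubset_leq_card : [fset c x | x in Gam] `<=` [fset x in iota lo i].
    apply/fsubsetP => n /imfsetP[x /= xG ->]; rewrite in_fset mem_iota lole //=.
    rewrite ltnNge; apply/negP => ci.
    have lo_lt : exists2 x, x \in Gam & c x < lo + i.
      exists xlo => //; rewrite clo; case: (i) nimg => [|i' _]; last by lia.
      by rewrite addn0 => /imgP[]; exists xlo.
    have [||z [t [zG tG e zt]]] := splitc (lo + i) => //; first by exists x.
    have [ct _] := edge_c z t zG tG e (ltac:(lia)).
    by case/imgP: nimg; exists t => //; lia.
  rewrite card_in_imfset //= card_fseq undup_id ?iota_uniq // size_iota.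
  by rewrite leqNgt iG.
have bx i : exists x, (i < #|` Gam|) ==> ((x \in Gam) && (c x == lo + i)).
  have [iG|] := ltnP i #|` Gam|; last by exists x0.
  by have /imgP[x xG cx] := full i iG; exists x; rewrite xG cx eqxx.
pose p i := xchoose (bx i).
have pP i : i < #|` Gam| -> p i \in Gam /\ c (p i) = lo + i.
  by move=> iG; have /implyP/(_ iG)/andP[? /eqP] := xchooseP (bx i).
have pinj i j : i < #|` Gam| -> j < #|` Gam| -> p i = p j -> i = j.
  by move=> /pP[_ ci] /pP[_ cj] pij; rewrite pij in ci; lia.
exists p.
  move=> m /andP[m0 mG]; have [mG1 cm] := pP m mG.
  have [|mG1' cm'] := pP m.-1; try lia.
  have [||x [y [xG yG e xy]]] := splitc (lo + m).
  - by exists (p m.-1) => //; lia.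
  - by exists (p m) => //; lia.
  have [cy E] := edge_c x y xG yG e (ltac:(lia)).
  have ym : y = p m by apply: cinj => //; lia.
  have xm : x = p m.-1 by apply: cinj => //; lia.
  rewrite /right_edge; move: E; rewrite {}xm {}ym.
  by case=> ->; rewrite /= ?ltnSn ?ltnn.
apply/eqP; rewrite eq_sym eqEfcard; apply/andP; split.
  by apply/fsubsetP => x /wsetP[i ib ->]; have [] := pP i.
rewrite card_in_imfset /= ?undup_id ?iota_uniq ?size_iota ?subn0 //.
by move=> i j; rewrite !mem_index_iota /=; apply: pinj.
Qed.

(** * Listings of a stair *)

Lemma before_trans : transitive before.
Proof. by move=> y x z; rewrite /before; lia. Qed.

Lemma before_anti : antisymmetric before.
Proof. by move=> [x1 x2] [y1 y2]; rewrite /before /= => h; congr pair; lia. Qed.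

Lemma lists_map_walk p a b : walk p a b ->
  lists [seq p i | i <- index_iota a b] (wset p a b).
Proof.
move=> pw; split.
- rewrite map_inj_in_uniq ?iota_uniq // => i j.
  by rewrite !mem_index_iota => ib jb; apply: walk_inj pw ib jb.
- rewrite sorted_map; apply: (sub_in_sorted (P := [pred i | a <= i < b]) (e := ltn)).
  + by move=> i j ib jb /= ij; rewrite (walk_before pw) //; lia.
  + by apply/allP => i; rewrite mem_index_iota.
  + exact: iota_ltn_sorted.
- move=> x; apply/mapP/wsetP => -[i ib ->]; exists i => //.
    by rewrite -mem_index_iota.
  by rewrite mem_index_iota.
Qed.

(** As [before] is transitive and antisymmetric, a stair has a single sorted listing, so the input
    of the algorithm is the walk itself. *)
Lemma lists_walk p a b s : walk p a b -> lists s (wset p a b) ->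
  s = [seq p i | i <- index_iota a b].
Proof.
move=> pw [us ss sE]; have [ut st tE] := lists_map_walk pw.
apply: (sorted_eq before_trans before_anti) => //.
by apply: uniq_perm => // x; rewrite sE tE.
Qed.

(** * Generators, and walks sharing them *)

(** By content, the only box of the walk that can lie left of [p i] is [p i.-1], and the only one
    that can lie below it is [p i.+1]; being a generator thus depends on the two adjacent steps
    alone. *)
Lemma mem_generators p a b i : walk p a b -> a <= i < b ->
  (p i \in generators (wset p a b)) =
  ((i == a) || ~~ right_edge p i) && ((i.+1 == b) || right_edge p i.+1).
Proof.
move=> pw ib; rewrite !inE mem_wset //=; congr andb.
  case: (i =P a) => [ia|ia] /=.
    apply/negP => /andP[i1 /wsetP[j jb pj]].
    by have := walk_content pw ib jb; rewrite -pj /=; lia.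
  have := pw i; case: ifP => _ E.
    by rewrite E /=; [rewrite -surjective_pairing mem_wset //; lia | lia].
  apply/negP => /andP[i1 /wsetP[j jb pj]].
  have h := walk_content pw ib jb; rewrite -pj /= in h.
  have ji : j = i.-1 by lia.
  by move: pj; rewrite ji E; [case; lia | lia].
case: (i.+1 =P b) => [ia|ia] /=.
  apply/negP => /andP[i1 /wsetP[j jb pj]].
  by have := walk_content pw ib jb; rewrite -pj /=; lia.
have := pw i.+1; rewrite /=; case: ifP => _ E.
  apply/negP => /andP[i1 /wsetP[j jb pj]].
  have h := walk_content pw ib jb; rewrite -pj /= in h.
  have ji : j = i.+1 by lia.
  by move: pj; rewrite ji E; [case; lia | lia].
by rewrite E /=; [rewrite -surjective_pairing mem_wset //; lia | lia].
Qed.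

Lemma generators_sub Gam : generators Gam `<=` Gam.
Proof. by apply/fsubsetP => x; rewrite !inE => /andP[]. Qed.

(** The witness is the leftmost box of the row of [p m]: the walk starts there or enters it from
    above, and leaves it to the right. *)
Lemma generator_before p a b m : walk p a b -> a < m < b -> right_edge p m ->
  exists2 i, a <= i < m & (p i \in generators (wset p a b)) && ((p i).2 == (p m).2).
Proof.
move=> pw; elim: m => [|m IHm] mb rm; first by lia.
have E := pw m.+1 mb; rewrite rm in E.
have [am|am] := eqVneq m a.
  by exists m; [lia | rewrite mem_generators // ?am ?eqxx -?am ?rm ?orbT ?E ?eqxx //; lia].
have [rm'|nrm] := boolP (right_edge p m).
  have [|i ib /andP[gi /eqP ei]] := IHm _ rm'; first by lia.
  by exists i; [lia | rewrite gi E ei eqxx].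
by exists m; [lia | rewrite mem_generators ?nrm ?rm ?orbT ?E ?eqxx //; lia].
Qed.

(** Dually, the witness is the lowest box of the column of [p m]. *)
Lemma generator_after p a b m : walk p a b -> a < m < b -> ~~ right_edge p m ->
  exists2 i, m <= i < b & (p i \in generators (wset p a b)) && ((p i).1 == (p m).1).
Proof.
move=> pw; move Dn : (b - m) => n; elim: n m Dn => [|n IHn] m Dn mb rm; first by lia.
have [mb'|mb'] := eqVneq m.+1 b.
  by exists m; [lia | rewrite mem_generators // ?mb' ?eqxx ?rm ?orbT //; lia].
have [rm'|nrm] := boolP (right_edge p m.+1).
  by exists m; [lia | rewrite mem_generators // ?rm ?rm' ?eqxx ?orbT //; lia].
have [||i ib /andP[gi /eqP ei]] := IHn m.+1 _ _ nrm; try lia.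
exists i; first lia.
rewrite gi ei /=; have := pw m.+1; rewrite (negbTE nrm) /= => ->; by [|lia].
Qed.

Lemma exists_generator p a b : walk p a b -> a < b ->
  exists2 i, a <= i < b & p i \in generators (wset p a b).
Proof.
move=> pw ab; have [ab'|ab'] := eqVneq a.+1 b.
  by exists a; [lia | rewrite mem_generators ?ab' ?eqxx //; lia].
have [r|r] := boolP (right_edge p a.+1).
  have [|i ib /andP[gi _]] := generator_before pw _ r; first by lia.
    by exists i; [lia|].
have [|i ib /andP[gi _]] := generator_after pw _ r; first by lia.
by exists i; [lia|].
Qed.

Section SameGenerators.

Variables (p q : nat -> box) (a b c d : nat).
Hypotheses (pw : walk p a b) (qw : walk q c d).
Hypothesis gE : generators (wset p a b) = generators (wset q c d).

(** If [q] went down, it would have a generator below [q j] in the same column. That box would lie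
    on [p] at a later index, but [p] has already left the column. *)
Lemma same_generators_next i j : a <= i -> i.+1 < b -> c <= j -> j.+1 < d ->
  p i = q j -> right_edge p i.+1 -> right_edge q j.+1.
Proof.
move=> ai ib cj jd pq rp; apply: contraT => rq.
have [|j' jb /andP[]] := generator_after qw _ rq; first by lia.
rewrite -gE => /(fsubsetP (generators_sub _))/wsetP[i' ib' qp] /eqP.
have := pw (m := i.+1); rewrite rp /= => E.
have := qw (m := j.+1); rewrite (negbTE rq) /= => E'.
have h1 := walk_content pw (i := i) (j := i') ltac:(lia) ltac:(lia).
have h2 := walk_content qw (i := j) (j := j') ltac:(lia) ltac:(lia).
rewrite qp pq in h1 h2; have ii' : i < i' by lia.
have [|||h3 _ _] := walk_diff (i := i.+1) (j := i') pw; try lia.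
rewrite qp => e.
have {}E : (p i.+1).1 = (q j).1.+1 by rewrite E ?pq //; lia.
have {}E' : (q j).1 = (q j.+1).1 by rewrite E' //=; lia.
by lia.
Qed.

(** If [q] came from above, a generator in the row of [p i] would precede [q j] on [q], whose
    earlier boxes all lie in higher rows. *)
Lemma same_generators_prev i j : a < i < b -> c < j < d ->
  p i = q j -> right_edge p i -> right_edge q j.
Proof.
move=> ib jd pq rp; apply: contraT => rq.
have [i' ib' /andP[]] := generator_before pw ib rp.
rewrite gE => /(fsubsetP (generators_sub _))/wsetP[j' jb' pq'] /eqP e.
have := qw jd; rewrite (negbTE rq) => E'.
have h1 := walk_content pw (i := i) (j := i') ltac:(lia) ltac:(lia).
have h2 := walk_content qw (i := j) (j := j') ltac:(lia) ltac:(lia).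
rewrite pq' pq in h1 h2 e; have jj' : j' <= j.-1 by lia.
have [|||_ h3 _] := walk_diff (i := j') (j := j.-1) qw; try lia.
have {}E' : (q j.-1).2 = (q j).2.+1 by rewrite E'.
by lia.
Qed.

End SameGenerators.

(* The steps of [p] agree with those of [q] as long as both last; the columns
   and rows at the ends of [p] keep [q] from overshooting it. *)
Lemma same_generators_window p N q k : walk p 0 N -> walk q 0 k -> 0 < k <= N ->
  (forall m, 0 < m < k -> ~~ right_edge p m) ->
  (forall m, N - k < m < N -> right_edge p m) ->
  generators (wset p 0 N) = generators (wset q 0 k) ->
  exists o, [/\ o + k <= N, forall i, i < k -> q i = p (o + i),
    forall m, 0 < m <= o -> ~~ right_edge p m &
    forall m, o + k <= m < N -> right_edge p m].
Proof.
move=> pw qw kN pD pR gE; have [|j0 jb qg] := exists_generator qw; first by lia.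
have pg := qg; rewrite -gE in pg.
have /wsetP[i0 ib E0] := fsubsetP (generators_sub _) _ pg.
rewrite E0 mem_generators // in pg.
(* Except at the ends, a generator is entered by a step down and left by a step right. The
   directions of the first and last [k - 1] steps of [p] keep it at least [k - 1] boxes away from
   both ends, enough room to follow [q] either way. *)
have i0k : k <= i0.+1.
  rewrite leqNgt; apply/negP => i0k; have := pD i0.+1; have := pD i0; lia.
have i0N : i0 + k <= N.
  rewrite leqNgt; apply/negP => i0k'; have := pR i0; lia.
have fwd t : j0 + t < k -> q (j0 + t) = p (i0 + t).
  elim: t => [|t IHt] tb; first by rewrite !addn0.
  rewrite !addnS in tb *; have e := IHt ltac:(lia).
  have := qw (j0 + t).+1; have := pw (i0 + t).+1; rewrite /= -e.
  have -> : right_edge p (i0 + t).+1 = right_edge q (j0 + t).+1.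
    apply/idP/idP => r.
      by apply: (same_generators_next pw qw gE _ _ _ _ (esym e) r); lia.
    by apply: (same_generators_next qw pw (esym gE) _ _ _ _ e r); lia.
  case: ifP => _ Ep Eq; first by rewrite Ep ?Eq //; lia.
  move: (Ep ltac:(lia)); rewrite Eq; last lia.
  by case: (q _) => q1 q2; case: (p _) => p1 p2 /= [-> ->].
have bwd t : t <= j0 -> q (j0 - t) = p (i0 - t).
  elim: t => [|t IHt] tb; first by rewrite !subn0.
  rewrite !subnS; have e := IHt ltac:(lia).
  have := qw (j0 - t); have := pw (i0 - t); rewrite /= -e.
  have -> : right_edge p (i0 - t) = right_edge q (j0 - t).
    apply/idP/idP => r.
      by apply: (same_generators_prev pw qw gE _ _ (esym e) r); lia.
    by apply: (same_generators_prev qw pw (esym gE) _ _ e r); lia.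
  case: ifP => _ Ep Eq; last by rewrite Ep ?Eq //; lia.
  move: (Ep ltac:(lia)); rewrite Eq; last lia.
  by case: (q _) => q1 q2; case: (p _) => p1 p2 /= [-> ->].
have qp i : i < k -> q i = p (i0 - j0 + i).
  move=> ik; have [ij|ji] := leqP i j0.
    have := bwd (j0 - i); rewrite (_ : j0 - (j0 - i) = i); last lia.
    by rewrite (_ : i0 - (j0 - i) = i0 - j0 + i); [apply; lia | lia].
  have := fwd (i - j0); rewrite (_ : j0 + (i - j0) = i); last lia.
  by rewrite (_ : i0 + (i - j0) = i0 - j0 + i); [apply; lia | lia].
have gwin i : i < N -> p i \in generators (wset p 0 N) -> i0 - j0 <= i < i0 - j0 + k.
  move=> iN; rewrite gE => /(fsubsetP (generators_sub _))/wsetP[j jk].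
  rewrite qp; last by lia.
  by move=> /(walk_inj pw) ij; have := ij ltac:(lia) ltac:(lia); lia.
(* A step right before the window, or a step down after it, would produce a generator outside the
   window, against [gwin]. *)
exists (i0 - j0); split=> // [|m mb|m mb]; first by lia.
  apply/negP => r; have [|i im /andP[/gwin]] := generator_before pw _ r; lia.
apply: contraT => r; have [|i im /andP[/gwin]] := generator_after pw _ r; lia.
Qed.

(** * Arithmetic modulo k and translations of walks *)

Lemma modn_eq_addP a b k : a = b %[mod k] -> a <= b -> exists t, b = a + t * k.
Proof.
move=> ab le; have /dvdnP[t bt] : k %| b - a by rewrite -eqn_mod_dvd //; apply/eqP.
by exists t; lia.
Qed.

Lemma modn_eq_small a b c k : a = b %[mod k] -> c <= a < c + k -> c <= b < c + k -> a = b.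
Proof.
move=> ab; have [le|/ltnW le] := leqP a b.
  by have [[|t] ->] := modn_eq_addP ab le; rewrite ?mulSn; lia.
by have [[|t] ->] := modn_eq_addP (esym ab) le; rewrite ?mulSn; lia.
Qed.

(* Position of the residue of [n] in the cyclic order starting at [z]. *)
Definition cyc_pos k z n := (n + (k - z %% k)) %% k.

Lemma cyc_posK k z n : 0 < k -> z + cyc_pos k z n = n %[mod k].
Proof.
move=> k0; rewrite /cyc_pos modnDmr {1}(divn_eq z k).
have -> : z %/ k * k + z %% k + (n + (k - z %% k)) = (z %/ k).+1 * k + n.
  by have := ltn_pmod z k0; rewrite mulSn; lia.
by rewrite modnMDl.
Qed.

Lemma cyc_posD k z m : m < k -> cyc_pos k z (z + m) = m.
Proof.
move=> mk; have k0 : 0 < k by lia.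
apply: (modn_eq_small (k := k) (c := 0)); try lia; last by rewrite ltn_pmod.
by apply/eqP; rewrite -(eqn_modDl z) (eqP (introT eqP (cyc_posK z _ k0))).
Qed.

Lemma cyc_pos_mod k z m n : m = n %[mod k] -> cyc_pos k z m = cyc_pos k z n.
Proof. by move=> mn; rewrite /cyc_pos -modnDml mn modnDml. Qed.

Lemma ltn_cyc_pos k z n : 0 < k -> cyc_pos k z n < k.
Proof. exact: ltn_pmod. Qed.

Lemma same_label k (u v : box) :
  label k u = label k v -> u.1 + v.2 = v.1 + u.2 %[mod k].
Proof.
rewrite /label => /eqP; rewrite -(eqz_modDr (u.2 + v.2)%:Z) => /eqP.
rewrite (_ : _ + _ = (u.1 + v.2)%:Z)%R; last lia.
rewrite (_ : _ + _ = (v.1 + u.2)%:Z)%R; last lia.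
by rewrite !modz_nat => -[].
Qed.

Lemma same_abstract_walk k p a b Del : walk p a b -> same_abstract k (wset p a b) Del ->
  exists q, [/\ walk q a b, Del = wset q a b,
    forall m, a < m < b -> right_edge q m = right_edge p m &
    forall i, a <= i < b -> (q i).1 + (p i).2 = (p i).1 + (q i).2 %[mod k]].
Proof.
move=> pw [u [v [luv E]]].
have iv i : a <= i < b -> exists2 y, y \in Del & Defs.addb (p i) u = Defs.addb y v.
  move=> ib; have : Defs.addb (p i) u \in [fset Defs.addb y v | y in Del].
    by rewrite -E; apply/imfsetP; exists (p i) => //=; apply: mem_wset.
  by case/imfsetP => y /= yD e; exists y.
(* Truncated subtraction is harmless: by [qE] the translate of every box of the walk lies in the
   quadrant. *)
pose q i : box := ((p i).1 + u.1 - v.1, (p i).2 + u.2 - v.2).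
have qE i : a <= i < b -> [/\ q i \in Del, (q i).1 + v.1 = (p i).1 + u.1 &
    (q i).2 + v.2 = (p i).2 + u.2].
  move=> /iv[[y1 y2] yD]; rewrite /Defs.addb /= => -[e1 e2].
  by rewrite /q e1 e2 !addnK.
have rE m : a < m < b -> right_edge q m = right_edge p m.
  move=> mb; rewrite /right_edge.
  have [|_ e1 _] := qE m.-1; first lia.
  by have [|_ e2 _] := qE m; lia.
exists q; split=> // [m mb||i ib].
- have := pw m mb; rewrite rE //.
  have [|_ e1 e2] := qE m.-1; first lia.
  have [|_ e3 e4] := qE m; first lia.
  by case: ifP => _ e5; have /= e6 := congr1 fst e5; have /= e7 := congr1 snd e5;
    rewrite [LHS]surjective_pairing; congr pair; lia.
- apply/fsetP => x; apply/idP/wsetP => [xD|[i ib ->]]; last by have [] := qE i.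
  have : Defs.addb x v \in [fset Defs.addb y u | y in wset p a b].
    by rewrite E; apply/imfsetP; exists x.
  case/imfsetP => y /= /wsetP[i ib ->] e; exists i => //; have [_ e1 e2] := qE i ib.
  move: e1 e2 e; case: x {xD} => x1 x2; rewrite [q i]surjective_pairing /= /Defs.addb /=.
  by move=> e1 e2 [e3 e4]; congr pair; lia.
- have [_ e1 e2] := qE i ib; have := same_label luv.
  move/(congr1 (fun n => ((p i).1 + (p i).2 + n) %% k)); rewrite !modnDmr => e.
  apply/eqP; rewrite -(eqn_modDr (v.1 + v.2)); apply/eqP.
  rewrite (_ : _ + _ = (p i).1 + (p i).2 + (u.1 + v.2)); last lia.
  by rewrite e; congr (_ %% _); lia.
Qed.

(** * Gluing stairs into one walk *)

Lemma steps_leq (o : nat -> nat) n i j : (forall j, 0 < j < n -> o j < o j.+1) ->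
  0 < i <= j -> j <= n -> o i <= o j.
Proof.
move=> oS; elim: j => [|j IHj] ij jn; first by lia.
have [->//|ij'] := eqVneq i j.+1.
by have := IHj ltac:(lia) ltac:(lia); have := oS j; lia.
Qed.

Lemma steps_ltn (o : nat -> nat) n i j : (forall j, 0 < j < n -> o j < o j.+1) ->
  0 < i < j -> j <= n -> o i < o j.
Proof.
move=> oS ij jn; apply: leq_trans (oS i _) _; first by lia.
by apply: (steps_leq oS); lia.
Qed.

(** The first box of [r] must lie in the first copy, and from there [r] follows [p] to the end of
    that copy; excluding [r 0 = p a] makes the shift [d] positive. *)
Lemma glued_window p a k r : walk p a (a + k) -> walk r 0 k -> 0 < k ->
  glued (wset p a (a + k)) (wset r 0 k) -> r 0 <> p a ->
  exists2 d, 0 < d < k & forall i, i < k - d -> r i = p (a + d + i).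
Proof.
move=> pw rw k0 [f [l [ff ll sub /fset0Pn[x xI] fin]]] r0.
have fE := first_box_wset pw ltac:(lia) ff.
have lE := last_box_wset pw ltac:(lia) ll.
have ct i j : a <= i < a + k -> j < k -> r j = p i ->
    forall i' j', a <= i' < a + k -> j' < k -> r j' = p i' -> j' + i = j + i'.
  move=> ib jb rp i' j' ib' jb' rp'.
  have := walk_content pw ib ib'; have := walk_content rw (i := j) (j := j') ltac:(lia) ltac:(lia).
  by rewrite rp rp'; lia.
move: xI; rewrite inE => /andP[/wsetP[i ib ->] /wsetP[t tk pr]].
(* In the second copy, [r 0] would have a larger content than every box of the first copy, in
   particular than the common box [r t]. *)
have r0p : r 0 \in wset p a (a + k).
  have [|//|[y /wsetP[j jb ->]]] := sub (r 0); first by rewrite mem_wset.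
  rewrite fE lE /Defs.addb /= => -[e1 e2].
  have h1 := walk_content pw (i := a) (j := j) ltac:(lia) ltac:(lia).
  have h2 := walk_content pw (i := a) (j := (a + k).-1) ltac:(lia) ltac:(lia).
  have h3 := walk_content pw (i := a) (j := i) ltac:(lia) ltac:(lia).
  have h4 := walk_content rw (i := 0) (j := t) ltac:(lia) ltac:(lia).
  by rewrite -pr in h4; lia.
have /wsetP[s sb rs] := r0p.
have sa : s <> a by move=> sa; apply: r0; rewrite rs sa.
exists (s - a); first lia.
move=> j jk; have -> : a + (s - a) + j = s + j by lia.
have : p (s + j) \in wset r 0 k.
  apply: (fin (p s)).
  - by rewrite inE mem_wset //= -rs mem_wset //; lia.
  - by rewrite mem_wset //; lia.
  - by rewrite (walk_before pw); lia.
move=> /wsetP[j' jb' e]; have := ct s 0 sb k0 rs (s + j) j' ltac:(lia) ltac:(lia) (esym e).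
by move=> ?; rewrite e; congr r; lia.
Qed.

(** The stairs become windows of length [k] of one walk, at increasing offsets [o]. That consecutive
    stairs start at distinct boxes, assumed here, will follow from their distinct widths. *)
Lemma glued_walk k Gam n : 0 < k -> 0 < n ->
  (forall j, 0 < j <= n -> exists2 r, walk r 0 k & Gam j = wset r 0 k) ->
  (forall j, 0 < j < n -> glued (Gam j) (Gam j.+1)) ->
  (forall j x y, 0 < j < n -> first_box (Gam j) x -> first_box (Gam j.+1) y -> y <> x) ->
  exists p o, [/\ o 1 = 0, walk p 0 (o n + k),
    forall j, 0 < j <= n -> Gam j = wset p (o j) (o j + k),
    forall j, 0 < j < n -> o j < o j.+1 < o j + k &
    forall m, m < o n + k -> exists2 j, 0 < j <= n & o j <= m < o j + k].
Proof.
move=> k0; elim: n => // -[_ _ GW _ _|n IHn _ GW gl fb].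
  have [//|r rw GE] := GW 1; exists r, (fun=> 0).
  split=> // [j jb|j|m mb]; last by [exists 1]; last by lia.
  by have -> : j = 1 by lia.
have [//||||p [o [o1 pw GE oS cov]]] := IHn.
- by move=> j jb; apply: GW; lia.
- by move=> j jb; apply: gl; lia.
- by move=> j x y jb; apply: fb; lia.
have [|r rw GrE] := GW n.+2; first lia.
have pw' : walk p (o n.+1) (o n.+1 + k) by apply: sub_walk pw _ _.
have [||d db rE] := glued_window pw' rw k0.
- by rewrite -GrE -GE ?leqnn //; apply: gl; lia.
- apply: (fb n.+1 _ _ ltac:(lia)); rewrite ?GrE ?GE ?leqnn //.
    by apply: wset_first pw' _; lia.
  exact: wset_first rw _.
pose o' j := if j <= n.+1 then o j else o n.+1 + d.
(* The old walk up to the start of the new stair, then the new stair; by [rE] the two agree on the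
   overlap. *)
pose p' m := if m < o n.+1 + d then p m else r (m - (o n.+1 + d)).
have p'E m : m < o n.+1 + k -> p' m = p m.
  rewrite /p' => mk; case: ifP => // om; rewrite rE; last by lia.
  by congr p; lia.
have p'r m : o n.+1 + d <= m -> p' m = r (m - (o n.+1 + d)).
  by rewrite /p' => om; case: ifP => //; lia.
have o'E j : j <= n.+1 -> o' j = o j by rewrite /o' => ->.
have o'n : o' n.+2 = o n.+1 + d by rewrite /o' ltnn.
have omono j : 0 < j <= n.+1 -> o j <= o n.+1.
  by move=> jb; apply: (steps_leq (n := n.+1)) => [i /oS||]; lia.
exists p', o'; split.
- by rewrite o'E.
- rewrite o'n => m mb; have [mo|mo] := ltnP m (o n.+1 + d).+1.
    have := pw m; rewrite /right_edge !p'E; [apply; lia|lia|lia].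
  have := rw (m - (o n.+1 + d)); rewrite /right_edge !p'r; [|lia|lia].
  rewrite (_ : m.-1 - _ = (m - (o n.+1 + d)).-1); last lia.
  by apply; lia.
- move=> j jb; have [jn|jn] := leqP j n.+1.
    rewrite o'E // GE; last lia.
    by apply: eq_wset => i ib; rewrite p'E //; have := omono j; lia.
  have -> : j = n.+2 by lia.
  rewrite o'n GrE; have := wset_shift p' 0 k (o n.+1 + d).
  rewrite add0n [k + _]addnC => ->; apply: eq_wset => i ib.
  by rewrite p'r ?addnK //; lia.
- move=> j jb; have [jn|jn] := ltnP j n.+1; first by rewrite !o'E; [apply: oS|lia|lia]; lia.
  have -> : j = n.+1 by lia.
  by rewrite o'n o'E //; lia.
- rewrite o'n => m mb; have [mo|mo] := ltnP m (o n.+1 + k).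
    by have [j jb ?] := cov m mo; exists j; rewrite ?o'E //; lia.
  by exists n.+2; rewrite ?o'n; lia.
Qed.

Lemma periodicM (T : Type) (k : nat) (f : nat -> T) : (forall m, f (m + k) = f m) ->
  forall t m, f (m + t * k) = f m.
Proof. by move=> per; elim=> [|t IHt] m; rewrite ?addn0 // mulSn addnCA addnC per. Qed.

Lemma periodic_mod (T : Type) (k : nat) (f : nat -> T) : (forall m, f (m + k) = f m) ->
  forall m n, m = n %[mod k] -> f m = f n.
Proof.
move=> per m n mn; have fmod i : f i = f (i %% k).
  by rewrite {1}(divn_eq i k) addnC periodicM.
by rewrite (fmod m) mn -fmod.
Qed.

Lemma big_periodic (T : Type) (idx : T) (op : Monoid.com_law idx) (k : nat) (f : nat -> T) :
  (forall m, f (m + k) = f m) ->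
  forall a, \big[op/idx]_(a <= m < a + k) f m = \big[op/idx]_(0 <= m < k) f m.
Proof.
case: k => [|k] per; first by move=> a; rewrite addn0 !big_geq.
elim=> [|a IHa]; first by rewrite add0n.
rewrite -IHa addSn big_nat_recr /=; last by lia.
rewrite per [RHS]big_ltn; last by lia.
by rewrite [RHS]Monoid.mulmC.
Qed.

(** * Stairs of a chamber *)

Section Ranks.

Variables (k : nat) (Q : nat -> rat).
Hypothesis k_gt0 : 0 < k.
Hypothesis Qper : forall m, Q (m + k) = Q m.
Hypothesis Qinj : forall m n, Q m = Q n -> m = n %[mod k].

Definition rank n := \sum_(0 <= m < k) (Q m < Q n)%R.

Lemma rank_lt m n : (rank m < rank n) = (Q m < Q n)%R.
Proof.
have mono i j : (Q i <= Q j)%R -> rank i <= rank j.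
  by move=> ij; apply: leq_sum => l _; case: ltP => // /lt_le_trans -> .
have smono i j : (Q i < Q j)%R -> rank i < rank j.
  move=> ij; rewrite /rank !(bigD1_seq (i %% k)) ?iota_uniq ?mem_index_iota ?ltn_mod //=.
  have -> : Q (i %% k) = Q i by apply: (periodic_mod Qper); rewrite modn_mod.
  rewrite ltxx ij add0n add1n ltnS; apply: leq_sum => l _.
  by case: ltP => // /lt_trans ->.
apply/idP/idP; last exact: smono.
by apply: contraLR; rewrite -leNgt -leqNgt => /mono.
Qed.

Lemma rank_ltn n : rank n < k.
Proof.
have -> : k = \sum_(0 <= m < k) 1 by rewrite sum_nat_const_nat muln1 subn0.
rewrite /rank !(bigD1_seq (n %% k)) ?iota_uniq ?mem_index_iota ?ltn_mod //=.
have -> : Q (n %% k) = Q n by apply: (periodic_mod Qper); rewrite modn_mod.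
by rewrite ltxx add0n add1n ltnS; apply: leq_sum => l _; case: ltP.
Qed.

Lemma rank_window a : rank a = \sum_(a.+1 <= m < a + k) (Q m < Q a)%R.
Proof.
rewrite /rank -(big_periodic (k := k) _ _ a) => [|m]; last by rewrite Qper.
by rewrite big_ltn ?ltxx //; lia.
Qed.

Lemma rank_inj m n : rank m = rank n -> m = n %[mod k].
Proof.
move=> mn; apply: Qinj; apply/eqP; rewrite eq_le !leNgt -!rank_lt mn.
by rewrite !ltnn.
Qed.

(* The windows [[o j, o j + k)] of the walk [p] are those of a [C]-stair. *)
Variables (p : nat -> box) (o : nat -> nat).
Hypothesis pw : walk p 0 (o k + k).
Hypothesis o1 : o 1 = 0.
Hypothesis oS : forall j, 0 < j < k -> o j < o j.+1 < o j + k.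
Hypothesis pR : forall j m, 0 < j <= k -> o j < m < o j + k ->
  right_edge p m = (Q m < Q (o j))%R.
Hypothesis pwd : forall j, 0 < j <= k -> width (wset p (o j) (o j + k)) = j.

Lemma window_offset_lt i j : 0 < i < j -> j <= k -> o i < o j.
Proof. by move=> ij jk; apply: (steps_ltn (n := k)) => // l /oS; lia. Qed.

Lemma window_offset_le i j : 0 < i <= j -> j <= k -> o i <= o j.
Proof. by move=> ij jk; apply: (steps_leq (n := k)) => // l /oS; lia. Qed.

(** By [pR] the right edges of the window are the positions of potential below [Q (o j)], and the
    width is one more than the number of right edges. *)
Lemma rank_offset j : 0 < j <= k -> (rank (o j)).+1 = j.
Proof.
move=> jb; rewrite -[RHS](pwd jb) (width_right_edges (a := o j)).
- rewrite rank_window; congr _.+1; apply: eq_big_nat => m mb.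
  by rewrite (pR jb).
- by apply: sub_walk pw _ _ => //; have := window_offset_le (i := j) (j := k); lia.
- lia.
Qed.

Lemma offset_surj m : exists2 j, 0 < j <= k & o j = m %[mod k].
Proof.
exists (rank m).+1; first by rewrite rank_ltn.
by apply: rank_inj; apply: succn_inj; rewrite rank_offset ?rank_ltn.
Qed.

Lemma first_window_down m : 0 < m < k -> ~~ right_edge p m.
Proof.
move=> mb; rewrite (pR (j := 1)) ?o1; try lia.
by rewrite -o1 -rank_lt; have := rank_offset (j := 1); lia.
Qed.

Lemma last_window_right m : o k < m < o k + k -> right_edge p m.
Proof.
move=> mb; rewrite (pR (j := k)); try lia.
have := rank_ltn m; have := rank_offset (j := k) ltac:(lia) => rk mk.
rewrite -rank_lt ltn_neqAle; apply/andP; split; last by lia.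
by apply/eqP => /rank_inj e; have := modn_eq_small (c := o k) e; lia.
Qed.

Variable a : nat.
Hypothesis ab : a + k <= o k + k.
Hypothesis aD : forall m, 0 < m <= a -> ~~ right_edge p m.
Hypothesis aR : forall m, a + k <= m < o k + k -> right_edge p m.

(** Were [a] strictly between [o j] and [o j.+1], the step down at [a] and the step right at
    [a + k], read in the windows [j] and [j.+1], would put the rank of [a] strictly between two
    consecutive ranks. *)
Lemma window_offset : exists2 j, 0 < j <= k & a = o j.
Proof.
have [j jb /andP[oj jn]] : exists2 j, 0 < j <= k &
    (o j <= a) && ((j == k) || (a < o j.+1)).
  have ex n : 0 < n <= k -> (exists2 j, 0 < j <= n &
      (o j <= a) && ((j == n) || (a < o j.+1))).
    elim: n => // -[_ _|n IHn nk]; first by exists 1; rewrite ?o1 ?eqxx.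
    have [oa|ao] := leqP (o n.+2) a; first by exists n.+2; rewrite ?oa ?eqxx //; lia.
    have [|j jb /andP[oj jn]] := IHn; first lia.
    exists j; first lia; rewrite oj /=.
    by case/orP: jn => [/eqP->|->]; rewrite ?ao orbT.
  by apply: ex; lia.
have [ja|ja] := eqVneq a (o j); first by exists j.
case/orP: jn => [/eqP jk|ao]; first by exists k; [lia|have := ab; rewrite -jk; lia].
have jk : j < k.
  by rewrite ltn_neqAle; apply/andP; split; [apply/eqP => jk; rewrite jk in oj ja; lia|lia].
have := oS (j := j); have onk := window_offset_le (i := j.+1) (j := k) => oSj.
have := aD (m := a); rewrite (pR jb); last lia.
have := aR (m := a + k); rewrite (pR (j := j.+1)); [|lia|lia].
rewrite Qper -leNgt => h1 h2; have {}h1 := h1 ltac:(lia); have {}h2 := h2 ltac:(lia).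
have neq : a <> o j %[mod k].
  by move=> e; have := modn_eq_small (c := o j) e; lia.
have {}h2 : (Q (o j) < Q a)%R.
  by rewrite lt_neqAle h2 andbT; apply/eqP => e; apply: neq; apply: Qinj.
rewrite -!rank_lt in h1 h2.
by have := rank_offset jb; have := rank_offset (j := j.+1); lia.
Qed.

(* The order of the potentials is forced by the stair: it is increasing along the right
   edges of the window and along its down edges. *)
Lemma window_order m m' : 0 < m < m' -> m' < k ->
  (Q (a + m) < Q a)%R = (Q (a + m') < Q a)%R -> (Q (a + m) < Q (a + m'))%R.
Proof.
move=> mm mk same; have [j jb aj] := window_offset.
have neq i i' : i < i' < k -> a + i <> a + i' %[mod k].
  by move=> ib e; have := modn_eq_small (c := a) e; lia.
case: (ltrgtP (Q (a + m)) (Q (a + m'))) => // [lt|/Qinj/neq]; last by lia.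
have okE i : 0 < i <= k -> o i <= o k by move=> ib; apply: window_offset_le; lia.
have [mX|mY] := ltP (Q (a + m)) (Q a).
  (* The stair starting at the residue of [a + m] begins before [a]. The translate of edge [a + m']
     in it would go right, although all edges up to [a] go down. *)
  have [i ib im] := offset_surj (a + m).
  have Qi : Q (o i) = Q (a + m) by apply: (periodic_mod Qper).
  have ij : i < j.
    by have := mX; rewrite -Qi aj -rank_lt; have := rank_offset ib; have := rank_offset jb; lia.
  have oij : o i < a by rewrite aj; apply: window_offset_lt; lia.
  have [[|t] ti] := modn_eq_addP im ltac:(lia); first by lia.
  rewrite mulSn in ti.
  have [le|gt] := leqP (k + t * k) (a + m').
    have := aD (m := a + m' - t.+1 * k); rewrite (pR ib) mulSn; last lia.
    rewrite Qi (periodic_mod Qper (n := a + m')).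
      by rewrite lt => /(_ ltac:(lia)).
    by rewrite -[in RHS](subnKC le) -mulSn modnMDl.
  lia.
(* Symmetrically, the stair starting at the residue of [a + m'] begins after [a]. A translate of
   edge [a + m] in it lies beyond [a + k], hence goes right, against [lt]. *)
have [i ib im] := offset_surj (a + m').
have Qi : Q (o i) = Q (a + m') by apply: (periodic_mod Qper).
have mY' : (Q a < Q (a + m'))%R.
  rewrite lt_neqAle leNgt -same -leNgt mY andbT; apply/eqP => /Qinj.
  by rewrite -{1}[a]addn0 => /neq; lia.
have ij : j < i.
  by have := mY'; rewrite -Qi aj -rank_lt; have := rank_offset ib; have := rank_offset jb; lia.
have oij : a < o i by rewrite aj; apply: window_offset_lt; lia.
have le : a + m' <= o i.
  rewrite leqNgt; apply/negP => gt; have := modn_eq_small (c := a) im; lia.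
have [t ti] := modn_eq_addP (esym im) le.
have e : Q (a + m + t.+1 * k) = Q (a + m) by exact: periodicM.
have := okE i ib; have := aR (m := a + m + t.+1 * k).
rewrite (pR ib); last by rewrite mulSn; lia.
rewrite e Qi mulSn => h ?; have := h ltac:(lia).
by move=> /(lt_trans lt); rewrite ltxx.
Qed.

End Ranks.

(** * The simple chamber of a stair *)

Section Extension.

Variables (p : nat -> box) (k : nat).
Hypothesis k_gt0 : 0 < k.
Hypothesis pw : walk p 0 k.

(* [p] prolonged by [k] boxes at both ends: the stairs of the simple chamber of
   [p] are windows of this walk. *)
Definition ext i : box :=
  if i < k then ((p 0).1, (p 0).2 + (k - i))
  else if i < k + k then p (i - k)
  else ((p k.-1).1 + (i - (k + k)).+1, (p k.-1).2).

Lemma ext_low i : i < k -> ext i = ((p 0).1, (p 0).2 + (k - i)).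
Proof. by rewrite /ext => ->. Qed.

Lemma ext_mid i : k <= i < k + k -> ext i = p (i - k).
Proof. by move=> ib; rewrite /ext ifN ?ifT //; lia. Qed.

Lemma ext_high i : k + k <= i -> ext i = ((p k.-1).1 + (i - (k + k)).+1, (p k.-1).2).
Proof. by move=> ib; rewrite /ext !ifN //; lia. Qed.

Lemma ext_edgeE m : 0 < m < k + k + k -> right_edge ext m =
  (k < m) && ((k + k <= m) || right_edge p (m - k)).
Proof.
move=> mb; rewrite /right_edge; have [mk|km] := leqP m k => /=.
  rewrite (ext_low (i := m.-1)); last by lia.
  have [mk'|mk'] := ltnP m k; first by rewrite ext_low //= ltnn.
  have -> : m = k by lia.
  by rewrite ext_mid ?subnn ?ltnn //; lia.
have [mkk|mkk] := leqP (k + k) m => /=; last first.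
  rewrite !ext_mid; [|lia|lia].
  by rewrite (_ : (m - k).-1 = m.-1 - k) //; lia.
rewrite (ext_high mkk) /=; have [e|e] := leqP m (k + k).
  rewrite ext_mid; last by lia.
  by rewrite (_ : m.-1 - k = k.-1); lia.
by rewrite ext_high /=; lia.
Qed.

Lemma ext_walk : walk ext 0 (k + k + k).
Proof.
move=> m mb; rewrite ext_edgeE //; have [mk|km] := leqP m k => /=.
  rewrite (ext_low (i := m.-1)); last by lia.
  have [mk'|mk'] := ltnP m k; first by rewrite ext_low //=; congr pair; lia.
  have -> : m = k by lia.
  rewrite ext_mid; last by lia.
  by rewrite subnn; congr pair; lia.
have [mkk|mkk] := leqP (k + k) m => /=; last first.
  rewrite !ext_mid; [|lia|lia].
  have := pw (m := m - k) ltac:(lia).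
  by rewrite (_ : (m - k).-1 = m.-1 - k) //; lia.
rewrite (ext_high mkk) /=; have [e|e] := leqP m (k + k).
  rewrite ext_mid; last by lia.
  by rewrite (_ : m.-1 - k = k.-1); [congr pair; lia|lia].
by rewrite ext_high /=; [congr pair; lia | lia].
Qed.

(* Offset in [ext] of the stair of the simple chamber of [p] whose first box has
   the label of [p m]. The potentials are ordered as these offsets. *)
Definition lft m := let r := m %% k in
  if (0 < r) && right_edge p r then r else r + k.

Lemma lft_mod m : lft m = m %[mod k].
Proof. by rewrite /lft; case: ifP; rewrite ?modnDr modn_mod. Qed.

Lemma lft_bounds m : 0 < lft m < k + k.
Proof. by rewrite /lft; have := ltn_pmod m k_gt0; case: ifP; lia. Qed.

Lemma eq_lft m n : m = n %[mod k] -> lft m = lft n.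
Proof. by rewrite /lft => ->. Qed.

Lemma lft_lft m : lft (lft m) = lft m.
Proof. exact: eq_lft (lft_mod m). Qed.

Lemma lftD m : lft (m + k) = lft m.
Proof. by apply: eq_lft; rewrite modnDr. Qed.

Lemma lft0 : lft 0 = k.
Proof. by rewrite /lft mod0n. Qed.

Lemma lftE m : m < k -> lft m = if (0 < m) && right_edge p m then m else m + k.
Proof. by move=> mk; rewrite /lft modn_small. Qed.

Lemma lft_inj m n : lft m = lft n -> m = n %[mod k].
Proof. by rewrite -(lft_mod m) -(lft_mod n) => ->. Qed.

(** This is the stability of the window at [lft m], with [lft] as potential. Edges of the window
    satisfy [e - k < lft m < e]; in [ext], steps down have [lft e >= e] and steps right have
    [lft e <= e - k]. *)
Lemma right_edge_lft m e : lft m < e < lft m + k ->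
  right_edge ext e = (lft e < lft m).
Proof.
have [n nk ->] : exists2 n, n < k & lft m = lft n.
  by exists (m %% k); rewrite ?ltn_pmod // /lft modn_mod.
move=> eb; have nb := lft_bounds n; rewrite ext_edgeE; last by lia.
move: eb; rewrite (lftE nk).
have [ek|ke] := leqP e k => /=; rewrite ?andbT.
  have [->|ek'] := eqVneq e k.
    have -> : lft k = k by rewrite -[RHS]lft0; apply: eq_lft; rewrite modnn mod0n.
    by case: ifP; lia.
  by rewrite lftE; [case: ifP; case: ifP|]; lia.
have [kke|ekk] := leqP (k + k) e => /=.
  rewrite (_ : lft e = lft (e - (k + k))).
    by case: ifP => rn eb; [lia|rewrite lftE; [case: ifP|]; lia].
  by apply: eq_lft; rewrite -[in LHS](subnK kke) addnA !modnDr.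
rewrite (_ : lft e = lft (e - k)); last first.
  by apply: eq_lft; rewrite -[in LHS](subnK (ltnW ke)) modnDr.
rewrite (lftE (m := e - k)); last by lia.
by case: ifP => rn; case: (right_edge p (e - k)); rewrite ?andbT ?andbF /=; try case: ifP; lia.
Qed.

Definition offset_seq := sort leq [seq lft m | m <- iota 0 k].

Lemma size_offset_seq : size offset_seq = k.
Proof. by rewrite size_sort size_map size_iota. Qed.

Lemma offset_seq_sorted : sorted ltn offset_seq.
Proof.
rewrite ltn_sorted_uniq_leq sort_sorted ?andbT; last exact: leq_total.
rewrite sort_uniq map_inj_in_uniq ?iota_uniq // => i j; rewrite !mem_iota /= add0n => ik jk.
by move/lft_inj; rewrite !modn_small.
Qed.

Definition offset j := nth 0 offset_seq j.-1.

Lemma offset_lft j : 0 < j <= k -> lft (offset j) = offset j.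
Proof.
move=> jb; have : offset j \in offset_seq by rewrite mem_nth ?size_offset_seq; lia.
by rewrite mem_sort => /mapP[m _ ->]; rewrite lft_lft.
Qed.

Lemma lft_offset m : exists2 j, 0 < j <= k & offset j = lft m.
Proof.
have : lft m \in offset_seq.
  rewrite mem_sort; apply/mapP; exists (m %% k); first by rewrite mem_iota ltn_pmod.
  by apply: eq_lft; rewrite modn_mod.
case/(nthP 0) => i; rewrite size_offset_seq => ik im.
by exists i.+1.
Qed.

Lemma offset_mono i j : 0 < i < j -> j <= k -> offset i < offset j.
Proof.
move=> ij jk; rewrite /offset.
apply: (sorted_ltn_nth ltn_trans 0 offset_seq_sorted); rewrite ?inE ?size_offset_seq; lia.
Qed.

Lemma offset_le i j : 0 < i <= j -> j <= k -> offset i <= offset j.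
Proof.
move=> ij jk; have [->//|ne] := eqVneq i j.
by apply/ltnW/offset_mono => //; lia.
Qed.

Lemma offset_count j : 0 < j <= k -> \sum_(0 <= m < k) (lft m < offset j) = j.-1.
Proof.
move=> jb; have -> : \sum_(0 <= m < k) (lft m < offset j) =
    count (fun x => x < offset j) offset_seq.
  rewrite (permP (permEl (perm_sort _ _))) count_map -sum1_count [RHS]big_mkcond /=.
  by rewrite /index_iota subn0; apply: eq_bigr => m _; case: ifP.
have /= := @count_lt_nth _ nat 0 offset_seq j.-1.
by rewrite size_offset_seq ltEnat /= => ->; [|exact: offset_seq_sorted|lia].
Qed.

(** Being [lft 0], the number [k] is itself an offset, so two consecutive offsets lie both in (0, k]
    or both in [k, 2k). *)
Lemma offset_gap j : 0 < j < k -> offset j < offset j.+1 < offset j + k.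
Proof.
move=> jb; rewrite offset_mono /=; [|lia|lia].
have [j0 j0b oj0] := lft_offset 0; rewrite lft0 in oj0.
have [jj|jj] := leqP j0 j.
  have := lft_bounds (offset j.+1); rewrite offset_lft; last by lia.
  have [<-|jj'] := eqVneq j0 j; first by rewrite oj0; lia.
  by have := offset_mono (i := j0) (j := j); lia.
have := lft_bounds (offset j); rewrite offset_lft; last by lia.
have [e|jj'] := eqVneq j0 j.+1; first by rewrite -e oj0; lia.
by have := offset_mono (i := j.+1) (j := j0); lia.
Qed.

Lemma offset_bounds j : 0 < j <= k -> 0 < offset j < k + k.
Proof. by move=> jb; have := lft_bounds (offset j); rewrite offset_lft. Qed.

Lemma offset_walk j : 0 < j <= k -> walk ext (offset j) (offset j + k).
Proof. by move=> jb; apply: sub_walk ext_walk _ _ => //; have := offset_bounds jb; lia. Qed.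

Lemma right_edge_offset j e : 0 < j <= k -> offset j < e < offset j + k ->
  right_edge ext e = (lft e < offset j).
Proof. by move=> jb; rewrite -{1 2 3}(offset_lft jb); apply: right_edge_lft. Qed.

Lemma offset_width j : 0 < j <= k -> width (wset ext (offset j) (offset j + k)) = j.
Proof.
move=> jb; rewrite (width_right_edges (offset_walk jb)); last by lia.
have -> : \sum_((offset j).+1 <= m < offset j + k) right_edge ext m =
    \sum_(offset j <= m < offset j + k) (lft m < offset j).
  rewrite [RHS]big_ltn; last by lia.
  rewrite offset_lft // ltnn add0n; apply: eq_big_nat => m mb.
  by rewrite (right_edge_offset jb).
rewrite (@big_periodic _ _ addn k (fun m => nat_of_bool (lft m < offset j))).
  by rewrite offset_count //; lia.
by move=> m; rewrite lftD.
Qed.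

Lemma no_lft_between j m : 0 < j < k -> m <> offset j %[mod k] ->
  m <> offset j.+1 %[mod k] -> (lft m < offset j.+1) = (lft m < offset j).
Proof.
move=> jb mj mj1; have [i ib im] := lft_offset m.
rewrite -im; have [ij|ij|ij] := ltngtP i j.
- by rewrite !offset_mono //; lia.
- have [ij1|ij1] := eqVneq i j.+1.
    by case: mj1; rewrite -ij1 im lft_mod.
  by have := offset_mono (i := j.+1) (j := i); have := offset_mono (i := j) (j := i); lia.
- by case: mj; rewrite -ij im lft_mod.
Qed.

Lemma offset_glued j : 0 < j < k ->
  glued (wset ext (offset j) (offset j + k)) (wset ext (offset j.+1) (offset j.+1 + k)).
Proof.
move=> jb; have gap := offset_gap jb.
have w1 := offset_walk (j := j) ltac:(lia); have w2 := offset_walk (j := j.+1) ltac:(lia).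
have ub := offset_bounds (j := j.+1) ltac:(lia).
exists (ext (offset j)), (ext (offset j + k).-1); split.
- by apply: wset_first w1 _; lia.
- by apply: wset_last w1 _; lia.
- move=> x /wsetP[e eb ->]; have [ek|ke] := ltnP e (offset j + k).
    by left; apply: mem_wset; lia.
  right; exists (ext (e - k)); first by apply: mem_wset; lia.
  have [d [-> db]] : exists d, e = offset j + k + d /\ d < offset j.+1 - offset j.
    by exists (e - (offset j + k)); lia.
  elim: d {e eb ke} db => [|d IHd] db.
    rewrite addn0 addnK.
    have := ext_walk (m := offset j + k) ltac:(lia).
    (* The second copy is glued to the right edge of the first, so this step must go right. It does,
       its potential [offset j] being below [offset j.+1]. *)
    have -> : right_edge ext (offset j + k).
      rewrite (right_edge_offset (j := j.+1)); [|lia|lia].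
      by rewrite lftD offset_lft; lia.
    by move=> ->; rewrite /Defs.addb /=; congr pair; lia.
  have := IHd ltac:(lia); rewrite /Defs.addb /= => -[e1 e2].
  have := ext_walk (m := offset j + k + d.+1) ltac:(lia).
  have := ext_walk (m := offset j + d.+1) ltac:(lia).
  have e3 : offset j + k + d.+1 - k = offset j + d.+1 by lia.
  have e4 : offset j + k + d - k = offset j + d by lia.
  have e5 : (offset j + k + d.+1).-1 = offset j + k + d by lia.
  have e6 : (offset j + d.+1).-1 = offset j + d by lia.
  rewrite e3 e5 e6; rewrite e4 in e1 e2.
  (* Congruent edges of the two windows have the same direction, since no offset lies between two
     consecutive ones. *)
  have -> : right_edge ext (offset j + k + d.+1) = right_edge ext (offset j + d.+1).
    rewrite (right_edge_offset (j := j.+1)); [|lia|lia].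
    rewrite (right_edge_offset (j := j)); [|lia|lia].
    rewrite addnAC lftD no_lft_between // => e.
      by have := modn_eq_small (c := offset j) e; lia.
    by have := modn_eq_small (c := offset j) e; lia.
  case: ifP => _ h1 h2.
    by rewrite h1 h2 /=; congr pair; lia.
  by rewrite h1 h2 /= in e1 e2; congr pair; lia.
- apply/fset0Pn; exists (ext (offset j.+1)); rewrite inE !mem_wset //; lia.
- move=> x y; rewrite inE => /andP[/wsetP[i ib ->] xin] /wsetP[i' ib' ->].
  rewrite (walk_before w1) // => ii'; move: xin; rewrite !(mem_wset_walk ext_walk) //; lia.
Qed.

Lemma offset_cover m : offset 1 <= m < offset k + k ->
  exists2 j, 0 < j <= k & offset j <= m < offset j + k.
Proof.
move=> mb; have [j0 j0b oj0] := lft_offset 0; rewrite lft0 in oj0.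
have h1 := offset_bounds (j := 1) ltac:(lia); have h2 := offset_bounds (j := k) ltac:(lia).
have [mk|mk] := ltnP m k.
  exists 1; first lia; have [h|h] := eqVneq j0 1; first by rewrite h in oj0; lia.
  by have := offset_mono (i := 1) (j := j0); lia.
have [mkk|mkk] := ltnP m (k + k); first by exists j0; rewrite ?oj0; lia.
by exists k; lia.
Qed.

Lemma offset_ends : offset 1 <= k <= offset k.
Proof.
have [j0 j0b oj0] := lft_offset 0; rewrite lft0 in oj0.
apply/andP; split.
  have [h|h] := eqVneq j0 1; first by rewrite -h oj0.
  by have := offset_mono (i := 1) (j := j0); lia.
have [h|h] := eqVneq j0 k; first by rewrite -{2}h oj0.
by have := offset_mono (i := j0) (j := k); lia.
Qed.

(** Boxes added before [p] are left by a step down and boxes added after it are entered by a step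
    right, so none is a generator; for the same reason the end boxes of [p] keep their status. *)
Lemma generators_ext : generators (wset ext (offset 1) (offset k + k)) =
  generators (wset p 0 k).
Proof.
have h := offset_ends; have b1 := offset_bounds (j := 1) ltac:(lia).
have bk := offset_bounds (j := k) ltac:(lia).
have -> : wset p 0 k = wset ext k (k + k).
  have := wset_shift ext 0 k k; rewrite add0n => ->.
  by apply: eq_wset => i ib; rewrite ext_mid ?addnK //; lia.
have w1 : walk ext (offset 1) (offset k + k) by apply: sub_walk ext_walk _ _; lia.
have w2 : walk ext k (k + k) by apply: sub_walk ext_walk _ _; lia.
apply/fsetP => x; apply/idP/idP => xg.
  have /wsetP[i ib xi] := fsubsetP (generators_sub _) _ xg; rewrite {x}xi in xg *.
  move: xg; rewrite (mem_generators w1) // => /andP[g1 g2].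
  have [ik|ik] := ltnP i k.
    by case/orP: g2 => [/eqP|]; [|rewrite ext_edgeE]; lia.
  have [ikk|ikk] := leqP (k + k) i.
    by case/orP: g1 => [/eqP|]; [|rewrite ext_edgeE]; lia.
  rewrite (mem_generators w2); last by lia.
  apply/andP; split; first by case/orP: g1 => [/eqP|->]; [|rewrite orbT]; lia.
  by case/orP: g2 => [/eqP|->]; [|rewrite orbT]; lia.
have /wsetP[i ib xi] := fsubsetP (generators_sub _) _ xg; rewrite {x}xi in xg *.
move: xg; rewrite (mem_generators w2) // => /andP[g1 g2].
rewrite (mem_generators w1); last by lia.
apply/andP; split.
  case/orP: g1 => [/eqP ->|->]; last by rewrite orbT.
  by rewrite ext_edgeE ?ltnn ?orbT //; lia.
case/orP: g2 => [/eqP->|->]; last by rewrite orbT.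
by rewrite ext_edgeE ?leqnn /= ?orbT; lia.
Qed.

(** Recognizes the offsets from two steps of the walk, a test that a program can perform on a list
    of boxes. *)
Lemma lft_fixed o : 0 < o < k + k ->
  (lft o == o) = ~~ right_edge ext o && right_edge ext (o + k).
Proof.
move=> ob; rewrite !ext_edgeE; [|lia|lia].
have -> : (k < o + k) = true by lia.
rewrite addnK; have [ok|ko] := leqP o k => /=.
  have [->|ok'] := eqVneq o k.
    rewrite (eq_lft (n := 0)) ?modnn ?mod0n // lft0 eqxx.
    by rewrite leqnn.
  have -> : (k + k <= o + k) = false by lia.
  rewrite lftE; last by lia.
  by case: (right_edge p o); rewrite ?andbT ?andbF /=; [case: ifP|]; lia.
have -> : lft o = lft (o - k).
  by apply: eq_lft; rewrite -[in LHS](subnK (ltnW ko)) modnDr.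
rewrite lftE; last by lia.
have -> : (k + k <= o) = false by lia.
have -> : (k + k <= o + k) = true by lia.
have -> : (0 < o - k) = true by lia.
by case: (right_edge p _) => /=; lia.
Qed.

End Extension.

(** * The algorithm *)

(** A total evaluator, suited to rewriting. Unbounded search gets the dummy value 0, so [ev] is tied
    to [runs] for programs without [Mu]. *)
Fixpoint ev A B (p : prog A B) : den A -> den B :=
  match p in prog A B return den A -> den B with
  | Id _ => fun a => a
  | Comp _ _ _ p q => fun a => ev q (ev p a)
  | MkPair _ _ _ p q => fun a => (ev p a, ev q a)
  | Fst _ _ => fun a => a.1
  | Snd _ _ => fun a => a.2
  | Zero _ => fun _ => 0
  | Succ => fun n => n.+1
  | NatRec _ _ p q => fun an =>
      (fix go n := if n is n'.+1 then ev q (an.1, (n', go n')) else ev p an.1) an.2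
  | Defs.Nil _ _ => fun _ => [::]
  | Defs.Cons _ => fun xs => xs.1 :: xs.2
  | ListRec _ _ _ p q => fun al =>
      (fix go s := if s is x :: s' then ev q (al.1, (x, (s', go s'))) else ev p al.1) al.2
  | Mu _ _ => fun _ => 0
  end.

Fixpoint primitive A B (p : prog A B) : bool :=
  match p with
  | Comp _ _ _ p q => primitive p && primitive q
  | MkPair _ _ _ p q => primitive p && primitive q
  | NatRec _ _ p q => primitive p && primitive q
  | ListRec _ _ _ p q => primitive p && primitive q
  | Mu _ _ => false
  | _ => true
  end.

Lemma runs_ev A B (p : prog A B) a : primitive p -> runs p a (ev p a).
Proof.
elim: p a => //= {A B} [A B C p IHp q IHq|A B C p IHp q IHq|A B p IHp q IHq|
  A B E p IHp q IHq] a /andP[pp pq].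
- by exists (ev p a); [apply: IHp | apply: IHq].
- by split; [apply: IHp | apply: IHq].
- elim: a.2 => [|n IHn]; first exact: IHp.
  by eexists; [exact: IHn | exact: IHq].
- elim: a.2 => [|x s IHs]; first exact: IHp.
  by eexists; [exact: IHs | exact: IHq].
Qed.

Section Programs.

Variable A : ty.

Definition succ_prog (p : prog A Nat) : prog A Nat := Comp p Succ.

Definition cons_prog E (p : prog A E) (q : prog A (List E)) : prog A (List E) :=
  Comp (MkPair p q) (Defs.Cons E).

Definition add_prog (p q : prog A Nat) : prog A Nat :=
  Comp (MkPair p q) (NatRec (Id Nat) (Comp (Snd _ _) (Comp (Snd _ _) Succ))).

Definition pred_prog (p : prog A Nat) : prog A Nat :=
  Comp (MkPair (Id A) p) (NatRec (Zero A) (Comp (Snd _ _) (Fst _ _))).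

Definition sub_prog (p q : prog A Nat) : prog A Nat :=
  Comp (MkPair p q) (NatRec (Id Nat) (Comp (Comp (Snd _ _) (Snd _ _))
    (Comp (MkPair (Id Nat) (Id Nat)) (NatRec (Zero Nat) (Comp (Snd _ _) (Fst _ _)))))).

Definition if_prog B (c : prog A Nat) (p q : prog A B) : prog A B :=
  Comp (MkPair (Id A) c) (NatRec q (Comp (Fst _ _) p)).

Definition behead_prog E (p : prog A (List E)) : prog A (List E) :=
  Comp (MkPair (Id A) p) (ListRec (Defs.Nil A E) (Comp (Snd _ _) (Comp (Snd _ _) (Fst _ _)))).

Definition head_prog E (d : prog A E) (p : prog A (List E)) : prog A E :=
  Comp (MkPair (Id A) p) (ListRec d (Comp (Snd _ _) (Fst _ _))).

Definition size_prog E (p : prog A (List E)) : prog A Nat :=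
  Comp (MkPair (Id A) p)
    (ListRec (Zero A) (Comp (Snd _ _) (Comp (Snd _ _) (Comp (Snd _ _) Succ)))).

Definition rcons_prog E (p : prog A (List E)) (q : prog A E) : prog A (List E) :=
  Comp (MkPair q p) (ListRec (Comp (MkPair (Id E) (Defs.Nil E E)) (Defs.Cons E))
    (Comp (Snd _ _) (Comp (MkPair (Fst _ _) (Comp (Snd _ _) (Snd _ _))) (Defs.Cons E)))).

Lemma ev_add p q a : ev (add_prog p q) a = ev p a + ev q a.
Proof. by rewrite /=; elim: (ev q a) => [|n /= ->]; rewrite ?addn0 ?addnS. Qed.

Lemma ev_pred p a : ev (pred_prog p) a = (ev p a).-1.
Proof. by rewrite /=; case: (ev p a). Qed.

Lemma ev_sub p q a : ev (sub_prog p q) a = ev p a - ev q a.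
Proof.
rewrite /=; elim: (ev q a) => [|n /= ->]; rewrite ?subn0 // subnS.
by case: (ev p a - n).
Qed.

Lemma ev_if B c (p q : prog A B) a :
  ev (if_prog c p q) a = if 0 < ev c a then ev p a else ev q a.
Proof. by rewrite /=; case: (ev c a). Qed.

Lemma ev_behead E (p : prog A (List E)) a : ev (behead_prog p) a = behead (ev p a).
Proof. by rewrite /=; case: (ev p a). Qed.

Lemma ev_head E d (p : prog A (List E)) a : ev (head_prog d p) a = head (ev d a) (ev p a).
Proof. by rewrite /=; case: (ev p a). Qed.

Lemma ev_size E (p : prog A (List E)) a : ev (size_prog p) a = size (ev p a).
Proof. by rewrite /=; elim: (ev p a) => //= x s ->. Qed.

Lemma ev_rcons E (p : prog A (List E)) q a : ev (rcons_prog p q) a = rcons (ev p a) (ev q a).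
Proof. by rewrite /=; elim: (ev p a) => //= x s ->. Qed.

End Programs.

Definition zero_box A : prog A Box := MkPair (Zero A) (Zero A).

Lemma ev_NatRecS A B (p : prog A B) q a n :
  ev (NatRec p q) (a, n.+1) = ev q (a, (n, ev (NatRec p q) (a, n))).
Proof. by []. Qed.

Definition drop_prog : prog (Pair (List Box) Nat) (List Box) :=
  NatRec (Id _) (behead_prog (Comp (Snd _ _) (Snd _ _))).

Lemma ev_Comp A B C (p : prog A B) (q : prog B C) a : ev (Comp p q) a = ev q (ev p a).
Proof. by []. Qed.

Lemma ev_MkPair A B C (p : prog A B) (q : prog A C) a : ev (MkPair p q) a = (ev p a, ev q a).
Proof. by []. Qed.

Lemma ev_Fst A B a : ev (Fst A B) a = a.1. Proof. by []. Qed.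

Lemma ev_Snd A B a : ev (Snd A B) a = a.2. Proof. by []. Qed.

Lemma ev_Id A a : ev (Id A) a = a. Proof. by []. Qed.

Lemma ev_Zero A a : ev (Zero A) a = 0. Proof. by []. Qed.

Lemma ev_succ A (p : prog A Nat) a : ev (succ_prog p) a = (ev p a).+1.
Proof. by []. Qed.

Lemma ev_cons A E (p : prog A E) q a : ev (cons_prog p q) a = ev p a :: ev q a.
Proof. by []. Qed.

Lemma ev_drop s n : ev drop_prog (s, n) = drop n s.
Proof.
elim: n => [|n IHn]; first by rewrite drop0.
by rewrite ev_NatRecS ev_behead -add1n -drop_drop drop1 -IHn.
Qed.

Definition nth_prog A (p : prog A (List Box)) (q : prog A Nat) : prog A Box :=
  head_prog (zero_box A) (Comp (MkPair p q) drop_prog).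

Lemma ev_nth A (p : prog A (List Box)) q a :
  ev (nth_prog p q) a = nth (0, 0) (ev p a) (ev q a).
Proof. by rewrite ev_head [ev (Comp _ _) a]ev_drop -nth0 nth_drop addn0. Qed.

Definition evE := (ev_nth, ev_rcons, ev_size, ev_add, ev_pred, ev_sub, ev_if, ev_cons, ev_succ,
  ev_Comp, ev_MkPair, ev_Fst, ev_Snd, ev_Id, ev_Zero).

(** * Prolonging a stair and cutting out its windows *)

Definition up_prog : prog (Pair (List Box) Nat) (List Box) :=
  let b := nth_prog (Fst _ _) (Zero _) in
  NatRec (Id _) (cons_prog (MkPair (Comp b (Fst _ _))
      (add_prog (Comp b (Snd _ _)) (succ_prog (Comp (Snd _ _) (Fst _ _)))))
    (Comp (Snd _ _) (Snd _ _))).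

Lemma ev_up (s : seq box) n : ev up_prog (s, n) =
  [seq ((nth (0, 0) s 0).1, (nth (0, 0) s 0).2 + (n - i)) | i <- iota 0 n] ++ s.
Proof.
elim: n => // n IHn; rewrite ev_NatRecS -/up_prog IHn !evE /=; congr cons.
by congr cat; rewrite (iotaDl 1 0 n) -map_comp.
Qed.

Definition right_prog : prog (Pair (Pair (List Box) (List Box)) Nat) (List Box) :=
  let s := Comp (Fst _ _) (Fst _ _) in
  let b := nth_prog s (pred_prog (size_prog s)) in
  NatRec (Snd _ _) (rcons_prog (Comp (Snd _ _) (Snd _ _))
    (MkPair (add_prog (Comp b (Fst _ _)) (succ_prog (Comp (Snd _ _) (Fst _ _))))
      (Comp b (Snd _ _)))).

Lemma ev_right (s t : seq box) n : ev right_prog ((s, t), n) = t ++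
  [seq ((nth (0, 0) s (size s).-1).1 + i.+1, (nth (0, 0) s (size s).-1).2) | i <- iota 0 n].
Proof.
elim: n => [|n IHn]; first by rewrite cats0.
rewrite ev_NatRecS -/right_prog IHn !evE.
by rewrite -[in RHS](addn1 n) iotaD map_cat catA /= cats1.
Qed.

Definition ext_prog : prog (List Box) (List Box) :=
  let l := size_prog (Id (List Box)) in
  Comp (MkPair (MkPair (Id _) (Comp (MkPair (Id _) l) up_prog)) l) right_prog.

Definition ext_list (s : seq box) : seq box :=
  let b := nth (0, 0) s 0 in let c := nth (0, 0) s (size s).-1 in
  ([seq (b.1, b.2 + (size s - i)) | i <- iota 0 (size s)] ++ s) ++
  [seq (c.1 + i.+1, c.2) | i <- iota 0 (size s)].

Lemma ev_ext s : ev ext_prog s = ext_list s.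
Proof.
by rewrite /ext_prog !evE ev_up ev_right.
Qed.

Lemma nth_ext_list p k i : i < k + k + k ->
  nth (0, 0) (ext_list [seq p i | i <- iota 0 k]) i = ext p k i.
Proof.
move=> ik; have k0 : 0 < k by lia.
rewrite /ext_list size_map size_iota !(nth_map 0) ?size_iota ?prednK // !nth_iota ?prednK // !add0n.
rewrite !nth_cat !size_cat !size_map !size_iota; have [i1|i1] := ltnP i (k + k); last first.
  by rewrite ext_high // (nth_map 0) ?size_iota ?nth_iota //; lia.
have [i2|i2] := ltnP i k.
  by rewrite ext_low // (nth_map 0) ?size_iota ?nth_iota.
by rewrite ext_mid ?i2 // (nth_map 0) ?size_iota ?nth_iota //; lia.
Qed.

Definition window_prog A (t : prog A (List Box)) (k e : prog A Nat) : prog A (List Box) :=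
  Comp (MkPair (MkPair t e) k) (NatRec (Defs.Nil _ _)
    (rcons_prog (Comp (Snd _ _) (Snd _ _))
      (nth_prog (Comp (Fst _ _) (Fst _ _))
        (add_prog (Comp (Fst _ _) (Snd _ _)) (Comp (Snd _ _) (Fst _ _)))))).

Lemma ev_window A t (k e : prog A Nat) a : ev (window_prog t k e) a =
  [seq nth (0, 0) (ev t a) i | i <- iota (ev e a) (ev k a)].
Proof.
rewrite /window_prog ev_Comp !ev_MkPair; elim: (ev k a) => // n IHn.
by rewrite ev_NatRecS IHn !evE -[in RHS](addn1 n) iotaD map_cat /= cats1.
Qed.

(* A window of the prolonged stair belongs to the chamber iff it is preceded by
   a step down and followed by a step to the right. *)
Definition stairs_prog : prog (List Box) (List (List Box)) :=
  let l := size_prog (Id (List Box)) in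
  Comp (MkPair (MkPair ext_prog l) (add_prog l l)) (NatRec (Defs.Nil _ _)
    (let t := Comp (Fst _ _) (Fst _ _) in let k := Comp (Fst _ _) (Snd _ _) in
     let e := Comp (Snd _ _) (Fst _ _) in let out := Comp (Snd _ _) (Snd _ _) in
     let b i := nth_prog t i in
     (* A truncated difference is positive exactly when the strict inequality holds, so it serves as
        a test. The step tested first leads into box [e + 1], where the window starts. *)
     if_prog (sub_prog (Comp (b e) (Snd _ _)) (Comp (b (succ_prog e)) (Snd _ _)))
       (if_prog (sub_prog (Comp (b (add_prog (succ_prog e) k)) (Fst _ _))
           (Comp (b (add_prog e k)) (Fst _ _)))
         (cons_prog (window_prog t k (succ_prog e)) out) out) out)).

Lemma ev_stairs (s : seq box) (l : seq box) :
  let t := ext_list s in let k := size s in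
  l \in (ev stairs_prog s : seq (seq box)) <-> exists e, [/\ e < k + k,
    (nth (0, 0) t e.+1).2 < (nth (0, 0) t e).2,
    (nth (0, 0) t (e + k)).1 < (nth (0, 0) t (e.+1 + k)).1 &
    l = [seq nth (0, 0) t i | i <- iota e.+1 k]].
Proof.
move=> t k; rewrite /stairs_prog ev_Comp !ev_MkPair ev_ext -/t !evE -/k.
elim: (k + k) => [|n IHn]; first by split=> // -[e []].
rewrite ev_NatRecS; set b := ev (NatRec _ _) _ in IHn *.
rewrite !(ev_window, evE) !subn_gt0 addSn /=.
have step : (exists e, [/\ e < n.+1, (nth (0, 0) t e.+1).2 < (nth (0, 0) t e).2,
      (nth (0, 0) t (e + k)).1 < (nth (0, 0) t (e + k).+1).1 &
      l = [seq nth (0, 0) t i | i <- iota e.+1 k]]) <->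
    (l \in b \/ [/\ (nth (0, 0) t n.+1).2 < (nth (0, 0) t n).2,
      (nth (0, 0) t (n + k)).1 < (nth (0, 0) t (n + k).+1).1 &
      l = [seq nth (0, 0) t i | i <- iota n.+1 k]]).
  rewrite IHn; split=> [[e [en e1 e2 e3]]|[[e [en e1 e2 e3]]|[e1 e2 e3]]].
  - have [ne|ne] := eqVneq e n; first by right; rewrite -ne.
    by left; exists e; split=> //; lia.
  - by exists e; split=> //; lia.
  - by exists n; split=> //; lia.
rewrite {}step; case: ifP => [h1|nh1]; last by split=> [lb|[//|[h _ _]]]; [left|rewrite h in nh1].
case: ifP => [h2|nh2]; last by split=> [lb|[//|[_ h _]]]; [left|rewrite h in nh2].
rewrite inE; split=> [/orP[/eqP->|->]|[->|[_ _ ->]]]; [by right|by left|by rewrite orbT|].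
by rewrite eqxx.
Qed.

Local Open Scope ring_scope.

Lemma prim_root_neq0 (K : fieldType) n (z : K) : n.-primitive_root z -> z != 0.
Proof.
move=> zP; apply/eqP => z0; have /eqP := prim_expr_order zP.
by rewrite z0 expr0n -(prednK (prim_order_gt0 zP)) /= eq_sym oner_eq0.
Qed.

(** * Constellations as string modules *)

Section Graded.

Variables (R : realType) (k : nat) (xi : R[i]).
Hypothesis xiP : k.-primitive_root xi.

Let k_gt0 : (0 < k)%N := prim_order_gt0 xiP.

Let kC_neq0 : k%:R != 0 :> R[i].
Proof. by rewrite pnatr_eq0 -lt0n. Qed.

Let xi_neq0 : xi != 0 := prim_root_neq0 xiP.

(** Orthogonality of the characters of the cyclic group, by a geometric sum. *)
Lemma prim_root_sum m n : \sum_(i < k) (xi ^+ m / xi ^+ n) ^+ i =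
  if m == n %[mod k] then k%:R else 0.
Proof.
set z := _ / _; have zE : (z == 1) = (m == n %[mod k]).
  by rewrite -(eq_prim_root_expr xiP) /z -subr_eq0 -[1](divff (expf_neq0 n xi_neq0)) -mulrBl
    mulf_eq0 invr_eq0 (negbTE (expf_neq0 n xi_neq0)) orbF subr_eq0.
rewrite -zE; case: eqP => [->|/eqP z1].
  by rewrite (eq_bigr (fun=> 1)) ?sumr_const ?card_ord // => i _; rewrite expr1n.
apply: (mulfI (x := z - 1)); first by rewrite subr_eq0.
rewrite -subrX1 mulr0 /z expr_div_n -!exprM ![(_ * k)%N]mulnC !exprM.
by rewrite (prim_expr_order xiP) !expr1n divr1 subrr.
Qed.

Lemma dim_constellation (F : constellation k xi) : \dim {: Defs.space F} = k.
Proof.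
have [e eB _] := opg_regular F.
by move: eB; rewrite /basis_of /free => /andP[/eqP <- /eqP ->]; rewrite size_map size_enum_ord.
Qed.

Variable F : constellation k xi.

Lemma iter_opgZ i a (u : Defs.space F) : iter i (opg F) (a *: u) = a *: iter i (opg F) u.
Proof. by elim: i => //= i ->; rewrite linearZ. Qed.

Lemma iter_opgD i (u w : Defs.space F) :
  iter i (opg F) (u + w) = iter i (opg F) u + iter i (opg F) w.
Proof. by elim: i => //= i ->; rewrite linearD. Qed.

(* Projector on the eigenspace of [opg F] for the eigenvalue [xi ^+ n]. *)
Definition isotypic n (u : Defs.space F) : Defs.space F :=
  k%:R^-1 *: \sum_(i < k) (xi ^+ n)^-1 ^+ i *: iter i (opg F) u.

Lemma isotypicD n u w : isotypic n (u + w) = isotypic n u + isotypic n w.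
Proof.
rewrite /isotypic -scalerDr -big_split /=; congr (_ *: _).
by apply: eq_bigr => i _; rewrite iter_opgD scalerDr.
Qed.

Lemma isotypicZ n a u : isotypic n (a *: u) = a *: isotypic n u.
Proof.
rewrite /isotypic [RHS]scalerA [a * _]mulrC -scalerA; congr (_ *: _); rewrite scaler_sumr.
by apply: eq_bigr => i _; rewrite iter_opgZ !scalerA mulrC.
Qed.

Lemma isotypic_sum n (I : finType) (f : I -> Defs.space F) :
  isotypic n (\sum_i f i) = \sum_i isotypic n (f i).
Proof.
apply: (big_morph (isotypic n) (isotypicD n)).
by rewrite -[0](scale0r (0 : Defs.space F)) isotypicZ !scale0r.
Qed.

Lemma isotypic_stable n (U : {vspace Defs.space F}) u :
  (opg F @: U <= U)%VS -> u \in U -> isotypic n u \in U.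
Proof.
move=> gU uU; rewrite memvZ // memv_suml // => i _; rewrite memvZ //.
by elim: (i : nat) => //= j IHj; apply: (subvP gU); apply: memv_img.
Qed.

Lemma isotypic_eigen m n u : opg F u = xi ^+ m *: u ->
  isotypic n u = if m == n %[mod k] then u else 0.
Proof.
move=> gu; have iu i : iter i (opg F) u = (xi ^+ m) ^+ i *: u.
  by elim: i => [|i IHi]; rewrite ?scale1r //= IHi linearZ /= gu scalerA -exprSr.
rewrite /isotypic (eq_bigr (fun i : 'I_k => (xi ^+ m / xi ^+ n) ^+ i *: u)); last first.
  by move=> i _; rewrite iu scalerA mulrC -exprMn.
rewrite -scaler_suml prim_root_sum scalerA; case: eqP => _; last by rewrite mulr0 scale0r.
by rewrite mulVf // scale1r.
Qed.

(** One nonzero weight vector per residue. Each character occurs once in the regular representation,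
    so these vectors form a basis; natural indices read modulo [k] let the cyclic quiver be
    traversed without wrap-around. *)
Definition graded (v : nat -> Defs.space F) :=
  [/\ forall n, v (n + k)%N = v n, forall n, opg F (v n) = xi ^+ n *: v n &
      forall n, v n != 0].

(** The discrete Fourier transform of the basis that [opg F] permutes cyclically. *)
Lemma exists_graded : exists v, graded v.
Proof.
have [e eB eg] := opg_regular F.
have szE : size [seq e i | i <- enum 'I_k] = k by rewrite size_map size_enum_ord.
pose v n := \sum_(i < k) (xi ^+ n)^-1 ^+ i *: e i; exists v; split=> n.
- apply: eq_bigr => i _; congr (_^-1 ^+ i *: _).
  by rewrite exprD (prim_expr_order xiP) mulr1.
- rewrite /v linear_sum scaler_sumr [RHS](reindex_inj (@ordS_inj k)) /=.
  apply: eq_bigr => i _; rewrite linearZ /= eg scalerA; congr (_ *: _).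
  rewrite expr_mod; last by rewrite exprVn -exprM mulnC exprM (prim_expr_order xiP) expr1n invr1.
  by rewrite exprS mulrA divff ?mul1r // expf_neq0.
- apply/eqP => v0; have := basis_free eB; rewrite -[map _ _]/(val [tuple e i | i < k]).
  move/freeP/(_ (fun i => (xi ^+ n)^-1 ^+ i)) => fr.
  have /fr/(_ (Ordinal k_gt0))/eqP : \sum_(i < k) (xi ^+ n)^-1 ^+ i *: [tuple e i | i < k]`_i = 0.
    by rewrite -[RHS]v0 /v; apply: eq_bigr => i _; rewrite -tnth_nth tnth_mktuple.
  by rewrite expr0 oner_eq0.
Qed.

Variable v : nat -> Defs.space F.
Hypothesis vP : graded v.

Lemma graded_isotypic n m : isotypic n (v m) = if m == n %[mod k] then v m else 0.
Proof. by have [_ gv _] := vP; apply: isotypic_eigen. Qed.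

Lemma graded_mod m n : m = n %[mod k] -> v m = v n.
Proof. by have [pv _ _] := vP; apply: periodic_mod. Qed.

Let vt := [tuple v i | i < k].

Let vtE (i : 'I_k) : vt`_i = v i.
Proof. by rewrite -tnth_nth tnth_mktuple. Qed.

Lemma graded_basis : basis_of fullv [tuple v i | i < k].
Proof.
rewrite basisEfree subvf size_tuple dim_constellation leqnn !andbT.
apply/freeP => c c0 i; have [_ _ v0] := vP.
have := congr1 (isotypic i) c0.
rewrite -[in RHS](scale0r (0 : Defs.space F)) isotypicZ scale0r isotypic_sum (bigD1 i) //=.
rewrite big1 => [|j ji]; rewrite vtE isotypicZ graded_isotypic ?eqxx ?addr0.
  by move/eqP; rewrite scaler_eq0 (negbTE (v0 _)) orbF => /eqP.
by rewrite !modn_small // ifN ?scaler0.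
Qed.

Definition coordv n (u : Defs.space F) : R[i] :=
  coord [tuple v i | i < k] (Ordinal (ltn_pmod n k_gt0)) u.

Lemma coordvD n u w : coordv n (u + w) = coordv n u + coordv n w.
Proof. exact: linearD. Qed.

Lemma coordvZ n a u : coordv n (a *: u) = a * coordv n u.
Proof. exact: linearZ. Qed.

Lemma coordv_sum n (I : Type) (r : seq I) (P : pred I) (f : I -> Defs.space F) :
  coordv n (\sum_(i <- r | P i) f i) = \sum_(i <- r | P i) coordv n (f i).
Proof. exact: linear_sum. Qed.

Lemma coordv_mod m n u : m = n %[mod k] -> coordv m u = coordv n u.
Proof. by move=> mn; congr (coord _ _ u); apply: val_inj. Qed.

Lemma coordv_sumE u : u = \sum_(i < k) coordv i u *: v i.
Proof.
rewrite {1}(coord_basis graded_basis (memvf u)); apply: eq_bigr => i _.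
rewrite vtE; congr (coord _ _ u *: _); apply: val_inj.
by rewrite /= modn_small.
Qed.

Lemma coordv_v n m : coordv n (v m) = (m == n %[mod k])%:R.
Proof.
rewrite (graded_mod (n := m %% k)) ?modn_mod //.
have := coord_free (Ordinal (ltn_pmod m k_gt0)) (Ordinal (ltn_pmod n k_gt0))
  (basis_free graded_basis).
by rewrite -tnth_nth tnth_mktuple.
Qed.

Lemma isotypic_coordv n u : isotypic n u = coordv n u *: v n.
Proof.
have nk := ltn_pmod n k_gt0.
rewrite {1}(coordv_sumE u) isotypic_sum (bigD1 (Ordinal nk)) //= isotypicZ graded_isotypic.
rewrite modn_mod eqxx big1 ?addr0 => [|i ni].
  by congr (_ *: _); [apply: coordv_mod; rewrite modn_mod | apply: graded_mod; rewrite modn_mod].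
rewrite isotypicZ graded_isotypic ifN ?scaler0 // (modn_small (ltn_ord i)).
by apply: contra ni => /eqP ni; apply/eqP/val_inj.
Qed.

(** Isotypic projections preserve a g-stable subspace and are scalar multiples of basis vectors.
    Submodules are therefore governed by the set of basis vectors they contain. *)
Lemma graded_mem (U : {vspace Defs.space F}) n u : (opg F @: U <= U)%VS ->
  u \in U -> coordv n u != 0 -> v n \in U.
Proof.
move=> gU uU un; rewrite -[v n](scalerK un) memvZ // -isotypic_coordv.
exact: isotypic_stable.
Qed.

Lemma eigen_coordv n u : opg F u = xi ^+ n *: u -> u = coordv n u *: v n.
Proof. by move=> gu; rewrite -isotypic_coordv (isotypic_eigen _ gu) eqxx. Qed.

(** Equivariance makes x raise the weight by one and y lower it by one, so the module is a
    representation of the cyclic McKay quiver with one-dimensional vertices. *)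
Lemma opx_graded n : opx F (v n) = coordv n.+1 (opx F (v n)) *: v n.+1.
Proof.
apply: eigen_coordv; have [_ gv _] := vP; have [-> _] := opg_equivariant (v n).
by rewrite gv linearZ /= scalerA invrK -exprS.
Qed.

Lemma opy_graded n : opy F (v n.+1) = coordv n (opy F (v n.+1)) *: v n.
Proof.
apply: eigen_coordv; have [_ gv _] := vP; have [_ ->] := opg_equivariant (v n.+1).
by rewrite gv linearZ /= scalerA exprS mulKf.
Qed.

Lemma Gsub_exists (U : {vspace Defs.space F}) : (opg F @: U <= U)%VS -> U != 0%VS ->
  exists2 n, (n < k)%N & v n \in U.
Proof.
move=> gU; rewrite -vpick0 => U0.
have [n nk un] : exists2 n, (n < k)%N & coordv n (vpick U) != 0.
  have [/existsP[i ci]|/existsPn c0] := boolP [exists i : 'I_k, coordv i (vpick U) != 0].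
    by exists i.
  case/eqP: U0; rewrite (coordv_sumE (vpick U)) big1 // => i _.
  by have /negPn/eqP-> := c0 i; rewrite scale0r.
by exists n => //; apply: graded_mem un => //; apply: memv_pick.
Qed.

Lemma graded_full (U : {vspace Defs.space F}) :
  (forall n, (n < k)%N -> v n \in U) -> U = fullv.
Proof.
move=> vU; apply/eqP; rewrite eqEsubv subvf; apply/subvP => u _.
by rewrite (coordv_sumE u) memv_suml // => i _; rewrite memvZ // vU.
Qed.

Definition theta_mod (theta : 'rV[rat]_k) m : rat := theta 0 (Ordinal (ltn_pmod m k_gt0)).

Lemma theta_valE (theta : 'rV[rat]_k) (U : {vspace Defs.space F}) :
  theta_val theta U = \sum_(0 <= m < k) theta_mod theta m * (v m \in U)%:R.
Proof.
rewrite big_mkord; apply: eq_bigr => i _; congr (_ * _).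
  by congr (theta 0 _); apply: val_inj; rewrite /= modn_small.
have [_ gv v0] := vP; congr (_%:R).
have -> : passmx.leigenspace (opg F) (xi ^+ i) = <[v i]>%VS.
  apply/vspaceP => u; rewrite memv_ker add_lfunE opp_lfunE scale_lfunE id_lfunE subr_eq0.
  apply/eqP/vlineP => [gu|[c ->]]; first by exists (coordv i u); apply: eigen_coordv.
  by rewrite linearZ /= gv scalerA mulrC -scalerA.
have [vU|vU] := boolP (v i \in U).
  have /capv_idPr -> : (<[v i]> <= U)%VS by rewrite -memvE.
  by rewrite dim_vline v0.
apply/eqP; rewrite dimv_eq0 -subv0; apply/subvP => u.
rewrite memv_cap memv0 => /andP[uU /vlineP[c uc]].
have [c0|c0] := eqVneq c 0; first by rewrite uc c0 scale0r.
by case/negP: vU; rewrite -[v i](scalerK c0) -uc memvZ.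
Qed.

Definition spanv (J : pred nat) : {vspace Defs.space F} :=
  <<[seq v i | i <- iota 0 k & J i]>>%VS.

Lemma mem_spanv J u : reflect (forall i, (i < k)%N -> ~~ J i -> coordv i u = 0) (u \in spanv J).
Proof.
apply: (iffP idP) => [|u0].
  move/(@coord_span _ _ _ (in_tuple _)) => -> i ik nJi.
  rewrite coordv_sum big1 // => j _; rewrite coordvZ.
  have /mapP[m] := mem_nth 0 (ltn_ord j); rewrite mem_filter mem_iota /= => /andP[Jm mk] ->.
  rewrite coordv_v !modn_small //; case: eqP => [mi|_]; last by rewrite mulr0.
  by rewrite -mi Jm in nJi.
rewrite (coordv_sumE u) memv_suml // => i _.
have [Ji|/u0 -> //] := boolP (J i); last by rewrite scale0r mem0v.
by rewrite memvZ // memv_span //; apply: map_f; rewrite mem_filter Ji mem_iota /=.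
Qed.

Lemma v_spanv J n : (n < k)%N -> (v n \in spanv J) = J n.
Proof.
move=> nk; apply/mem_spanv/idP => [h|Jn i ik nJi].
  by apply: contraT => /(h n nk)/eqP; rewrite coordv_v eqxx oner_eq0.
by rewrite coordv_v !modn_small //; case: eqP => // ni; rewrite -ni Jn in nJi.
Qed.

End Graded.

Section Strings.

Variables (R : realType) (k : nat) (xi : R[i]).
Hypothesis xiP : k.-primitive_root xi.

Let k_gt0 : (0 < k)%N := prim_order_gt0 xiP.

(* The constellation with basis [v z, .., v (z + k - 1)], its only nonzero
   structure maps being [v (z + m.-1) |-> v (z + m)] by [x] when [w m], and
   [v (z + m) |-> v (z + m.-1)] by [y] otherwise, for [0 < m < k]. *)
Definition string (F : constellation k xi) (v : nat -> Defs.space F) z (w : pred nat) :=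
  graded v /\ forall m, (m < k)%N ->
    opx F (v (z + m)%N) = (if (m.+1 < k)%N && w m.+1 then v (z + m.+1)%N else 0) /\
    opy F (v (z + m)%N) = (if (0 < m)%N && ~~ w m then v (z + m.-1)%N else 0).

Section Construction.

Variables (z : nat) (w : pred nat).

Let MX : 'M[R[i]]_k := \matrix_(i, j) ((j == i.+1 :> nat) && w j)%:R.
Let MY : 'M[R[i]]_k := \matrix_(i, j) ((i == j.+1 :> nat) && ~~ w i)%:R.
Let d : 'rV[R[i]]_k := \row_j xi ^+ (z + j).
Let X : 'End('rV[R[i]]_k) := linfun (mulmxr MX).
Let Y : 'End('rV[R[i]]_k) := linfun (mulmxr MY).
Let g : 'End('rV[R[i]]_k) := linfun (mulmxr (diag_mx d)).

Let XY0 : MX *m MY = 0.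
Proof.
apply/matrixP => i j; rewrite !mxE big1 // => l _; rewrite !mxE.
by case: (w l); rewrite /= ?andbF ?mulr0 ?mul0r.
Qed.

Let YX0 : MY *m MX = 0.
Proof.
apply/matrixP => i j; rewrite !mxE big1 // => l _; rewrite !mxE.
case: (j =P l.+1 :> nat) => [jl|]; last by rewrite mulr0.
case: (i =P l.+1 :> nat) => [il|]; last by rewrite mul0r.
have -> : i = j by apply: val_inj; rewrite /= jl.
by case: (w j); rewrite /= ?mulr0 ?mul0r.
Qed.

Let comm u : X (Y u) = Y (X u).
Proof. by rewrite !lfunE /= -!mulmxA XY0 YX0. Qed.

Let iter_g n (u : 'rV_k) : iter n g u = \row_j (u 0 j * xi ^+ ((z + j) * n)).
Proof.
elim: n => [|n IHn]; first by apply/rowP => j; rewrite mxE muln0 mulr1.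
apply/rowP => j; rewrite /= IHn lfunE /= mul_mx_diag !mxE -mulrA -exprD mulnS.
by rewrite addnC.
Qed.

Let order u : iter k g u = u.
Proof.
rewrite iter_g; apply/rowP => j.
by rewrite mxE mulnC exprM (prim_expr_order xiP) expr1n mulr1.
Qed.

Let equiv : equivariant X Y xi^-1 xi g.
Proof.
have xi0 := prim_root_neq0 xiP.
have XE u : X u = u *m MX by rewrite lfunE.
have YE u : Y u = u *m MY by rewrite lfunE.
have gE u : g u = u *m diag_mx d by rewrite lfunE.
move=> u; split.
  rewrite (gE (X u)) (XE u) (XE (g u)) (gE u) -!mulmxA !scalemxAr; congr (u *m _).
  apply/matrixP => i j; rewrite mul_mx_diag mxE mul_diag_mx !mxE invrK.
  case: (j =P i.+1 :> nat) => [->|]; last by rewrite mul0r !mulr0.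
  by rewrite addnS exprSr mulrC mulrA.
rewrite (gE (Y u)) (YE u) (YE (g u)) (gE u) -!mulmxA !scalemxAr; congr (u *m _).
apply/matrixP => i j; rewrite mul_mx_diag mxE mul_diag_mx !mxE.
case: (i =P j.+1 :> nat) => [->|]; last by rewrite mul0r !mulr0.
by rewrite addnS exprSr -mulrA mulVKf // mulrC.
Qed.

Let regular : exists2 e : 'I_k -> 'rV[R[i]]_k,
  basis_of fullv [seq e i | i <- enum 'I_k] & forall i, g (e i) = e (ordS i).
Proof.
(* The orbit of the all-ones vector under [g]; its freeness is Fourier inversion. *)
pose e (i : 'I_k) : 'rV[R[i]]_k := \row_j xi ^+ ((z + j) * i).
exists e => [|i]; last first.
  apply/rowP => j; rewrite lfunE /= mul_mx_diag !mxE -exprD.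
  apply/eqP; rewrite (eq_prim_root_expr xiP) -mulnSr /=.
  by rewrite modnMmr.
rewrite -[map _ _]/(tval (mktuple e)).
rewrite basisEfree subvf size_tuple dimvf /dim /= mul1n leqnn !andbT.
apply/(@freeP _ _ _ (mktuple e)) => c c0 l.
have : \sum_(m < k) (\sum_(i < k) c i * xi ^+ ((z + m) * i)) * (xi ^+ l)^-1 ^+ m = 0.
  rewrite big1 // => m _; have /rowP/(_ m) := c0; rewrite !mxE summxE => h.
  rewrite (_ : \sum_(i < k) _ = 0) ?mul0r // -[RHS]h; apply: eq_bigr => i _.
  by rewrite -tnth_nth tnth_mktuple !mxE.
under eq_bigr do rewrite mulr_suml.
rewrite exchange_big /= (bigD1 l) //= [X in _ + X]big1 => [|i il].
  rewrite addr0 => h.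
  have {h} : c l * xi ^+ (z * l) * \sum_(m < k) (xi ^+ l / xi ^+ l) ^+ m = 0.
    rewrite -[RHS]h mulr_sumr; apply: eq_bigr => m _.
    by rewrite mulnDl exprD exprMn [(m * l)%N]mulnC (exprM _ l m) !mulrA.
  rewrite (prim_root_sum xiP) eqxx => /eqP; rewrite !mulf_eq0 -orbA => /or3P[/eqP//||].
    by rewrite expf_eq0 (negbTE (prim_root_neq0 xiP)) andbF.
  by rewrite pnatr_eq0 -leqn0 leqNgt k_gt0.
transitivity (c i * xi ^+ (z * i) * \sum_(m < k) (xi ^+ i / xi ^+ l) ^+ m).
  rewrite mulr_sumr; apply: eq_bigr => m _.
  by rewrite mulnDl exprD exprMn [(m * i)%N]mulnC (exprM _ i m) !mulrA.
rewrite (prim_root_sum xiP) !modn_small // ifN ?mulr0 //.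
Qed.

Lemma exists_string : exists (F : constellation k xi) v, @string F v z w.
Proof.
exists (Constellation comm order equiv regular).
pose pos n := Ordinal (ltn_cyc_pos z n k_gt0).
have posE m : (m < k)%N -> pos (z + m)%N = m :> nat by exact: cyc_posD.
exists (fun n => delta_mx 0 (pos n)); split.
  split=> n /=.
  - by congr delta_mx; apply: val_inj; apply: cyc_pos_mod; rewrite modnDr.
  - rewrite lfunE /= -rowE; apply/rowP => j; rewrite !mxE eqxx /= eq_sym.
    rewrite -[X in X *+ _]mulr1 -mulrnAr; congr (_ * _).
    by apply/eqP; rewrite (eq_prim_root_expr xiP) cyc_posK.
  - by apply/eqP => /rowP/(_ (pos n)); rewrite !mxE !eqxx => /eqP; rewrite oner_eq0.
move=> m mk /=; rewrite !lfunE /= -!rowE; split; apply/rowP => j; rewrite !mxE posE //.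
  have [mk1|mk1] := ltnP m.+1 k; last first.
    by rewrite mxE (_ : (j == m.+1 :> nat) = false) //; apply/eqP; have := ltn_ord j; lia.
  rewrite /=; case: (j =P m.+1 :> nat) => [jm|jm].
    rewrite -{1}jm; case: (w j); rewrite mxE // (_ : j = pos (z + m.+1)%N) ?eqxx //.
    by apply: val_inj; rewrite [RHS]posE.
  case: (w m.+1); rewrite mxE // (_ : (j == pos _) = false) //.
  by apply/eqP => jp; apply: jm; rewrite jp posE.
case: m mk => [|m] mk; first by rewrite mxE.
rewrite /= eqSS; case: (m =P j :> nat) => [jm|jm] /=.
  case: (w m.+1); rewrite mxE // (_ : j = pos (z + m)%N) ?eqxx //.
  by apply: val_inj; rewrite [RHS]posE //; lia.
case: (w m.+1); rewrite mxE // (_ : (j == pos _) = false) //.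
by apply/eqP => jp; apply: jm; rewrite jp posE //; lia.
Qed.

End Construction.

End Strings.

(** * Stability and chambers *)

Lemma abel_sum (f : nat -> rat) (J : pred nat) n : (0 < n)%N ->
  \sum_(0 <= m < n) (f m.+1 - f m) * (J m)%:R =
  f n * (J n.-1)%:R - f 0 * (J 0)%:R +
    \sum_(1 <= m < n) f m * ((J m.-1)%:R - (J m)%:R).
Proof.
case: n => // n _; elim: n => [|n IHn]; first by rewrite big_nat1 big_geq // addr0 mulrBl.
rewrite big_nat_recr //= IHn [in RHS]big_nat_recr //=; ring.
Qed.

Section Stability.

Variables (R : realType) (k : nat) (xi : R[i]).
Hypothesis xiP : k.-primitive_root xi.

Let k_gt0 : (0 < k)%N := prim_order_gt0 xiP.

Definition potential (theta : 'rV[rat]_k) n := \sum_(0 <= m < n) theta_mod xiP theta m.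

Lemma theta_modD theta m : theta_mod xiP theta (m + k) = theta_mod xiP theta m.
Proof. by congr (theta 0 _); apply: val_inj; rewrite /= modnDr. Qed.

Lemma theta_mod_sum theta : \sum_(0 <= m < k) theta_mod xiP theta m = \sum_i theta 0 i.
Proof.
rewrite big_mkord; apply: eq_bigr => i _; congr (theta 0 _).
by apply: val_inj; rewrite /= modn_small.
Qed.

Lemma potentialD theta n : in_Theta theta -> potential theta (n + k) = potential theta n.
Proof.
move=> th0; rewrite /potential (big_cat_nat (n := n)) ?leq_addr //=.
by rewrite (big_periodic _ (theta_modD theta)) theta_mod_sum th0 addr0.
Qed.

Lemma potential_mod theta m n : in_Theta theta -> m = n %[mod k] ->
  potential theta m = potential theta n.
Proof. by move=> th0; apply: periodic_mod => i; apply: potentialD. Qed.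

Section Graded.

Variables (F : constellation k xi) (v : nat -> Defs.space F).
Hypothesis vP : graded v.

(** Summation by parts over one period starting at [z]; the boundary terms vanish because the
    potential is periodic. *)
Lemma theta_val_jumps theta z (U : {vspace Defs.space F}) : in_Theta theta ->
  theta_val theta U = \sum_(1 <= m < k) (potential theta (z + m) - potential theta z) *
    ((v (z + m.-1)%N \in U)%:R - (v (z + m)%N \in U)%:R).
Proof.
move=> th0; rewrite (theta_valE xiP vP).
pose g m := theta_mod xiP theta m * (v m \in U)%:R.
have gk m : g (m + k)%N = g m.
  by rewrite /g theta_modD; have [-> _ _] := vP.
rewrite -(big_periodic _ gk z) -{1}[z]addn0 [(z + 0)%N]addnC [(z + k)%N]addnC big_addn addnK.
pose f m := potential theta (z + m) - potential theta z.
have -> : \sum_(0 <= i < k) g (i + z)%N =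
    \sum_(0 <= m < k) (f m.+1 - f m) * (v (z + m)%N \in U)%:R.
  apply: eq_bigr => m _; rewrite /g /f addnC; congr (_ * _).
  by rewrite addnS /potential big_nat_recr //=; ring.
have f0 : f 0 = 0 by rewrite /f addn0 subrr.
have fk : f k = 0 by rewrite /f potentialD ?subrr.
rewrite (abel_sum f (fun m => v (z + m)%N \in U)) //.
by rewrite f0 fk !mul0r subrr add0r.
Qed.

Lemma spanv_Gsub (J : pred nat) :
  (forall n, (n < k)%N -> J n -> opx F (v n) \in spanv v J /\ opy F (v n) \in spanv v J) ->
  Gsub (spanv v J).
Proof.
move=> cl; have h (f : 'End(Defs.space F)) :
    (forall n, (n < k)%N -> J n -> f (v n) \in spanv v J) ->
    (f @: spanv v J <= spanv v J)%VS.
  move=> fJ; rewrite limg_span; apply/span_subvP => u /mapP[u' /mapP[n]].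
  by rewrite mem_filter mem_iota => /andP[Jn /= nk] -> ->; apply: fJ.
split; apply: h => n nk Jn; try by case: (cl n nk Jn).
by have [_ -> _] := vP; rewrite memvZ // (v_spanv xiP vP).
Qed.

Definition spanc z (J : pred nat) := spanv v (fun n => J (cyc_pos k z n)).

Lemma v_spanc z (J : pred nat) m : (m < k)%N -> (v (z + m)%N \in spanc z J) = J m.
Proof.
move=> mk; rewrite (graded_mod vP (n := (z + m) %% k)) ?modn_mod //.
rewrite (v_spanv xiP vP) ?ltn_pmod //; congr J.
by rewrite -[RHS](cyc_posD z mk); apply: cyc_pos_mod; rewrite modn_mod.
Qed.

Lemma spanc_Gsub z (J : pred nat) :
  (forall m, (m < k)%N -> J m ->
     opx F (v (z + m)%N) \in spanc z J /\ opy F (v (z + m)%N) \in spanc z J) ->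
  Gsub (spanc z J).
Proof.
move=> cl; apply: spanv_Gsub => n nk Jn.
have -> : v n = v (z + cyc_pos k z n)%N by apply: (graded_mod vP); rewrite cyc_posK.
by apply: cl => //; apply: ltn_cyc_pos.
Qed.

Lemma spanc_neq0 z (J : pred nat) m : (m < k)%N -> J m -> spanc z J != 0%VS.
Proof.
move=> mk Jm; apply/eqP => s0; have := v_spanc z J mk.
by rewrite s0 memv0 Jm; have [_ _ /(_ (z + m)%N)/negbTE->] := vP.
Qed.

Lemma spanc_neqT z (J : pred nat) m : (m < k)%N -> ~~ J m -> spanc z J != fullv.
Proof.
move=> mk /negbTE Jm; apply/eqP => s0; have := v_spanc z J mk.
by rewrite s0 memvf Jm.
Qed.

Lemma exists_in z (U : {vspace Defs.space F}) : Gsub U -> U != 0%VS ->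
  exists2 m, (m < k)%N & v (z + m)%N \in U.
Proof.
case=> _ _ gU /(Gsub_exists xiP vP gU)[n nk nU]; exists (cyc_pos k z n).
  exact: ltn_cyc_pos.
by rewrite (graded_mod vP (cyc_posK z n k_gt0)).
Qed.

Lemma exists_notin z (U : {vspace Defs.space F}) : U != fullv ->
  exists2 m, (m < k)%N & v (z + m)%N \notin U.
Proof.
move=> UT; have [/existsP[i ni]|/existsPn h] := boolP [exists i : 'I_k, v i \notin U].
  exists (cyc_pos k z i); first exact: ltn_cyc_pos.
  by rewrite (graded_mod vP (cyc_posK z i k_gt0)).
case/eqP: UT; apply: (graded_full xiP vP) => n nk.
by have := h (Ordinal nk); rewrite negbK.
Qed.

End Graded.

Lemma string_closed (F : constellation k xi) (v : nat -> Defs.space F) z w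
    (U : {vspace Defs.space F}) m : string v z w -> Gsub U ->
  (0 < m < k)%N ->
  if w m then (v (z + m.-1)%N \in U) ==> (v (z + m)%N \in U)
  else (v (z + m)%N \in U) ==> (v (z + m.-1)%N \in U).
Proof.
move=> [vP wP] [XU YU gU] mb; case: ifP => wm; apply/implyP => vU.
  have [] := wP m.-1 ltac:(lia); rewrite prednK ?wm; last by lia.
  rewrite (_ : (m < k)%N) //=; last by lia.
  by move=> <- _; apply: (subvP XU); apply: memv_img.
have [_] := wP m ltac:(lia); rewrite wm (_ : (0 < m)%N) //=; last by lia.
by move=> <-; apply: (subvP YU); apply: memv_img.
Qed.

(** Cutting the string at edge [m] leaves one submodule: the part after an x-edge, into which x
    maps, or the part before a y-edge, into which y maps. *)
Lemma string_suffix_Gsub (F : constellation k xi) (v : nat -> Defs.space F) z w m :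
  string v z w -> (0 < m < k)%N ->
  Gsub (spanc v z (if w m then leq m else gtn m)).
Proof.
move=> [vP wP] mb; apply: (spanc_Gsub vP) => i ik Ji; have [-> ->] := wP i ik.
case: ifP Ji => wm /= Ji; split; case: ifP => [/andP[h1 h2]|_]; rewrite ?mem0v //
  (v_spanc vP) //=; try lia.
  by have [e|] := eqVneq i m; [rewrite e wm in h2 | lia].
by have [e|] := eqVneq i.+1 m; [rewrite e wm in h2 | lia].
Qed.

Lemma theta_val_suffix (F : constellation k xi) (v : nat -> Defs.space F) z
    (w : pred nat) m theta : in_Theta theta ->
  graded v -> (0 < m < k)%N ->
  theta_val theta (spanc v z (if w m then leq m else gtn m)) =
  if w m then potential theta z - potential theta (z + m)
  else potential theta (z + m) - potential theta z.
Proof.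
move=> th0 vP mb; rewrite (theta_val_jumps vP z _ th0).
rewrite (bigD1_seq m) ?iota_uniq ?mem_index_iota //= big1_seq ?addr0; last first.
  move=> i /andP[im]; rewrite mem_index_iota => ib; rewrite !(v_spanc vP); [|lia|lia].
  case: ifP => _ /=; rewrite (_ : _%:R - _ = 0) ?mulr0 //; apply/eqP; rewrite subr_eq0;
    apply/eqP; congr (_%:R); lia.
rewrite !(v_spanc vP); [|lia|lia].
case: ifP => _ /=.
  by rewrite leqnn (_ : (m <= m.-1)%N = false) /=; [ring | lia].
by rewrite ltnn (_ : (m.-1 < m)%N = true) /=; [ring | lia].
Qed.

(** Necessity tests the submodules obtained by one cut. For sufficiency, every jump of a submodule
    contributes positively, and a proper nonzero submodule has at least one jump. *)
Lemma string_stable (F : constellation k xi) (v : nat -> Defs.space F) z w theta :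
  in_Theta theta -> string v z w ->
  stable theta F <-> forall m, (0 < m < k)%N ->
    if w m then potential theta (z + m) < potential theta z
    else potential theta z < potential theta (z + m).
Proof.
move=> th0 vwP; have [vP wP] := vwP; split=> [st m mb|h U GU U0 UT].
  have := st _ (string_suffix_Gsub vwP mb); rewrite theta_val_suffix //.
  case: ifP => wm h; rewrite -subr_gt0; apply: h.
  - by apply: (@spanc_neq0 _ _ vP z _ m) => //=; lia.
  - by apply: (@spanc_neqT _ _ vP z _ 0) => //=; lia.
  - by apply: (@spanc_neq0 _ _ vP z _ 0) => //=; lia.
  - by apply: (@spanc_neqT _ _ vP z _ m) => //=; lia.
rewrite (theta_val_jumps vP z _ th0).
have [a ak aU] := exists_in vP z GU U0; have [b bk bU] := exists_notin vP z UT.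
have ge0 m : (0 < m < k)%N -> 0 <= (potential theta (z + m) - potential theta z) *
    ((v (z + m.-1)%N \in U)%:R - (v (z + m)%N \in U)%:R).
  move=> mb; have := h m mb; have := string_closed vwP GU mb.
  by case: (w m); case: (_ \in U); case: (_ \in U) => //= _; lra.
have [m mb jump] : exists2 m, (0 < m < k)%N & (v (z + m.-1)%N \in U) != (v (z + m)%N \in U).
  have [ab|ba] := leqP a b.
    have [|m mb /andP[m1 /negbTE m2]] := exists_switch (P := fun m => v (z + m)%N \in U) ab aU.
      exact: bU.
    by exists m; [lia | rewrite m1 m2].
  have [|m mb /andP[/negbTE m1 m2]] :=
    exists_switch (P := fun m => v (z + m)%N \notin U) (ltnW ba) bU.
    by rewrite negbK.
  by rewrite negbK in m2; exists m; [lia | rewrite m1 m2].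
rewrite (bigD1_seq m) ?iota_uniq ?mem_index_iota //= ltr_wpDr //.
  by rewrite big_seq_cond sumr_ge0 // => i; rewrite mem_index_iota => /andP[ib _]; apply: ge0.
have := h m mb; have := string_closed vwP GU mb; move: jump.
by case: (w m); case: (_ \in U); case: (_ \in U) => //= _ _; lra.
Qed.

Lemma string_semistable (F : constellation k xi) (v : nat -> Defs.space F) z w theta :
  in_Theta theta -> string v z w ->
  (forall m, (0 < m < k)%N ->
    if w m then potential theta (z + m) <= potential theta z
    else potential theta z <= potential theta (z + m)) -> semistable theta F.
Proof.
move=> th0 vwP h U GU _ _; have [vP wP] := vwP.
rewrite (theta_val_jumps vP z _ th0) big_seq_cond sumr_ge0 // => m.
rewrite mem_index_iota andbT => mb; have := h m mb; have := string_closed vwP GU mb.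
by case: (w m); case: (_ \in U); case: (_ \in U) => //= _; lra.
Qed.

End Stability.

Section Chambers.

Variables (R : realType) (k : nat) (xi : R[i]).
Hypothesis xiP : k.-primitive_root xi.

Let k_gt0 : (0 < k)%N := prim_order_gt0 xiP.

Let P := potential xiP.

(** The weights of [U] split into a cyclic interval bounded by weights outside [U] and a remainder.
    Arrows join adjacent weights only, so both parts span submodules; the interval has nonzero value
    by injectivity, hence a positive one, and the remainder a nonnegative one. *)
Lemma semistable_stable theta (F : constellation k xi) : in_Theta theta ->
  (forall m n, P theta m = P theta n -> m = n %[mod k]) ->
  semistable theta F -> stable theta F.
Proof.
move=> th0 inj ss U GU U0 UT; have [v vP] := exists_graded xiP F.
have [pv gv v0] := vP; have [XU YU gU] := GU.
have [a ak aU] := exists_in xiP vP 0 GU U0; have [b bk bU] := exists_notin xiP vP 0 UT.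
rewrite add0n in aU bU.
(* [z] opens a cyclic interval of indices of vectors in [U], of length [l]. *)
have [z [zU zU']] : exists z, v z \in U /\ v (z + k.-1)%N \notin U.
  have [|||m mb /andP[m1 m2]] :=
    exists_switch (P := fun m => v m \notin U) (i := b) (j := (a + k)%N).
  - by move: ak bk; clear; lia.
  - exact: bU.
  - by rewrite negbK pv.
  exists m; rewrite negbK in m2; split=> //.
  by rewrite (_ : m + k.-1 = m.-1 + k)%N ?pv //; move: mb; clear -k_gt0; lia.
pose J m := v (z + m)%N \in U.
have ex : exists m, ~~ J m by exists k.-1.
case: (ex_minnP ex) => l nJl lmin.
have l_gt0 : (0 < l)%N by rewrite lt0n; apply: contraNneq nJl => ->; rewrite /J addn0.
have l_ltk : (l < k)%N by apply: leq_ltn_trans (lmin _ zU') _; rewrite ltn_predL.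
have Jl m : (m < l)%N -> J m by move=> ml; apply: contraT => /lmin; rewrite leqNgt ml.
have stepX m : J m -> J m.+1 \/ opx F (v (z + m)%N) = 0.
  move=> Jm; have [c0|c0] := eqVneq (coordv xiP v (z + m).+1 (opx F (v (z + m)%N))) 0.
    by right; rewrite (opx_graded xiP vP) c0 scale0r.
  by left; rewrite /J addnS; apply: (graded_mem vP gU _ c0); apply: (subvP XU); apply: memv_img.
have stepY m : J m.+1 -> J m \/ opy F (v (z + m.+1)%N) = 0.
  rewrite /J addnS => Jm.
  have [c0|c0] := eqVneq (coordv xiP v (z + m) (opy F (v (z + m).+1))) 0.
    by right; rewrite (opy_graded xiP vP) c0 scale0r.
  by left; apply: (graded_mem vP gU _ c0); apply: (subvP YU); apply: memv_img.
have Xin (I : pred nat) m : (m.+1 < k)%N -> (J m.+1 -> I m.+1) -> J m ->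
    opx F (v (z + m)%N) \in spanc v z I.
  move=> mk JI /stepX[/JI Im|->]; last exact: mem0v.
  by rewrite (opx_graded xiP vP) -addnS memvZ // (v_spanc xiP vP).
have Yin (I : pred nat) m : (m < k)%N -> (J m -> I m) -> J m.+1 ->
    opy F (v (z + m.+1)%N) \in spanc v z I.
  move=> mk JI /stepY[/JI Im|->]; last exact: mem0v.
  by rewrite addnS (opy_graded xiP vP) memvZ // (v_spanc xiP vP).
have Y0 : opy F (v (z + 0)%N) = 0.
  have := stepY k.-1; rewrite prednK // /J pv addn0 => /(_ zU)[kU|//].
  by rewrite kU in zU'.
have nJk : ~~ J k.-1 by [].
have GI : Gsub (spanc v z (gtn l)).
  apply: (spanc_Gsub xiP vP) => m mk /= ml; split.
    apply: Xin; [exact: leq_ltn_trans ml l_ltk | move=> J1 /= | exact: Jl].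
    by rewrite ltn_neqAle ml andbT; apply: contraNneq nJl => <-.
  case: m ml mk => [|m] ml mk; first by rewrite Y0 mem0v.
  by apply: Yin; [exact: ltnW | move=> _ /=; exact: ltnW | exact: Jl].
have GW : Gsub (spanc v z (fun m => (l < m)%N && J m)).
  apply: (spanc_Gsub xiP vP) => m mk /= /andP[ml Jm]; split.
    apply: Xin => [|/= ->|//]; last by rewrite ltnW.
    by rewrite ltn_neqAle mk andbT; apply: contraNneq nJk => <-.
  case: m ml mk Jm => [|m] ml mk Jm; first by rewrite Y0 mem0v.
  apply: Yin => [|Jm'|//]; first exact: ltnW.
  by rewrite Jm' andbT ltn_neqAle -ltnS ml andbT; apply: contraNneq nJl => ->.
have vI : 0 < theta_val theta (spanc v z (gtn l)).
  rewrite lt_neqAle ss ?andbT //.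
  (* [pred0] selects the [gtn] case: the interval has value [P theta (z + l) - P theta z]. *)
  - have := theta_val_suffix xiP z pred0 th0 vP (m := l); rewrite /= => ->; last by rewrite l_gt0.
    rewrite eq_sym subr_eq0; apply/eqP => /inj e.
    by have := modn_eq_small (c := z) e; move: l_gt0 l_ltk; clear; lia.
  - by apply: (@spanc_neq0 _ _ _ xiP _ _ vP z _ 0).
  - by apply: (@spanc_neqT _ _ _ xiP _ _ vP z _ l) => //=; rewrite ltnn.
have vW : 0 <= theta_val theta (spanc v z (fun m => (l < m)%N && J m)).
  have [->|W0] := eqVneq (spanc v z (fun m => (l < m)%N && J m)) 0%VS.
    by rewrite /theta_val big1 // => i _; rewrite cap0v dimv0 mulr0.
  apply: ss => //.
  by apply: (@spanc_neqT _ _ _ xiP _ _ vP z _ k.-1);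
    [rewrite ltn_predL | rewrite (negbTE nJk) andbF].
have -> : theta_val theta U = theta_val theta (spanc v z (gtn l)) +
    theta_val theta (spanc v z (fun m => (l < m)%N && J m)).
  rewrite !(theta_val_jumps xiP vP z _ th0) -big_split /=; apply: eq_big_nat => m mb.
  rewrite -mulrDr; congr (_ * _).
  have mk : (m < k)%N by case/andP: mb.
  have mk' : (m.-1 < k)%N by apply: leq_ltn_trans (leq_pred m) mk.
  rewrite !(v_spanc xiP vP) // -/(J m) -/(J m.-1).
  have e i : ((i < l) + ((l < i) && J i) = J i)%N.
    have [il|il|->] := ltngtP i l; last by rewrite (negbTE nJl).
      by rewrite Jl.
    by [].
  by rewrite -[in LHS]e -[in X in _ - X]e !natrD /=; ring.
by rewrite ltr_wpDr.
Qed.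

Lemma generic_potential (theta : 'rV[rat]_k) : generic xi theta <->
  in_Theta theta /\ forall m n, P theta m = P theta n -> m = n %[mod k].
Proof.
split=> [[th0 gen]|[th0 inj]]; last first.
  split=> // F; split; first exact: semistable_stable.
  by move=> st U GU U0 UT; apply/ltW/st.
split=> // m n mn; apply/eqP/negPn/negP => neq.
(* With equal potentials at [m] and [n], orienting the string based at [m] by [P] makes it
   semistable, while the edge at [n] contributes zero and prevents stability. *)
have [F [v Fv]] := exists_string xiP m (fun i => P theta (m + i) <= P theta m).
have /gen/(string_stable xiP th0 Fv) st : semistable theta F.
  by apply: (string_semistable th0 Fv) => i ib; case: leP => // /ltW.
pose d := cyc_pos k m n.
have dn : m + d = n %[mod k] by apply: cyc_posK.
have d0 : (0 < d < k)%N.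
  rewrite ltn_cyc_pos // andbT lt0n; apply: contraNneq neq => d0.
  by rewrite -[m]addn0 -d0 dn.
have := st d d0; rewrite -/P (_ : P theta (m + d) = P theta m) ?lexx ?ltxx //.
by rewrite mn; apply: potential_mod.
Qed.

Definition same_order (theta theta' : 'rV[rat]_k) := forall m n,
  (P theta m < P theta n) = (P theta' m < P theta' n).

Lemma potential_segment (theta theta' : 'rV[rat]_k) t n :
  P ((1 - t) *: theta + t *: theta') n = (1 - t) * P theta n + t * P theta' n.
Proof.
rewrite /P /potential !mulr_sumr -big_split /=; apply: eq_bigr => m _.
by rewrite /theta_mod !mxE.
Qed.

Lemma generic_segment_order (theta theta' : 'rV[rat]_k) : generic_segment xi theta theta' ->
  same_order theta theta'.
Proof.
have seg (th th' : 'rV[rat]_k) m n : generic_segment xi th th' ->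
    P th m < P th n -> P th' n < P th' m -> False.
  (* The difference of the two potentials is affine along the segment and changes sign; it vanishes
     at the rational time [a / (a + b)], where genericity fails. *)
  move=> gs lt lt'; pose a := P th n - P th m; pose b := P th' m - P th' n.
  have ab : 0 < a + b by rewrite /a /b; lra.
  have a0 : 0 <= a by rewrite /a; lra.
  have t01 : 0 <= a / (a + b) <= 1.
    by rewrite divr_ge0 ?(ltW ab) //= ler_pdivrMr // mul1r /b; lra.
  have /generic_potential[th0 /(_ m n)] := gs _ t01.
  rewrite !potential_segment => e; have /e mn : (1 - a / (a + b)) * P th m + a / (a + b) * P th' m =
      (1 - a / (a + b)) * P th n + a / (a + b) * P th' n.
    apply: (mulfI (lt0r_neq0 ab)); rewrite /a /b; field.
    by rewrite -/a -/b; apply: lt0r_neq0.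
  have /generic_potential[th0' _] : generic xi th.
    by have := gs 0; rewrite subr0 scale1r scale0r addr0; apply; rewrite lexx ler01.
  by move: lt; rewrite /P (potential_mod xiP th0' mn) ltxx.
move=> gs m n.
have g0 : generic xi theta.
  by have := gs 0; rewrite subr0 scale1r scale0r addr0; apply; rewrite lexx ler01.
have g1 : generic xi theta'.
  by have := gs 1; rewrite subrr scale1r scale0r add0r; apply; rewrite ler01 lexx.
have /generic_potential[th0 inj] := g0; have /generic_potential[th0' inj'] := g1.
apply/idP/idP => lt.
  have [//|lt'|/inj' mn] := ltrgtP (P theta' m) (P theta' n).
    by case: (seg _ _ _ _ gs lt lt').
  by move: lt; rewrite /P (potential_mod xiP th0 mn) ltxx.
have [//|lt'|/inj mn] := ltrgtP (P theta m) (P theta n).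
  by case: (seg _ _ _ _ gs lt' lt).
by move: lt; rewrite /P (potential_mod xiP th0' mn) ltxx.
Qed.

Lemma generic_segment_end (theta theta' : 'rV[rat]_k) :
  generic_segment xi theta theta' -> generic xi theta'.
Proof.
by move=> /(_ 1); rewrite subrr scale1r scale0r add0r; apply; rewrite ler01 lexx.
Qed.

Lemma chamber_order (theta theta' : 'rV[rat]_k) : generic xi theta ->
  clos_refl_trans _ (generic_segment xi) theta theta' ->
  generic xi theta' /\ same_order theta theta'.
Proof.
move=> g0 ct; elim: ct g0 => {theta theta'} [x y xy _|x gx|x y z _ IH1 _ IH2 gx].
- by split; [apply: generic_segment_end xy | apply: generic_segment_order].
- by split.
- have [gy oy] := IH1 gx; have [gz oz] := IH2 gy.
  by split=> // m n; rewrite oy oz.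
Qed.

Lemma chamberP (C : 'rV[rat]_k -> Prop) : chamber xi C -> exists theta0, C theta0 /\
  forall theta, C theta -> generic xi theta /\ same_order theta0 theta.
Proof.
case=> theta0 g0 CE; exists theta0; split; first by apply/CE; apply: rt_refl.
by move=> theta /CE; apply: chamber_order.
Qed.

Lemma stable_order (theta theta' : 'rV[rat]_k) (F : constellation k xi)
  (v : nat -> Defs.space F) z w : string v z w ->
  in_Theta theta -> in_Theta theta' -> same_order theta theta' ->
  stable theta F -> stable theta' F.
Proof.
move=> Fv th0 th0' o /(string_stable xiP th0 Fv) st; apply/(string_stable xiP th0' Fv) => m mb.
by have := st m mb; case: (w m); rewrite -/P o.
Qed.

End Chambers.

(** * Toric constellations *)

Section Toric.

Variables (R : realType) (k : nat) (xi : R[i]).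
Hypothesis xiP : k.-primitive_root xi.

Let k_gt0 : (0 < k)%N := prim_order_gt0 xiP.

Section GradedMaps.

Variables (F : constellation k xi) (v : nat -> Defs.space F).
Hypothesis vP : graded v.

Lemma lfun_eq_graded z (f g : 'End(Defs.space F)) :
  (forall m, (m < k)%N -> f (v (z + m)%N) = g (v (z + m)%N)) -> f = g.
Proof.
move=> fg; apply/lfunP => u; rewrite (coordv_sumE xiP vP u) !linear_sum.
apply: eq_bigr => i _; rewrite !linearZ /=; congr (_ *: _).
by rewrite -(graded_mod vP (cyc_posK z i k_gt0)) fg // ltn_cyc_pos.
Qed.

Definition isotypic_lfun n : 'End(Defs.space F) :=
  k%:R^-1 *: \sum_(i < k) (xi ^+ n)^-1 ^+ i *: iter i (comp_lfun (opg F)) \1%VF.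

Lemma isotypic_lfunE n u : isotypic_lfun n u = isotypic n u.
Proof.
rewrite scale_lfunE sum_lfunE; congr (_ *: _); apply: eq_bigr => i _.
rewrite scale_lfunE; congr (_ *: _).
by elim: (i : nat) => [|j IHj]; rewrite /= ?id_lfunE // comp_lfunE IHj.
Qed.

Lemma diag_lfunE (chi : 'I_k -> R[i]) z (m : 'I_k) :
  (\sum_i chi i *: isotypic_lfun (z + i)) (v (z + m)%N) = chi m *: v (z + m)%N.
Proof.
rewrite sum_lfunE (bigD1 m) //= scale_lfunE isotypic_lfunE (graded_isotypic xiP vP) eqxx.
rewrite big1 ?addr0 // => i im.
rewrite scale_lfunE isotypic_lfunE (graded_isotypic xiP vP) ifN ?scaler0 //.
by rewrite eqn_modDl !modn_small // eq_sym.
Qed.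

End GradedMaps.

Section StringToric.

Variables (F : constellation k xi) (v : nat -> Defs.space F) (z : nat) (w : pred nat).
Hypothesis vwP : string v z w.

(** In a decomposition each basis vector lies in exactly one summand, and every edge of the string
    forces its two ends into the same one. *)
Lemma string_indecomposable : indecomposable F.
Proof.
have [vP wP] := vwP; have [_ _ v0] := vP.
move=> [U [W [GU GW [UT WT] UWT UW0]]]; have [_ _ gU] := GU; have [_ _ gW] := GW.
have UorW m : (v (z + m)%N \in U) || (v (z + m)%N \in W).
  have /memv_addP[u uU [u' uW E]] : v (z + m)%N \in (U + W)%VS by rewrite UWT memvf.
  have := congr1 (coordv xiP v (z + m)) E.
  rewrite (coordv_v xiP vP) eqxx coordvD => e.
  have [c0|c0] := eqVneq (coordv xiP v (z + m) u) 0.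
    rewrite (graded_mem vP gW uW) ?orbT //; apply: contra_eqN e => /eqP ->.
    by rewrite c0 addr0 oner_eq0.
  by rewrite (graded_mem vP gU uU c0).
have notboth m : ~~ ((v (z + m)%N \in U) && (v (z + m)%N \in W)).
  by rewrite -memv_cap UW0 memv0.
have step m : (m.+1 < k)%N -> (v (z + m)%N \in U) = (v (z + m.+1)%N \in U).
  move=> mk; have := string_closed xiP vwP GU (m := m.+1) ltac:(lia).
  have := string_closed xiP vwP GW (m := m.+1) ltac:(lia).
  have := UorW m; have := UorW m.+1; have := notboth m; have := notboth m.+1.
  rewrite /=; case: ifP => _; case: (_ \in U); case: (_ \in U);
    by case: (_ \in W); case: (_ \in W).
have const m : (m < k)%N -> (v (z + m)%N \in U) = (v (z + 0)%N \in U).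
  by elim: m => // m IHm mk; rewrite -step // IHm //; apply: ltnW.
have [a ak] := exists_notin xiP vP z UT; rewrite const // => aU.
have [b bk] := exists_notin xiP vP z WT; apply/negP; rewrite negbK.
by have := UorW b; rewrite const // (negbTE aU).
Qed.

(** Number of x-edges up to [m]. The basis vector at position [m] is reached by [r m] steps of x and
    [m - r m] reversed steps of y, which dictates the torus character [chi]. *)
Let r m : nat := \sum_(1 <= i < m.+1) w i.

Let r_le m : (r m <= m)%N.
Proof.
rewrite /r (leq_trans (leq_sum _ (_ : forall i, _ -> _ <= 1)%N)) //.
  by move=> i _; case: (w i).
by rewrite sum_nat_const_nat muln1 subSS subn0.
Qed.

Let rS m : r m.+1 = (r m + w m.+1)%N.
Proof. by rewrite /r big_nat_recr. Qed.

Let chi a b m : R[i] := (a ^+ r m)^-1 * b ^+ (m - r m).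

Let tau a b : 'End(Defs.space F) :=
  \sum_(i < k) chi a b i *: isotypic_lfun F (z + i).

Let tauE a b m : (m < k)%N -> tau a b (v (z + m)%N) = chi a b m *: v (z + m)%N.
Proof. by have [vP _] := vwP => mk; have := diag_lfunE vP (fun i => chi a b i) z (Ordinal mk). Qed.

Lemma string_torus : exists tau, @torus_structure R k xi F tau.
Proof.
have [vP wP] := vwP; exists tau; split.
- apply: (lfun_eq_graded vP (z := z)) => m mk.
  by rewrite tauE // /chi !expr1n invr1 mulr1 scale1r id_lfunE.
- move=> a b c d _ _ _ _; apply: (lfun_eq_graded vP (z := z)) => m mk.
  rewrite comp_lfunE !tauE // linearZ /= tauE // scalerA; congr (_ *: _).
  by rewrite /chi !exprMn invfM; ring.
(* The factor (ab)^k clears the denominators; the resulting exponents [k - r m] and [k + (m - r m)]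
   are below [2k]. *)
- exists k, (k + k)%N, (fun i j : 'I_(k + k) =>
    \sum_(m < k | (k - r m == i)%N && (k + (m - r m) == j)%N)
    isotypic_lfun F (z + m)) => a b a0 b0.
  rewrite /tau scaler_sumr.
  transitivity (\sum_(m < k) \sum_(i < k + k) \sum_(j < k + k)
      (if (k - r m == i)%N && (k + (m - r m) == j)%N then
        chi a b m *: isotypic_lfun F (z + m) else 0)).
    apply: eq_bigr => m _; have rm := r_le m; have mk := ltn_ord m.
    have ib : (k - r m < k + k)%N by lia.
    have jb : (k + (m - r m) < k + k)%N by lia.
    rewrite (bigD1 (Ordinal ib)) //= (bigD1 (Ordinal jb)) //= !eqxx /=.
    rewrite big1 ?addr0 => [|j jj]; last first.
      by rewrite ifN //; apply: contra jj => /eqP e; apply/eqP/val_inj.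
    rewrite big1 ?addr0 // => i ii; rewrite big1 // => j _.
    by rewrite ifN // negb_and; apply/orP; left; apply: contra ii => /eqP e; apply/eqP/val_inj.
  rewrite exchange_big; apply: eq_bigr => i _; rewrite exchange_big scaler_sumr.
  apply: eq_bigr => j _; rewrite -big_mkcond /= !scaler_sumr.
  apply: eq_bigr => m /andP[/eqP <- /eqP <-].
  have rm := r_le m; have mk := ltn_ord m.
  have e : a ^+ k = a ^+ (k - r m) * a ^+ r m by rewrite -exprD subnK //; lia.
  rewrite [RHS]scalerA; congr (_ *: _); rewrite /chi exprMn exprD e.
  by field; rewrite !expf_neq0.
- move=> a b a0 b0.
  have ex : (tau a b \o opx F)%VF = (a^-1 *: (opx F \o tau a b))%VF.
    apply: (lfun_eq_graded vP (z := z)) => m mk; rewrite scale_lfunE !comp_lfunE tauE // linearZ /=.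
    have [-> _] := wP m mk; case: ifP => [/andP[mk1 wm]|_]; last by rewrite linear0 !scaler0.
    rewrite tauE // scalerA; congr (_ *: _); rewrite /chi rS wm addn1 exprS invfM.
    by rewrite subSS mulrA.
  have ey : (tau a b \o opy F)%VF = (b^-1 *: (opy F \o tau a b))%VF.
    apply: (lfun_eq_graded vP (z := z)) => m mk; rewrite scale_lfunE !comp_lfunE tauE // linearZ /=.
    have [_ ->] := wP m mk; case: ifP => [/andP[m0 wm]|_]; last by rewrite linear0 !scaler0.
    case: m mk m0 wm => // m mk _ wm; rewrite tauE //; last exact: ltnW.
    rewrite scalerA; congr (_ *: _); rewrite /chi rS (negbTE wm) addn0 subSn ?r_le // exprS.
    by rewrite mulrCA mulKf.
  by move=> u; split; [have /lfunP/(_ u) := ex | have /lfunP/(_ u) := ey];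
    rewrite scale_lfunE !comp_lfunE.
Qed.

Lemma string_toric : toric F.
Proof. by split; [exact: string_indecomposable | exact: string_torus]. Qed.

End StringToric.

End Toric.

(** * From toric constellations to strings *)

Lemma poly_vanish (K : numFieldType) (q : {poly K}) : (forall a, a != 0 -> q.[a] = 0) -> q = 0.
Proof.
move=> q0; apply/eqP; apply: contraT => qn0.
have := max_poly_roots qn0 (rs := [seq i.+1%:R | i <- iota 0 (size q)]).
rewrite size_map size_iota ltnn; apply.
  by apply/allP => a /mapP[i _ ->]; apply/eqP/q0; rewrite pnatr_eq0.
by rewrite map_inj_uniq ?iota_uniq // => i j /eqP; rewrite eqr_nat => /eqP[].
Qed.

Section ToricString.

Variables (R : realType) (k : nat) (xi : R[i]).
Hypothesis xiP : k.-primitive_root xi.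

Let k_gt0 : (0 < k)%N := prim_order_gt0 xiP.

Variables (F : constellation k xi) (v : nat -> Defs.space F).
Hypothesis vP : graded v.

(** The scalars of x and y on the edge joining [n] and [n + 1]; in a string they are normalized to 0
    or 1. *)
Let al n := coordv xiP v n.+1 (opx F (v n)).
Let be n := coordv xiP v n (opy F (v n.+1)).

Let vD n : v (n + k)%N = v n. Proof. by have [-> _ _] := vP. Qed.

Let alD n : al (n + k) = al n.
Proof. by rewrite /al vD; apply: coordv_mod; rewrite -addSn modnDr. Qed.

Let beD n : be (n + k) = be n.
Proof. by rewrite /be -addSn vD; apply: coordv_mod; rewrite modnDr. Qed.

Let opxE n : opx F (v n) = al n *: v n.+1. Proof. exact: opx_graded. Qed.
Let opyE n : opy F (v n.+1) = be n *: v n. Proof. exact: opy_graded. Qed.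

(** [opyE] speaks of successor indices; periodicity provides one in every residue class, including
    that of 0. *)
Let vS n : exists m, n = m.+1 %[mod k] /\ v n = v m.+1.
Proof. by exists (n + k.-1)%N; rewrite -addnS prednK // modnDr vD. Qed.

Lemma coordv_opx n u : coordv xiP v n.+1 (opx F u) = coordv xiP v n u * al n.
Proof.
rewrite {1}(coordv_sumE xiP vP u) linear_sum coordv_sum.
rewrite (bigD1 (Ordinal (ltn_pmod n k_gt0))) //= big1 ?addr0 => [|i ni].
  rewrite linearZ /= coordvZ (coordv_mod xiP v _ (modn_mod n k)); congr (_ * _).
  by rewrite /al (graded_mod vP (n := n)) ?modn_mod.
rewrite linearZ /= coordvZ opxE coordvZ (coordv_v xiP vP) -[n.+1]addn1 -[i.+1]addn1 eqn_modDr.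
rewrite (modn_small (ltn_ord i)) (_ : (_ == _) = false) ?mulr0 //.
by apply: contraNF ni => /eqP e; apply/eqP/val_inj.
Qed.

Lemma coordv_opy n u : coordv xiP v n (opy F u) = coordv xiP v n.+1 u * be n.
Proof.
rewrite {1}(coordv_sumE xiP vP u) linear_sum coordv_sum.
rewrite (bigD1 (Ordinal (ltn_pmod n.+1 k_gt0))) //= big1 ?addr0 => [|i ni].
  rewrite linearZ /= coordvZ (coordv_mod xiP v _ (modn_mod n.+1 k)); congr (_ * _).
  by rewrite /be (graded_mod vP (n := n.+1)) ?modn_mod.
have [m [im vm]] := vS i.
rewrite linearZ /= coordvZ vm opyE coordvZ (coordv_v xiP vP) -(eqn_modDr 1) !addn1 -im.
rewrite (modn_small (ltn_ord i)) (_ : (_ == _) = false) ?mulr0 //.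
by apply: contraNF ni => /eqP e; apply/eqP/val_inj.
Qed.

(** Commutation of x and y makes the product [al n * be n] the same on all edges of the cycle. *)
Lemma opxy_scalar u : opx F (opy F u) = (al 0 * be 0) *: u.
Proof.
have c n : al n * be n = al 0 * be 0.
  elim: n => // n <-; have [_ _ v0] := vP; have := opxy_comm (v n.+1).
  rewrite opyE opxE !linearZ /= opxE opyE !scalerA => /eqP.
  rewrite -subr_eq0 -scalerBl scaler_eq0 (negbTE (v0 _)) orbF subr_eq0 => /eqP e.
  by rewrite -e mulrC.
rewrite (coordv_sumE xiP vP u) !linear_sum; apply: eq_bigr => i _.
have [m [_ ->]] := vS i.
by rewrite !linearZ /= opyE linearZ /= opxE !scalerA -(c m); congr (_ *: _); ring.
Qed.

Section TorusAction.

Variable tau : R[i] -> R[i] -> 'End(Defs.space F).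
Hypothesis tauP : torus_structure tau.

(** The torus element (2, 1) rescales xy by 1/2, whereas xy acts as a scalar; the scalar must
    vanish, because the torus acts by invertible maps. *)
Lemma torus_opxy : al 0 * be 0 = 0.
Proof.
have [t1 tM _ te] := tauP; have [_ _ v0] := vP.
have two0 : 2 != 0 :> R[i] by rewrite pnatr_eq0.
have [h1 _] := te 2 1 two0 (oner_neq0 _) (opy F (v 0)).
have [_ h2] := te 2 1 two0 (oner_neq0 _) (v 0).
move: h1; rewrite h2 !linearZ /= !opxy_scalar linearZ /= invr1 !scale1r scalerA => /eqP.
rewrite -subr_eq0 -scalerBl scaler_eq0 => /orP[|/eqP T0].
  rewrite -{1}[al 0 * be 0]mul1r -mulrBl mulf_eq0 => /orP[|/eqP //].
  rewrite subr_eq0 => /eqP/(congr1 ( *%R 2)); rewrite mulr1 mulfV // => /eqP.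
  by rewrite (eqr_nat _ 2 1).
have : tau (2^-1 * 2) (1 * 1) (v 0) = 0.
  by rewrite tM ?invr_eq0 ?oner_neq0 // comp_lfunE T0 linear0.
by rewrite mulVf // mulr1 t1 id_lfunE => /eqP; rewrite (negbTE (v0 0)).
Qed.

(** Otherwise every edge carries a nonzero map, and (a, a^-1) multiplies the diagonal coefficient by
    a^-1 along each edge, whether x or y is used. Going around the cycle gives (a^k - 1) t = 0 for
    the Laurent polynomial t at weight 0, although t equals 1 at a = 1. *)
Lemma torus_zero_edge : exists z, al z = 0 /\ be z = 0.
Proof.
have [t1 tM [n [m [A tA]]] te] := tauP; have [_ _ v0] := vP.
have [/existsP[z /andP[/eqP a0 /eqP b0]]|/existsPn h] :=
    boolP [exists z : 'I_k, (al z == 0) && (be z == 0)]; first by exists z.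
have nz i : (al i != 0) || (be i != 0).
  have := h (Ordinal (ltn_pmod i k_gt0)); rewrite negb_and /=.
  by rewrite -!(periodic_mod alD (modn_mod i k)) -!(periodic_mod beD (modn_mod i k)).
pose t a i := coordv xiP v i (tau a a^-1 (v i)).
have tS a i : a != 0 -> t a i.+1 = a^-1 * t a i.
  move=> a0; have a0' : a^-1 != 0 by rewrite invr_eq0.
  have [ni|] := boolP (al i == 0).
    have {}ni : be i != 0 by have := nz i; rewrite ni.
    have [_] := te a a^-1 a0 a0' (v i.+1); rewrite opyE linearZ /=.
    move/(congr1 (coordv xiP v i)); rewrite !coordvZ coordv_opy invrK -/(t a i) -/(t a i.+1).
    move=> e; apply: (mulfI ni); apply: (mulfI a0).
    by transitivity (a * (t a i.+1 * be i)); [ring | rewrite -e; field].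
  move=> ni; have [+ _] := te a a^-1 a0 a0' (v i); rewrite opxE linearZ /=.
  move/(congr1 (coordv xiP v i.+1)); rewrite !coordvZ coordv_opx -/(t a i) -/(t a i.+1).
  by move=> e; apply: (mulfI ni); rewrite e; ring.
have tk a : a != 0 -> (a ^+ k - 1) * t a 0 = 0.
  move=> a0; have : t a k = (a ^+ k)^-1 * t a 0.
    elim: (k) => [|j IHj]; first by rewrite expr0 invr1 mul1r.
    by rewrite tS // IHj exprS invfM mulrA.
  have -> : t a k = t a 0.
    by rewrite /t -[in v k](add0n k) vD; apply: coordv_mod; rewrite modnn mod0n.
  by move=> e; rewrite mulrBl mul1r {1}e mulVKf ?subrr // expf_neq0.
pose c i j := coordv xiP v 0 (A i j (v 0)).
(* Multiplication by a^m clears the negative powers of [a] that come from b = a^-1. *)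
pose p : {poly R[i]} := \sum_(i < m) \sum_(j < m) c i j *: 'X^(i + (m - j)).
have pE a : a != 0 -> p.[a] = a ^+ m * t a 0.
  move=> a0; rewrite /t tA ?invr_eq0 // divff // expr1n invr1 scale1r sum_lfunE coordv_sum.
  rewrite horner_sum mulr_sumr; apply: eq_bigr => i _.
  rewrite sum_lfunE coordv_sum horner_sum mulr_sumr; apply: eq_bigr => j _.
  rewrite hornerZ hornerXn scale_lfunE coordvZ -/(c i j) exprD.
  have -> : a ^+ m = a ^+ (m - j) * a ^+ j by rewrite -exprD subnK // ltnW.
  by rewrite exprVn; field; rewrite expf_neq0.
have q0 : ('X^k - 1) * p = 0.
  apply: poly_vanish => a a0; rewrite hornerM pE // hornerD hornerN hornerXn hornerC.
  by rewrite mulrCA tk // mulr0.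
have p1 : p.[1] = 1.
  by rewrite pE ?oner_neq0 // expr1n mul1r /t invr1 t1 id_lfunE (coordv_v xiP vP) eqxx.
move/eqP: q0; rewrite mulf_eq0 => /orP[|/eqP p0].
  by rewrite -size_poly_eq0 size_XnsubC.
by move/eqP: p1; rewrite p0 horner0 eq_sym oner_eq0.
Qed.

End TorusAction.

(** Two zero edges cut the cycle into two arcs, which span complementary submodules. *)
Lemma indecomposable_nonzero_edge z m : indecomposable F -> al z = 0 -> be z = 0 ->
  (0 < m < k)%N -> (al (z + m) != 0) || (be (z + m) != 0).
Proof.
move=> ind az bz mb; apply: contraT; rewrite negb_or !negbK => /andP[/eqP am /eqP bm].
case: ind; exists (spanc v z.+1 (gtn m)), (spanc v z.+1 (leq m)).
have Xin (I : pred nat) i : (i < k)%N -> ((i.+1 < k)%N -> al (z + i.+1) != 0 -> I i.+1) ->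
    opx F (v (z.+1 + i)%N) \in spanc v z.+1 I.
  move=> ik Ii; rewrite opxE addSnnS; have [->|a0] := eqVneq (al (z + i.+1)) 0.
    by rewrite scale0r mem0v.
  have [ik1|ik1] := ltnP i.+1 k.
    by rewrite memvZ // -addnS -addSnnS (v_spanc xiP vP) // Ii.
  have e : i.+1 = k by lia.
  by case/eqP: a0; rewrite e alD.
have Yin (I : pred nat) i : (i < k)%N -> ((0 < i)%N -> be (z + i) != 0 -> I i.-1) ->
    opy F (v (z.+1 + i)%N) \in spanc v z.+1 I.
  move=> ik Ii; rewrite addSn opyE; have [->|a0] := eqVneq (be (z + i)) 0.
    by rewrite scale0r mem0v.
  case: i ik Ii a0 => [|i] ik Ii a0; first by rewrite addn0 bz eqxx in a0.
  by rewrite memvZ // addnS -addSn (v_spanc xiP vP) ?Ii //; apply: ltnW.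
split.
- apply: (spanc_Gsub xiP vP) => i ik /= im; split.
    apply: Xin => // _ ai /=; rewrite ltn_neqAle im andbT.
    by apply: contraNneq ai => ->; rewrite am.
  by apply: Yin => //= _ _; lia.
- apply: (spanc_Gsub xiP vP) => i ik /= im; split.
    by apply: Xin => //= _ _; lia.
  apply: Yin => // i0 bi; rewrite -ltnS prednK // ltn_neqAle im andbT.
  by apply: contraNneq bi => <-; rewrite bm.
- split; first by apply: (@spanc_neqT _ _ _ xiP _ _ vP _ _ m); [lia | rewrite /= ltnn].
  by apply: (@spanc_neqT _ _ _ xiP _ _ vP _ _ 0) => //=; lia.
- apply: (graded_full xiP vP) => n nk; rewrite -(graded_mod vP (cyc_posK z.+1 n k_gt0)).
  have pk := ltn_cyc_pos z.+1 n k_gt0; have [mp|pm] := leqP m (cyc_pos k z.+1 n).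
    by apply: (subvP (addvSr _ _)); rewrite (v_spanc xiP vP).
  by apply: (subvP (addvSl _ _)); rewrite (v_spanc xiP vP).
- apply/eqP; rewrite -subv0; apply/subvP => u; rewrite memv_cap memv0.
  move=> /andP[/(mem_spanv xiP vP) u1 /(mem_spanv xiP vP) u2].
  rewrite (coordv_sumE xiP vP u) big1 // => i _.
  have [mi|im] := leqP m (cyc_pos k z.+1 i).
    by rewrite u1 ?scale0r //= -leqNgt.
  by rewrite u2 ?scale0r //= -ltnNge.
Qed.

Lemma toric_string_graded : toric F -> exists u z w, @string R k xi F u z w.
Proof.
case=> ind [tau tauP]; have [z [az bz]] := torus_zero_edge tauP.
have c0 := torus_opxy tauP; have [_ gv v0] := vP.
have alt n : al n * be n *: v n.+1 = 0.
  by have := opxy_scalar (v n.+1); rewrite c0 scale0r opyE linearZ /= opxE scalerA mulrC.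
have alt0 n : (al n == 0) || (be n == 0).
  by have /eqP := alt n; rewrite scaler_eq0 (negbTE (v0 _)) orbF mulf_eq0.
pose w m := al (z + m) != 0.
have wN m : (0 < m < k)%N -> ~~ w m -> be (z + m) != 0.
  by move=> mb; have := indecomposable_nonzero_edge ind az bz mb; rewrite /w => /orP[->|].
(* Rescaling by cumulative products along the string turns its nonzero scalars into 1. The string
   starts at [z.+1], as the zero edge [z] joins [z] to [z.+1]. *)
pose sc := fix sc m := if m is m'.+1 then
  (if w m'.+1 then sc m' * al (z + m'.+1) else sc m' / be (z + m'.+1)) else 1.
have sc0 m : (m < k)%N -> sc m != 0.
  elim: m => [|m IHm] mk; first exact: oner_neq0.
  rewrite /=; case: ifP => wm; rewrite mulf_neq0 ?IHm ?(ltnW mk) //.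
  by rewrite invr_eq0 wN ?wm.
pose u n := sc (cyc_pos k z.+1 n) *: v n.
have uE m : (m < k)%N -> u (z.+1 + m)%N = sc m *: v (z.+1 + m)%N.
  by move=> mk; rewrite /u cyc_posD.
exists u, z.+1, w; split.
  split=> n.
  - by rewrite /u vD; congr (sc _ *: _); apply: cyc_pos_mod; rewrite modnDr.
  - by rewrite /u linearZ /= gv !scalerA mulrC.
  - by rewrite scaler_eq0 negb_or v0 andbT sc0 //; apply: ltn_cyc_pos.
move=> m mk; rewrite uE // !linearZ /=; split.
  rewrite opxE addSnnS; have [mk1|mk1] := ltnP m.+1 k => /=.
    case: ifP => wm; first by rewrite uE //= wm scalerA -addSn.
    by move/negbT: wm; rewrite negbK => /eqP ->; rewrite scale0r scaler0.
  have -> : m.+1 = k by lia.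
  by rewrite alD az scale0r scaler0.
case: m mk => [|m] mk /=; first by rewrite addn0 opyE bz scale0r scaler0.
rewrite addSn opyE; case: ifP => wm.
  have /eqP -> : be (z + m.+1) == 0.
    by have := alt0 (z + m.+1)%N; rewrite (negbTE (_ : al _ != 0)) //; apply: negbNE; rewrite wm.
  by rewrite scale0r scaler0.
have be0 : be (z + m.+1) != 0 by apply: wN; rewrite ?wm.
by rewrite uE ?(ltnW mk) // scalerA addSnnS divfK // -addSnnS.
Qed.

End ToricString.

Lemma toric_string R k xi (F : @constellation R k xi) : k.-primitive_root xi -> toric F ->
  exists v z w, string (F := F) v z w.
Proof.
by move=> xiP tF; have [v vP] := exists_graded xiP F; apply: toric_string_graded vP tF.
Qed.

Lemma walk_right p k m : walk p 0 k -> (m < k)%N ->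
  if (m.+1 < k)%N && right_edge p m.+1 then ((p m).1.+1, (p m).2) = p m.+1
  else ((p m).1.+1, (p m).2) \notin wset p 0 k.
Proof.
move=> pw mk; case: ifP => [/andP[mk1 r]|nr].
  by have := pw m.+1; rewrite r /= => ->; [|lia].
apply: contraFN nr => /wsetP[j jb e].
have := walk_content pw (i := m) (j := j) ltac:(lia) jb; rewrite -e /= => h.
have jm : j = m.+1 by lia.
by rewrite -jm /right_edge -e jm /=; lia.
Qed.

Lemma walk_up p k m : walk p 0 k -> (m < k)%N ->
  if (0 < m)%N && ~~ right_edge p m then ((p m).1, (p m).2.+1) = p m.-1
  else ((p m).1, (p m).2.+1) \notin wset p 0 k.
Proof.
move=> pw mk; case: ifP => [/andP[m0 r]|nr].
  by have := pw m; rewrite (negbTE r) => ->; [|lia].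
apply: contraFN nr => /wsetP[j jb e].
have := walk_content pw (i := m) (j := j) ltac:(lia) jb; rewrite -e /= => h.
have jm : j = m.-1 by lia.
by rewrite /right_edge -jm -e /=; lia.
Qed.

(** * Modules of stairs *)

Section Monomials.

Variable R : realType.

Definition bmon (b : box) : 'X_{1..2} := (U_(0%R) *+ b.1 + U_(1%R) *+ b.2)%MM.

Definition mbox (m : 'X_{1..2}) : box := (m 0, m 1).

Lemma bmonE (b : box) : 'X_0 ^+ b.1 * 'X_1 ^+ b.2 = 'X_[bmon b] :> {mpoly R[i][2]}.
Proof. by rewrite mpolyXD !mpolyXn. Qed.

Lemma mboxK : cancel bmon mbox.
Proof.
case=> b1 b2; rewrite /mbox /bmon !mnmDE !mulmnE !mnm1E /=.
by congr pair; lia.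
Qed.

Lemma bmonK : cancel mbox bmon.
Proof.
move=> m; apply/mnmP => i; rewrite /bmon /mbox !mnmDE !mulmnE !mnm1E /=.
case: i => [[|[|//]] i] /=; rewrite ?mul1n ?mul0n ?addn0 ?add0n; congr (m _); exact: val_inj.
Qed.

Lemma bmonD b c : bmon (Defs.addb b c) = (bmon b + bmon c)%MM.
Proof. by apply/mnmP => i; rewrite /bmon !mnmDE !mulmnE /=; lia. Qed.

(** For a Ferrers diagram the monomials outside [A] are stable under multiplication, so membership
    in the ideal can be read off the support. *)
Lemma mon_idealP (A : {fset box}) (q : {mpoly R[i][2]}) : ferrers A ->
  mon_ideal A q <-> forall m, m \in msupp q -> mbox m \notin A.
Proof.
move=> fA; split=> [[n [f [b [bA ->]]]] m|qA].
  rewrite mcoeff_msupp raddf_sum => s0.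
  have [i _ /negbTE ci] : exists2 i : 'I_n, true &
      (f i * ('X_0 ^+ (b i).1 * 'X_1 ^+ (b i).2))@_m != 0.
    have [/existsP[i ci]|/existsPn h] := boolP
      [exists i, (f i * ('X_0 ^+ (b i).1 * 'X_1 ^+ (b i).2))@_m != 0]; first by exists i.
    case/eqP: s0; rewrite big1 // => i _; apply/eqP; have := h i; by rewrite negbK.
  move/negbT: ci; rewrite bmonE -mcoeff_msupp (perm_mem (msuppMX _ _)) => /mapP[m' _ ->].
  by rewrite -[m']bmonK -bmonD mboxK; apply: fA.
exists (size (msupp q)), (fun i => (q@_(nth 0%MM (msupp q) i))%:MP),
  (fun i => mbox (nth 0%MM (msupp q) i)).
split=> [i|]; first by apply: qA; apply: mem_nth.
rewrite {1}[q]mpolyE (big_nth 0%MM) big_mkord; apply: eq_bigr => i _.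
by rewrite mul_mpolyC bmonE bmonK.
Qed.

Lemma mon_ideal_bmon (A : {fset box}) b : ferrers A ->
  mon_ideal A ('X_[bmon b] : {mpoly R[i][2]}) <-> b \notin A.
Proof.
move=> fA; rewrite (mon_idealP _ fA); split=> [/(_ (bmon b))|bA m].
  by rewrite msuppX inE eqxx mboxK => /(_ isT).
by rewrite msuppX inE => /eqP ->; rewrite mboxK.
Qed.

Lemma act_poly_bmon (a c : R[i]) b :
  act_poly a c 'X_[bmon b] = (a^-1 ^+ b.1 * c^-1 ^+ b.2) *: 'X_[bmon b].
Proof.
rewrite /act_poly -bmonE rmorphM !rmorphXn /= !comp_mpolyXU /=.
by rewrite !exprZn -scalerAl -scalerAr scalerA.
Qed.

Lemma mulX0_bmon b : 'X_0 * 'X_[bmon b] = 'X_[bmon (b.1.+1, b.2)] :> {mpoly R[i][2]}.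
Proof. by rewrite -!bmonE mulrA -exprS. Qed.

Lemma mulX1_bmon b : 'X_1 * 'X_[bmon b] = 'X_[bmon (b.1, b.2.+1)] :> {mpoly R[i][2]}.
Proof. by rewrite -!bmonE mulrCA -exprS. Qed.

End Monomials.

Lemma walk_label p a b k z i j : walk p a b -> (a <= i <= j)%N -> (j < b)%N ->
  (z + (p i).2 = (p i).1 %[mod k])%N -> (z + (j - i) + (p j).2 = (p j).1 %[mod k])%N.
Proof.
move=> pw ij jb zp; have h := walk_content pw (i := i) (j := j) ltac:(lia) ltac:(lia).
apply/eqP; rewrite -(eqn_modDr ((p i).2 + i)).
have -> : (z + (j - i) + (p j).2 + ((p i).2 + i) = z + (p i).2 + (j + (p j).2))%N by lia.
rewrite -modnDml zp modnDml; apply/eqP; congr (_ %% _)%N; lia.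
Qed.

Section WalkModule.

Variables (R : realType) (k : nat) (xi : R[i]).
Hypothesis xiP : k.-primitive_root xi.

Let k_gt0 : (0 < k)%N := prim_order_gt0 xiP.

Variables (F : constellation k xi) (p : nat -> box).
Hypothesis pw : walk p 0 k.

Let label_pow z m : (z + (p 0).2 = (p 0).1 %[mod k])%N -> (m < k)%N ->
  (xi^-1)^-1 ^+ (p m).1 * xi^-1 ^+ (p m).2 = xi ^+ (z + m).
Proof.
move=> zp mk; have xi0 := prim_root_neq0 xiP.
apply: (mulIf (expf_neq0 (p m).2 xi0)); rewrite invrK exprVn mulfVK ?expf_neq0 // -exprD.
apply/eqP; rewrite (eq_prim_root_expr xiP) eq_sym; apply/eqP.
by rewrite -{1}[m]subn0; apply: walk_label pw _ mk zp.
Qed.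

Lemma string_iso_M v z w : string (F := F) v z w ->
  (forall m, (0 < m < k)%N -> w m = right_edge p m) ->
  (z + (p 0).2 = (p 0).1 %[mod k])%N -> iso_M F (wset p 0 k).
Proof.
move=> [vP wP] wp zp; have [A1 [A2 [f1 f2 GA]]] := wset_skew pw.
have pA m : (m < k)%N -> (p m \in A1) && (p m \notin A2).
  by move=> mk; have := mem_wset p (a := 0) (b := k) (i := m) mk; rewrite GA inE andbC.
have inG b : b \notin A2 -> b \notin wset p 0 k -> b \notin A1.
  by rewrite GA inE => -> /=.
(* [phi] keeps the coefficients of the monomials on the walk. It is linear everywhere; compatibility
   with x, y and g is checked on the ideal of [A2]. *)
pose phi (q : {mpoly R[i][2]}) : Defs.space F := \sum_(m < k) q@_(bmon (p m)) *: v (z + m)%N.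
have phi_lin : linear phi.
  move=> a q q'; rewrite /phi scaler_sumr -big_split /=; apply: eq_bigr => m _.
  by rewrite mcoeffD mcoeffZ scalerDl scalerA.
pose phiM := GRing.isLinear.Build _ _ _ _ phi phi_lin.
pose phiL : {linear {mpoly R[i][2]} -> Defs.space F} := HB.pack phi phiM.
have phiE q : phiL q = \sum_(m < k) q@_(bmon (p m)) *: v (z + m)%N by [].
clearbody phiL; clear phi_lin phiM; clear phi.
have phi_in m : (m < k)%N -> phiL 'X_[bmon (p m)] = v (z + m)%N.
  move=> mk; rewrite phiE (bigD1 (Ordinal mk)) //= mcoeffX eqxx scale1r big1 ?addr0 // => i im.
  rewrite mcoeffX (_ : (_ == _) = false) ?scale0r //; apply: contraNF im => /eqP/(can_inj mboxK) e.
  by apply/eqP/val_inj; rewrite /= (walk_inj pw (i := m) (j := i) mk (ltn_ord i) e).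
have phi_out b : b \notin A1 -> phiL 'X_[bmon b] = 0.
  move=> bA; rewrite phiE big1 // => i _.
  rewrite mcoeffX (_ : (_ == _) = false) ?scale0r //; apply: contraNF bA => /eqP/(can_inj mboxK) ->.
  by have /andP[] := pA i (ltn_ord i).
have A1r b c : b \notin A1 -> Defs.addb b c \notin A1 by apply: f1.
have linE (f g : {mpoly R[i][2]} -> Defs.space F) : linear f -> linear g ->
    (forall b, b \notin A2 -> f 'X_[bmon b] = g 'X_[bmon b]) ->
    forall q, mon_ideal A2 q -> f q = g q.
  move=> fl gl fg q /(mon_idealP _ f2) qA; rewrite [q]mpolyE.
  have lin (h : {mpoly R[i][2]} -> Defs.space F) : linear h ->
      h (\sum_(m <- msupp q) q@_m *: 'X_[m]) = \sum_(m <- msupp q) q@_m *: h 'X_[m].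
    move=> hl; pose hM := GRing.isLinear.Build _ _ _ _ h hl.
    pose hL : {linear {mpoly R[i][2]} -> Defs.space F} := HB.pack h hM.
    by rewrite -[h]/(hL : _ -> _) linear_sum; apply: eq_bigr => m _; rewrite linearZ.
  rewrite !lin // big_seq [RHS]big_seq; apply: eq_bigr => m mq; congr (_ *: _).
  by rewrite -(bmonK m) fg //; apply: qA.
exists A1, A2; split=> //; exists phiL; split.
- move=> u; exists (\sum_(i < k) coordv xiP v i u *: 'X_[bmon (p (cyc_pos k z i))]).
    exists k, (fun i => (coordv xiP v i u)%:MP), (fun i => p (cyc_pos k z i)); split=> [i|].
      by have /andP[] := pA _ (ltn_cyc_pos z i k_gt0).
    by apply: eq_bigr => i _; rewrite mul_mpolyC bmonE.
  rewrite linear_sum [RHS](coordv_sumE xiP vP); apply: eq_bigr => i _.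
  by rewrite linearZ /= phi_in ?ltn_cyc_pos // (graded_mod vP (cyc_posK z i k_gt0)).
- move=> q /(mon_idealP _ f2) q2; rewrite (mon_idealP _ f1); split=> [q0 m mq|q1].
    apply: contraT; rewrite negbK => mA1; have : mbox m \in wset p 0 k by rewrite GA inE mA1 q2.
    case/wsetP => j jk mj; have := congr1 (coordv xiP v (z + j)) q0.
    rewrite phiE coordv_sum (bigD1 (Ordinal jk)) //= coordvZ (coordv_v xiP vP) eqxx mulr1.
    rewrite big1 ?addr0 => [|i ij].
      rewrite -mj bmonK -[X in coordv _ _ _ X](scale0r (0 : Defs.space F)) coordvZ mul0r => c0.
      by move: mq; rewrite mcoeff_msupp c0 eqxx.
    rewrite coordvZ (coordv_v xiP vP) eqn_modDl !modn_small //.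
    rewrite (_ : (_ == _) = false) ?mulr0 //; apply: contraNF ij => /eqP e.
    exact/eqP/val_inj.
  rewrite phiE big1 // => i _; rewrite memN_msupp_eq0 ?scale0r //.
  apply/negP => /q1; rewrite mboxK; apply/negP; rewrite negbK.
  by have /andP[] := pA i (ltn_ord i).
- move=> q qA; split.
  + apply: (linE (fun q => phiL ('X_0 * q)) (fun q => opx F (phiL q))) => // [a q1 q2|a q1 q2|b bA].
    * by rewrite mulrDr -scalerAr linearP.
    * by rewrite !linearP.
    rewrite mulX0_bmon; have [/wsetP[m mk bm]|bG] := boolP (b \in wset p 0 k); last first.
      rewrite phi_out; last first.
        by have := A1r b (1%N, 0%N) (inG _ bA bG); rewrite /Defs.addb /= addn1 addn0.
      by rewrite phi_out ?linear0 ?inG.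
    rewrite bm phi_in //; have [-> _] := wP m mk; have := walk_right pw mk.
    have [mk1|mk1] := ltnP m.+1 k => /=.
      rewrite wp ?mk1 //; case: ifP => _ e; first by rewrite e phi_in.
      apply: phi_out; apply: inG e; rewrite -bm.
      by have := f2 b (1%N, 0%N) bA; rewrite /Defs.addb /= addn1 addn0.
    move=> e; apply: phi_out; apply: inG e; rewrite -bm.
    by have := f2 b (1%N, 0%N) bA; rewrite /Defs.addb /= addn1 addn0.
  + apply: (linE (fun q => phiL ('X_1 * q)) (fun q => opy F (phiL q))) => // [a q1 q2|a q1 q2|b bA].
    * by rewrite mulrDr -scalerAr linearP.
    * by rewrite !linearP.
    rewrite mulX1_bmon; have [/wsetP[m mk bm]|bG] := boolP (b \in wset p 0 k); last first.
      rewrite phi_out; last first.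
        by have := A1r b (0%N, 1%N) (inG _ bA bG); rewrite /Defs.addb /= addn1 addn0.
      by rewrite phi_out ?linear0 ?inG.
    rewrite bm phi_in //; have [_ ->] := wP m mk; have := walk_up pw mk.
    case: m bm mk => [|m] bm mk /=.
      move=> e; apply: phi_out; apply: inG e; rewrite -bm.
      by have := f2 b (0%N, 1%N) bA; rewrite /Defs.addb /= addn1 addn0.
    rewrite wp ?mk //; case: ifP => _ e; first by rewrite e phi_in // ltnW.
    apply: phi_out; apply: inG e; rewrite -bm.
    by have := f2 b (0%N, 1%N) bA; rewrite /Defs.addb /= addn1 addn0.
  + apply: (linE (fun q => phiL (act_poly xi^-1 xi q)) (fun q => opg F (phiL q)))
      => // [a q1 q2|a q1 q2|b bA].
    * by rewrite /act_poly linearP linearP.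
    * by rewrite !linearP.
    rewrite act_poly_bmon linearZ /=.
    have [/wsetP[m mk bm]|bG] := boolP (b \in wset p 0 k); last first.
      by rewrite phi_out ?inG // scaler0 linear0.
    by rewrite bm phi_in // (label_pow zp mk); have [_ -> _] := vP.
Qed.

Lemma iso_M_string : iso_M F (wset p 0 k) ->
  exists v z, string (F := F) v z (right_edge p) /\ (z + (p 0).2 = (p 0).1 %[mod k])%N.
Proof.
case=> A1 [A2 [f1 f2 GA [phi [surj ker equiv]]]].
have pA m : (m < k)%N -> (p m \in A1) && (p m \notin A2).
  by move=> mk; have := mem_wset p (a := 0) (b := k) (i := m) mk; rewrite GA inE andbC.
(* Modulo [k], the factor [k.-1] stands for -1, so this natural number represents the label of
   [p 0]. *)
pose z := ((p 0).1 + k.-1 * (p 0).2)%N.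
have zp : (z + (p 0).2 = (p 0).1 %[mod k])%N.
  by rewrite /z -addnA -mulSnr prednK // addnC mulnC modnMDl.
pose u m : Defs.space F := phi 'X_[bmon (p m)].
have out b : b \notin A2 -> b \notin wset p 0 k -> phi 'X_[bmon b] = 0.
  move=> b2 bG; apply/ker; apply/mon_ideal_bmon => //.
  by move: bG; rewrite GA inE b2.
have id2 m : (m < k)%N -> mon_ideal A2 ('X_[bmon (p m)] : {mpoly R[i][2]}).
  by move=> mk; apply/mon_ideal_bmon => //; have /andP[] := pA m mk.
have uX m : (m < k)%N -> opx F (u m) = if (m.+1 < k)%N && right_edge p m.+1 then u m.+1 else 0.
  move=> mk; have [<- _ _] := equiv _ (id2 m mk); rewrite mulX0_bmon.
  have := walk_right pw mk; case: ifP => _ e; first by rewrite e.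
  apply: out => //; have /andP[_ pA2] := pA m mk.
  by have := f2 _ (1%N, 0%N) pA2; rewrite /Defs.addb /= addn1 addn0.
have uY m : (m < k)%N -> opy F (u m) = if (0 < m)%N && ~~ right_edge p m then u m.-1 else 0.
  move=> mk; have [_ <- _] := equiv _ (id2 m mk); rewrite mulX1_bmon.
  have := walk_up pw mk; case: ifP => _ e; first by rewrite e.
  apply: out => //; have /andP[_ pA2] := pA m mk.
  by have := f2 _ (0%N, 1%N) pA2; rewrite /Defs.addb /= addn1 addn0.
pose v n := u (cyc_pos k z n).
have vE m : (m < k)%N -> v (z + m)%N = u m by move=> mk; rewrite /v cyc_posD.
exists v, z; split=> //; split.
  split=> n; rewrite /v; have nk := ltn_cyc_pos z n k_gt0.
  - by congr u; apply: cyc_pos_mod; rewrite modnDr.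
  - have [_ _ <-] := equiv _ (id2 _ nk); rewrite act_poly_bmon linearZ /= (label_pow zp nk).
    congr (_ *: _); apply/eqP; rewrite (eq_prim_root_expr xiP).
    by rewrite cyc_posK.
  - apply/eqP => /(ker _ (id2 _ nk))/mon_ideal_bmon => /(_ f1).
    by have /andP[->] := pA _ nk.
move=> m mk; rewrite vE // uX // uY //; split; case: ifP => // /andP[h _].
  by rewrite vE.
by rewrite vE //; apply: leq_ltn_trans (leq_pred m) mk.
Qed.

End WalkModule.

(** The start (z + k, k) has label [z] and leaves room below for [k - 1] steps down. *)
Definition walk_of_word k z (w : pred nat) (m : nat) : box :=
  let r := (\sum_(1 <= i < m.+1) w i)%N in ((z + k + r)%N, (k - (m - r))%N).

Lemma walk_of_wordP k z (w : pred nat) :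
  [/\ walk (walk_of_word k z w) 0 k,
      forall m, (0 < m < k)%N -> right_edge (walk_of_word k z w) m = w m &
      z + (walk_of_word k z w 0).2 = (walk_of_word k z w 0).1 %[mod k]]%N.
Proof.
pose r m := (\sum_(1 <= i < m.+1) w i)%N.
have r_le m : (r m <= m)%N.
  rewrite /r (leq_trans (leq_sum _ (_ : forall i, _ -> _ <= 1)%N)) //.
    by move=> i _; case: (w i).
  by rewrite sum_nat_const_nat muln1 subSS subn0.
have rS m : r m.+1 = (r m + w m.+1)%N by rewrite /r big_nat_recr.
have rE m : (0 < m < k)%N -> right_edge (walk_of_word k z w) m = w m.
  case: m => // m mb; rewrite /right_edge /walk_of_word /= -!/(r _) rS.
  by case: (w m.+1); lia.
split=> // [m mb|]; last by rewrite /walk_of_word /= big_geq // !addn0 subnn subn0.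
rewrite rE //; case: m mb => // m mb; rewrite /walk_of_word -!/(r _) rS /=.
by have := r_le m; case: (w m.+1) => /= ?; congr pair; lia.
Qed.

(** * From a chamber stair to the order of the potentials *)

Section Main.

Variables (R : realType) (k : nat) (xi : R[i]).
Hypothesis xiP : k.-primitive_root xi.

Let k_gt0 : (0 < k)%N := prim_order_gt0 xiP.

Let P := potential xiP.

Lemma has_Gstair_string (F : constellation k xi) Gam : has_Gstair F Gam ->
  exists p (v : nat -> Defs.space F) z,
    [/\ walk p 0 k, Gam = wset p 0 k, string v z (right_edge p) &
    z + (p 0%N).2 = (p 0%N).1 %[mod k]]%N.
Proof.
case=> -[st cd] iso; have [p pw GE] := stair_walk st; rewrite cd in pw GE.
by rewrite GE in iso; have [v [z [vz zp]]] := iso_M_string xiP pw iso; exists p, v, z.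
Qed.

Lemma string_has_Gstair (F : constellation k xi) (v : nat -> Defs.space F) z w p :
  string v z w -> walk p 0 k -> (forall m, (0 < m < k)%N -> w m = right_edge p m) ->
  (z + (p 0).2 = (p 0).1 %[mod k])%N -> has_Gstair F (wset p 0 k).
Proof.
move=> vz pw wp zp; split; last exact: string_iso_M vz wp zp.
by have := wset_Gstair pw; rewrite subn0.
Qed.

Lemma walk_constellation p z : walk p 0 k -> (z + (p 0).2 = (p 0).1 %[mod k])%N ->
  exists F : constellation k xi, [/\ toric F, has_Gstair F (wset p 0 k) &
    exists v : nat -> Defs.space F, string v z (right_edge p)].
Proof.
move=> pw zp; have [F [v vz]] := exists_string xiP z (right_edge p); exists F; split.
- exact: string_toric vz.
- exact: string_has_Gstair vz pw _ zp.
- by exists v.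
Qed.

(** The base marks the edge on which x and y both vanish. If the bases differed, that edge of one
    string would be interior to the other, where one of the two maps is nonzero. *)
Lemma string_base_unique (F : constellation k xi) (v v' : nat -> Defs.space F) z z' w w' :
  string v z w -> string v' z' w' -> z = z' %[mod k].
Proof.
move=> [vP wP] [vP' wP']; have [_ gv v0] := vP; have [_ gv' v0'] := vP'.
have prop n : exists2 c, c != 0 & v' n = c *: v n.
  have e := eigen_coordv xiP vP (gv' n); exists (coordv xiP v n (v' n)) => //.
  by apply: contra_neq (v0' n) => c0; rewrite e c0 scale0r.
pose m := cyc_pos k z z'; have mk : (m < k)%N := ltn_cyc_pos z z' k_gt0.
have zm : (z + m = z' %[mod k])%N := cyc_posK z z' k_gt0.
case: (posnP m) => [m0|m0]; first by rewrite -zm m0 addn0.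
have [wm|wm] := boolP (w m).
  have [+ _] := wP m.-1 ltac:(lia); rewrite prednK // mk wm /= => e.
  have [+ _] := wP' k.-1 ltac:(lia); rewrite prednK // ltnn /=.
  have [c c0 ->] := prop (z' + k.-1)%N; rewrite linearZ /=.
  rewrite (graded_mod vP (n := (z + m.-1)%N)).
    by rewrite e => /eqP; rewrite scaler_eq0 (negbTE c0) (negbTE (v0 _)).
  apply/eqP; rewrite -(eqn_modDr 1) -!addnA !addn1 !prednK //.
  by rewrite -(modnDmr z') modnn addn0 eq_sym; apply/eqP.
have [_] := wP m mk; rewrite m0 wm /= => e.
have [_ /=] := wP' 0%N k_gt0; rewrite addn0.
have [c c0 ->] := prop z'; rewrite linearZ /= -(graded_mod vP zm) e => /eqP.
by rewrite scaler_eq0 (negbTE c0) (negbTE (v0 _)).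
Qed.

Lemma stable_right_edge theta (F : constellation k xi) (v : nat -> Defs.space F) z w m :
  in_Theta theta -> string v z w -> stable theta F -> (0 < m < k)%N ->
  w m = (P theta (z + m) < P theta z).
Proof.
move=> th0 vz /(string_stable xiP th0 vz) st mb; have := st m mb; rewrite -/P.
by case: (w m) => [->|/ltW]; rewrite // ltNge => ->.
Qed.

Lemma right_edge_stable theta (F : constellation k xi) (v : nat -> Defs.space F) z w :
  generic xi theta -> string v z w ->
  (forall m, (0 < m < k)%N -> w m = (P theta (z + m) < P theta z)) -> stable theta F.
Proof.
move=> /(generic_potential xiP)[th0 inj] vz wE; apply/(string_stable xiP th0 vz) => m mb.
rewrite wE // -/P; case: ltrgtP => // /inj; rewrite -[in RHS](addn0 z) => /eqP.
by rewrite eqn_modDl mod0n modn_small //; lia.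
Qed.

Lemma Cstable_chamber (C : 'rV[rat]_k -> Prop) theta0 (F : constellation k xi) :
  (forall theta, C theta -> generic xi theta /\ same_order xiP theta0 theta) ->
  in_Theta theta0 -> toric F -> stable theta0 F -> Cstable C F.
Proof.
move=> CP th0 /(toric_string xiP)[v [z [w vz]]] st theta /CP[[th0' _] so].
exact: stable_order vz th0 th0' so st.
Qed.

(* Having the generators of [S], the stair of [F] is a window of [S] before which
   all steps go down and after which all steps go right; such a window is one of
   the stairs glued to form [S]. *)
Lemma same_generators_Cstair (C : 'rV[rat]_k -> Prop) theta0 (F : constellation k xi) Gam S :
  C theta0 -> generic xi theta0 -> has_Gstair F Gam -> Cstair xi C S ->
  same_generators k Gam S ->
  stable theta0 F /\ exists2 z, (exists (v : nat -> Defs.space F) w, string v z w) &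
    forall m m', (0 < m < m')%N -> (m' < k)%N ->
      (P theta0 (z + m) < P theta0 z) = (P theta0 (z + m') < P theta0 z) ->
      P theta0 (z + m) < P theta0 (z + m').
Proof.
move=> C0 g0 /has_Gstair_string[q [v [z [qw GE vz zq]]]] [G [Gj Gl GS]] [Gam' [S' [sG sS gE]]].
have /(generic_potential xiP)[th0 inj] := g0.
have Pper n : P theta0 (n + k) = P theta0 n by apply: potentialD.
have rk j r z' : (0 < j <= k)%N -> walk r 0 k -> G j = wset r 0 k ->
    (z' + (r 0%N).2 = (r 0%N).1 %[mod k])%N ->
    (forall m, (0 < m < k)%N -> right_edge r m = (P theta0 (z' + m) < P theta0 z')) /\
    (rank k (P theta0) z').+1 = j.
  move=> jb rw GrE zr; have [wj [Fj [_ stj [_ isoj]]]] := Gj j jb.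
  rewrite GrE in isoj; have [v' [z2 [vz2 zr2]]] := iso_M_string xiP rw isoj.
  have zz : (z2 = z' %[mod k])%N.
    by apply/eqP; rewrite -(eqn_modDr (r 0%N).2) zr zr2.
  have E m : (0 < m < k)%N -> right_edge r m = (P theta0 (z' + m) < P theta0 z').
    move=> mb; rewrite (stable_right_edge th0 vz2 (stj _ C0) mb).
    by congr (_ < _); apply: periodic_mod => //; rewrite -modnDml zz modnDml.
  split=> //; rewrite -[RHS]wj GrE (width_right_edges rw) // rank_window //.
  congr _.+1; rewrite -[z'.+1]addn1 [(z' + 1)%N]addnC [(z' + k)%N]addnC big_addn addnK.
  by apply: eq_big_nat => m mb; rewrite E // addnC.
have [|||p [o [o1 pw GpE oS cov]]] := @glued_walk k G k k_gt0 k_gt0.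
- move=> j jb; have [_ [Fj [_ _ /has_Gstair_string[r [_ [_ [rw GrE _ _]]]]]]] := Gj j jb.
  by exists r.
- exact: Gl.
(* By [rk] the label of the first box determines the width, so stairs of widths [j] and [j.+1] start
   at distinct boxes. *)
- move=> j x y jb.
  have [_ [Fj [_ _ /has_Gstair_string[r [v1 [z1 [rw GrE _ zr]]]]]]] := Gj j ltac:(lia).
  have [_ [Fj' [_ _ /has_Gstair_string[r' [v2 [z2 [rw' GrE' _ zr']]]]]]] := Gj j.+1 ltac:(lia).
  rewrite GrE GrE' => /(first_box_wset rw k_gt0) -> /(first_box_wset rw' k_gt0) -> rr.
  rewrite rr in zr'.
  have [_ h1] := rk j r z1 ltac:(lia) rw GrE zr.
  have [_ h2] := rk j.+1 r' z1 ltac:(lia) rw' GrE' ltac:(by rewrite rr).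
  by lia.
pose N := (o k + k)%N.
have SE : S = wset p 0 N.
  apply/fsetP => x; apply/idP/wsetP => [/GS[j jb]|[i ib ->]].
    rewrite GpE // => /wsetP[i ib ->]; exists i => //.
    have := steps_leq (o := o) (n := k) (i := j) (j := k) => h.
    by have := h (fun j jb => proj1 (andP (oS j jb))) ltac:(lia) (leqnn k); rewrite /N; lia.
  have [j jb ij] := cov i ib; apply/GS; exists j => //; rewrite GpE //.
  exact: mem_wset.
(* [c0] represents the label of [p 0]; hence [c0 + m] represents that of [p m], and [Q m] is the
   potential at this label. *)
pose c0 := ((p 0%N).1 + k.-1 * (p 0%N).2)%N.
have c0p : (c0 + (p 0%N).2 = (p 0%N).1 %[mod k])%N.
  by rewrite /c0 -addnA -mulSnr prednK // addnC mulnC modnMDl.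
pose Q m := P theta0 (c0 + m).
have Qper m : Q (m + k)%N = Q m by rewrite /Q addnA Pper.
have Qinj m n : Q m = Q n -> m = n %[mod k].
  by move=> /inj /eqP; rewrite eqn_modDl => /eqP.
have oN j : (0 < j <= k)%N -> (o j + k <= N)%N.
  move=> jb; have := steps_leq (o := o) (n := k) (i := j) (j := k) => h.
  by have := h (fun j jb => proj1 (andP (oS j jb))) ltac:(lia) (leqnn k); rewrite /N; lia.
have win j : (0 < j <= k)%N ->
    (forall m, (0 < m < k)%N -> right_edge p (m + o j) = (Q (o j + m)%N < Q (o j))).
  move=> jb m mb; have [|||E _] := rk j (fun i => p (i + o j)%N) (c0 + o j)%N jb.
  - by apply: walk_shift; apply: sub_walk pw _ _ => //; rewrite addnC; apply: oN.
  - by rewrite GpE // -wset_shift add0n addnC.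
  - rewrite add0n -[X in (c0 + X)%N]subn0; apply: walk_label pw _ _ c0p; first by [].
    by have := oN j jb; lia.
  have := E m mb; rewrite /Q addnA => <-.
  by rewrite /right_edge (_ : (m + o j).-1 = (m.-1 + o j)%N) //; lia.
have pR j m : (0 < j <= k)%N -> (o j < m < o j + k)%N -> right_edge p m = (Q m < Q (o j)).
  move=> jb mb; have := win j jb (m - o j)%N ltac:(lia).
  by rewrite subnK ?subnKC //; lia.
have pwd j : (0 < j <= k)%N -> width (wset p (o j) (o j + k)) = j.
  by move=> jb; rewrite -GpE //; have [] := Gj j jb.
rewrite GE in sG; have [q' [qw' GE' qR' ql']] := same_abstract_walk qw sG.
rewrite SE in sS; have [p' [pw' SE' pR' pl']] := same_abstract_walk pw sS.
rewrite GE' SE' in gE.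
have [|||a [ab qp aD aR]] := same_generators_window pw' qw' _ _ _ (esym gE).
- by rewrite k_gt0 /N leq_addl.
- move=> m mb; rewrite pR'; last by rewrite /N; lia.
  exact: (first_window_down k_gt0 Qper pw o1 oS pR pwd).
- rewrite /N addnK => m mb; rewrite pR'; last by rewrite /N; lia.
  exact: (last_window_right k_gt0 Qper Qinj pw o1 oS pR pwd).
have aD' m : (0 < m <= a)%N -> ~~ right_edge p m by move=> mb; rewrite -pR' ?aD //; lia.
have aR' m : (a + k <= m < N)%N -> right_edge p m by move=> mb; rewrite -pR' ?aR //; lia.
have [j jb aj] := window_offset k_gt0 Qper Qinj pw o1 oS pR pwd ab aD' aR'.
(* The realizations compared are label-preserving translates of the stair of [F] and of [S], so
   their common box at the start of the window identifies the two labels. *)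
have za : (z = c0 + a %[mod k])%N.
  have h0 := ql' 0%N k_gt0; have h1 := pl' a ltac:(lia).
  have h2 : (c0 + (a - 0) + (p a).2 = (p a).1 %[mod k])%N by apply: walk_label pw _ _ c0p; lia.
  rewrite qp // addn0 in h0; rewrite subn0 in h2.
  apply/eqP; rewrite -(eqn_modDr ((q 0%N).2 + (p' a).2 + (p a).2)).
  have -> : (z + ((q 0%N).2 + (p' a).2 + (p a).2) = z + (q 0%N).2 + ((p' a).2 + (p a).2))%N by lia.
  rewrite -modnDml zq modnDml addnA -modnDml -h0 modnDml.
  have -> : ((p' a).1 + (q 0%N).2 + (p a).2 = (p' a).1 + (p a).2 + (q 0%N).2)%N by lia.
  rewrite -modnDml h1 modnDml.
  have -> : (c0 + a + ((q 0%N).2 + (p' a).2 + (p a).2) =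
    c0 + a + (p a).2 + ((q 0%N).2 + (p' a).2))%N by lia.
  by rewrite -[X in _ == X]modnDml h2 modnDml; apply/eqP; congr (_ %% _)%N; lia.
have PQ m : P theta0 (z + m) = Q (a + m)%N.
  by rewrite /Q addnA; apply: periodic_mod => //; rewrite -modnDml za modnDml.
have PQ0 : P theta0 z = Q a by rewrite -[z]addn0 PQ addn0.
split.
  apply: right_edge_stable g0 vz _ => m mb; rewrite PQ PQ0 aj -win // -qR'; last by lia.
  rewrite -pR'; last by lia.
  have mk : (m < k)%N by case/andP: mb.
  rewrite /right_edge (qp m mk) (qp m.-1 (leq_ltn_trans (leq_pred m) mk)).
  have e : (a + m.-1 = (m + o j).-1)%N by rewrite -aj; move: mb; clear; lia.
  by rewrite e addnC aj.
exists z; first by exists v, (right_edge q).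
move=> m m' mm mk; rewrite !PQ PQ0.
exact: (window_order k_gt0 Qper Qinj pw o1 oS pR pwd ab aD' aR').
Qed.

(** * The stairs of a simple chamber as windows *)

Section Window.

Variables (p : nat -> box) (z : nat) (theta : 'rV[rat]_k).
Hypothesis pw : walk p 0 k.
Hypothesis zp : (z + (p 0).2 = (p 0).1 %[mod k])%N.
Hypothesis gth : generic xi theta.

Let th0 : in_Theta theta. Proof. by have /(generic_potential xiP)[] := gth. Qed.

Let inj m n : P theta m = P theta n -> m = n %[mod k].
Proof. by have /(generic_potential xiP)[_] := gth; apply. Qed.

Let Pmod m n : m = n %[mod k] -> P theta (z + m) = P theta (z + n).
Proof. by move=> mn; apply: potential_mod => //; rewrite -modnDmr mn modnDmr. Qed.

(** Three blocks determine the order: x-edges below the base, the base, y-edges above it, increasing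
    within each edge block. [lft] sends them below [k], to [k] and above [k], increasingly. *)
Lemma order_lft : (forall m, (0 < m < k)%N -> right_edge p m = (P theta (z + m) < P theta z)) ->
  (forall m m', (0 < m < m')%N -> (m' < k)%N ->
      (P theta (z + m) < P theta z) = (P theta (z + m') < P theta z) ->
      P theta (z + m) < P theta (z + m')) ->
  forall m n, (P theta (z + m) < P theta (z + n)) = (lft p k m < lft p k n)%N.
Proof.
move=> rP ord.
have cls m : (m < k)%N -> [\/ m = 0%N /\ lft p k m = k,
    [/\ (0 < m)%N, lft p k m = m & P theta (z + m) < P theta z] |
    [/\ (0 < m)%N, lft p k m = (m + k)%N & P theta z < P theta (z + m)]].
  move=> mk; have [->|m0] := posnP m; first by constructor 1; rewrite lft0.
  rewrite lftE // m0 /=; have := rP m; rewrite m0 mk => /(_ isT) ->.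
  case: ifPn => [lt|]; first by constructor 2.
  rewrite -leNgt le_eqVlt => /orP[/eqP/esym/inj|lt]; last by constructor 3.
  rewrite -[in RHS](addn0 z) => /eqP.
  by rewrite eqn_modDl mod0n modn_small // gtn_eqF.
have mono m n : (m < k)%N -> (n < k)%N -> (lft p k m < lft p k n)%N ->
    P theta (z + m) < P theta (z + n).
  move=> mk nk; case: (cls m mk) => [[-> ->]|[m0 -> hm]|[m0 -> hm]];
    case: (cls n nk) => [[-> ->]|[n0 -> hn]|[n0 -> hn]]; rewrite ?addn0 ?ltnn //.
  - by move=> /(ltn_trans nk); rewrite ltnn.
  - by move=> mn; apply: ord => //; [rewrite m0 | rewrite hm hn].
  - by move=> _; apply: lt_trans hm hn.
  - by rewrite ltnNge leq_addl.
  - by move=> h; have := leq_ltn_trans (leq_addl m k) (ltn_trans h nk); rewrite ltnn.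
  - rewrite ltn_add2r => mn; apply: ord => //; first by rewrite m0.
    by rewrite !ltNge (ltW hm) (ltW hn).
move=> m n; have k0 := k_gt0.
rewrite (Pmod (esym (modn_mod m k))) (Pmod (esym (modn_mod n k))).
rewrite -(eq_lft p (modn_mod m k)) -(eq_lft p (modn_mod n k)).
have mk := ltn_pmod m k0; have nk := ltn_pmod n k0.
move: (m %% k)%N (n %% k)%N mk nk => {}m {}n mk nk.
apply/idP/idP; last exact: mono.
apply: contraLR; rewrite -leqNgt leq_eqVlt => /orP[/eqP/lft_inj e|lt].
  by rewrite (Pmod e) ltxx.
by rewrite -leNgt ltW // mono.
Qed.

Hypothesis ord : forall m n, (P theta (z + m) < P theta (z + n)) = (lft p k m < lft p k n)%N.

Let off := offset p k.

Let shifted j i := ext p k (i + off j).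

Let shifted_walk j : (0 < j <= k)%N -> walk (shifted j) 0 k.
Proof. by move=> jb; apply: walk_shift; rewrite add0n addnC; apply: offset_walk. Qed.

Let shifted_wset j : wset (shifted j) 0 k = wset (ext p k) (off j) (off j + k).
Proof. by rewrite -wset_shift add0n addnC. Qed.

Let shifted_label j : (0 < j <= k)%N ->
  (z + off j + (shifted j 0).2 = (shifted j 0).1 %[mod k])%N.
Proof.
move=> jb; have b := offset_bounds p k_gt0 jb; rewrite /shifted add0n -[X in (z + X + _)%N]subn0.
apply: walk_label (ext_walk k_gt0 pw) _ _ _ => //; first by rewrite -/off in b; lia.
by rewrite ext_low //= subn0 addnA modnDr.
Qed.

Let shifted_edge j m : (0 < j <= k)%N -> (0 < m < k)%N ->
  right_edge (shifted j) m = (P theta (z + off j + m) < P theta (z + off j)).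
Proof.
move=> jb mb; rewrite -addnA ord [lft p k (off j)]offset_lft //.
rewrite -(right_edge_offset k_gt0 jb); last by rewrite -/off; lia.
by rewrite /right_edge /shifted [(m + _)%N]addnC (_ : (m.-1 + off j = (off j + m).-1)%N) //; lia.
Qed.

Lemma window_constellation j : (0 < j <= k)%N -> exists F : constellation k xi,
  [/\ toric F, stable theta F & has_Gstair F (wset (ext p k) (off j) (off j + k))].
Proof.
move=> jb; have [F [tF hF [v vF]]] := walk_constellation (shifted_walk jb) (shifted_label jb).
exists F; split=> //; last by rewrite -shifted_wset.
by apply: right_edge_stable gth vF _ => m mb; apply: shifted_edge.
Qed.

(** A stable string is determined by its base, since the potentials then dictate every direction;
    the window whose offset is congruent to that base has the same directions. *)
Lemma toric_window (F : constellation k xi) : toric F -> stable theta F ->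
  exists2 j, (0 < j <= k)%N & has_Gstair F (wset (ext p k) (off j) (off j + k)).
Proof.
move=> /(toric_string xiP)[v [z' [w vz]]] st.
have [j jb oj] := lft_offset p k_gt0 (cyc_pos k z z'); exists j => //.
have zz : (z + off j = z' %[mod k])%N.
  by rewrite /off oj -modnDmr lft_mod modnDmr cyc_posK.
rewrite -shifted_wset; apply: (string_has_Gstair vz (shifted_walk jb)) => [m mb|].
  rewrite shifted_edge // (stable_right_edge th0 vz st mb).
  have e : P theta (z + off j + m) = P theta (z' + m).
    by apply: potential_mod => //; rewrite -modnDml zz modnDml.
  by rewrite e /P (potential_mod xiP th0 zz).
by rewrite -modnDml -zz modnDml shifted_label.
Qed.

End Window.

End Main.

Lemma same_abstract_refl k Gam : same_abstract k Gam Gam.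
Proof. by exists (0, 0)%N, (0, 0)%N. Qed.

(** * Simple chambers *)

Section Statements.

Variables (R : realType) (k : nat) (xi : R[i]).
Hypothesis xiP : k.-primitive_root xi.

Let k_gt0 : (0 < k)%N := prim_order_gt0 xiP.

Let P := potential xiP.

(* The parameter for which the potentials [P (z + m)] are ordered as the
   [lft p k m], up to an additive constant. *)
Definition simple_theta (p : nat -> box) z : 'rV[rat]_k :=
  let f n := (lft p k (cyc_pos k z n))%:R in \row_(i < k) (f i.+1 - f i).

Lemma simple_thetaP p z : generic xi (simple_theta p z) /\ forall m n,
  (P (simple_theta p z) (z + m) < P (simple_theta p z) (z + n)) = (lft p k m < lft p k n)%N.
Proof.
pose f n : rat := (lft p k (cyc_pos k z n))%:R.
have fmod m n : m = n %[mod k] -> f m = f n.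
  by move=> mn; rewrite /f (cyc_pos_mod z mn).
have tE m : theta_mod xiP (simple_theta p z) m = f m.+1 - f m.
  rewrite /theta_mod mxE /= -/(f _) -/(f _) (fmod (m %% k) m)%N ?modn_mod //.
  by rewrite (fmod (m %% k).+1 m.+1)%N // -addn1 modnDml addn1.
have PE n : P (simple_theta p z) n = f n - f 0%N.
  rewrite /P /potential; elim: n => [|n IHn]; first by rewrite big_geq // subrr.
  by rewrite big_nat_recr //= IHn tE; ring.
have fz m : f (z + m)%N = (lft p k m)%:R.
  congr (_%:R); apply: eq_lft; apply/eqP.
  by rewrite -(eqn_modDl z) cyc_posK.
split; last by move=> m n; rewrite !PE ltrD2r !fz ltr_nat.
apply/(generic_potential xiP); split=> [|m n].
  rewrite /in_Theta -(theta_mod_sum xiP); transitivity (P (simple_theta p z) k) => //.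
  by rewrite PE (fmod k 0%N) ?subrr // modnn mod0n.
rewrite -!/P !PE => /addIr/eqP; rewrite eqr_nat => /eqP/lft_inj e.
by rewrite -(cyc_posK z m k_gt0) -(cyc_posK z n k_gt0); apply/eqP; rewrite eqn_modDl; apply/eqP.
Qed.

Lemma toric_simple (F : constellation k xi) : toric F ->
  exists C : 'rV[rat]_k -> Prop, simple_chamber xi C /\ Cstable C F.
Proof.
move=> tF; have [v [z [w vz]]] := toric_string xiP tF.
have [pw rE zp] := walk_of_wordP k z w; move: (walk_of_word k z w) pw rE zp => p pw rE zp.
have [g0 ord] := simple_thetaP p z; set theta0 := simple_theta p z in g0 ord.
have [th0 _] := (generic_potential xiP theta0).1 g0.
pose C := clos_refl_trans _ (generic_segment xi) theta0.
have CP theta : C theta -> generic xi theta /\ same_order xiP theta0 theta.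
  exact: chamber_order.
have stF : stable theta0 F.
  apply: (right_edge_stable g0 vz) => m mb.
  (* The value [lft 0 = k] separates the x-edges, where [lft m = m], from the y-edges, where
     [lft m = m + k]; this is the stability criterion. *)
  rewrite -[in X in _ < X](addn0 z) -/P ord lft0 lftE -?rE //; last by lia.
  by rewrite (_ : (0 < m)%N) /=; [case: ifP|]; lia.
have CF := Cstable_chamber CP th0.
exists C; split; last exact: CF.
split; first by exists theta0.
have hF : has_Gstair F (wset p 0 k).
  by apply: (string_has_Gstair xiP vz pw) => // m mb; rewrite rE.
exists F; split=> //; first exact: CF.
exists (wset p 0 k), (wset (ext p k) (offset p k 1) (offset p k k + k)); split=> //.
- exists (fun j => wset (ext p k) (offset p k j) (offset p k j + k)); split.
  + move=> j jb; split; first exact: offset_width.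
    have [Fj [tFj stj hj]] := window_constellation pw zp g0 ord jb.
    by exists Fj; split=> //; apply: CF.
  + by move=> j jb; apply: offset_glued.
  + move=> b; split=> [/wsetP[m mb ->]|[j jb /wsetP[m mb ->]]].
      have [j jb mj] := offset_cover k_gt0 mb.
      by exists j => //; apply: mem_wset.
    have le1 := @offset_le p k k_gt0 1 j; have lek := @offset_le p k k_gt0 j k.
    by apply: mem_wset; lia.
- exists (wset p 0 k), (wset (ext p k) (offset p k 1) (offset p k k + k)); split.
  + exact: same_abstract_refl.
  + exact: same_abstract_refl.
  + by rewrite generators_ext.
Qed.

Lemma chamber_generic (C : 'rV[rat]_k -> Prop) : chamber xi C -> exists theta0,
  [/\ C theta0, generic xi theta0, in_Theta theta0 &
    forall theta, C theta -> generic xi theta /\ same_order xiP theta0 theta].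
Proof.
move=> /(chamberP xiP)[theta0 [C0 CP]]; have [g0 _] := CP _ C0.
by exists theta0; split=> //; have [] := g0.
Qed.

Lemma same_generators_Cstable (C : 'rV[rat]_k -> Prop) (F : constellation k xi) :
  chamber xi C -> toric F -> same_generators_as_Cstair C F -> Cstable C F.
Proof.
move=> /chamber_generic[theta0 [C0 g0 th0 CP]] tF [Gam [S [hG CS sG]]].
have [st _] := same_generators_Cstair xiP C0 g0 hG CS sG.
exact: Cstable_chamber CP th0 tF st.
Qed.

(** [same_generators_Cstair] orders the potentials around a base of its own, which
    [string_base_unique] identifies with [z]; hence the walk of a characteristic stair determines
    the whole order. *)
Lemma characteristic_order (C : 'rV[rat]_k -> Prop) (F : constellation k xi) p z theta0
    (v : nat -> Defs.space F) :
  C theta0 -> generic xi theta0 -> characteristic C F -> walk p 0 k -> string v z (right_edge p) ->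
  forall m n, (P theta0 (z + m) < P theta0 (z + n)) = (lft p k m < lft p k n)%N.
Proof.
move=> C0 g0 [tF CF [Gam [S [hG CS sG]]]] pw vz.
have [th0 _] := (generic_potential xiP theta0).1 g0.
have [st [z' [v' [w' vz']] ord]] := same_generators_Cstair xiP C0 g0 hG CS sG.
have zz := string_base_unique xiP vz vz'.
have PE m : P theta0 (z + m) = P theta0 (z' + m).
  by apply: potential_mod => //; rewrite -modnDml zz modnDml.
apply: order_lft => // [m mb|m m' mm mk].
  exact: stable_right_edge th0 vz st mb.
have PE0 : P theta0 z = P theta0 z' by apply: potential_mod.
by rewrite -/P !PE PE0; apply: ord.
Qed.

Lemma stairs_prog_correct (C : 'rV[rat]_k -> Prop) (F : constellation k xi) Gam s :
  chamber xi C -> characteristic C F -> has_Gstair F Gam -> lists s Gam ->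
  let out : seq (seq box) := ev stairs_prog s in
  (forall l, l \in out -> exists (F' : constellation k xi) Gam',
     [/\ toric F', Cstable C F', has_Gstair F' Gam' & lists l Gam']) /\
  (forall F' : constellation k xi, toric F' -> Cstable C F' -> exists Gam' l,
     [/\ l \in out, has_Gstair F' Gam' & lists l Gam']).
Proof.
move=> /chamber_generic[theta0 [C0 g0 th0 CP]] chF hG sG out.
have [p [v [z [pw GE vz zp]]]] := has_Gstair_string xiP hG.
have ord := characteristic_order C0 g0 chF pw vz.
have sE : s = [seq p i | i <- iota 0 k].
  by rewrite GE in sG; rewrite (lists_walk pw sG) /index_iota subn0.
have sk : size s = k by rewrite sE size_map size_iota.
have nthE i : (i < k + k + k)%N -> nth (0, 0)%N (ext_list s) i = ext p k i.
  by rewrite sE; apply: nth_ext_list.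
have ew := ext_walk k_gt0 pw.
have outP l : l \in out <-> exists2 j, (0 < j <= k)%N &
    l = [seq ext p k i | i <- index_iota (offset p k j) (offset p k j + k)].
  have iotaE o : (o + k <= k + k + k)%N ->
      [seq nth (0, 0)%N (ext_list s) i | i <- iota o k] =
      [seq ext p k i | i <- index_iota o (o + k)].
    move=> ok; rewrite /index_iota addKn; apply/eq_in_map => i; rewrite mem_iota => ib.
    by apply: nthE; move: ib ok; clear; lia.
  rewrite ev_stairs sk; split=> [[e [ek]]|[j jb ->]].
    have k0 := k_gt0; rewrite (nthE e.+1) ?(nthE e); try by move: k0 ek; clear; lia.
    move=> down right ->.
    have D : ~~ right_edge (ext p k) e.+1.
      apply/negP => r; have eb : (0 < e.+1 < k + k + k)%N by move: k0 ek; clear; lia.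
      by have := ew _ eb; rewrite r => E; rewrite E /= ltnn in down.
    (* A window starting at [2k] is ruled out, because edge [2k] of [ext] goes right and not
       down. *)
    have e2 : (e.+1 < k + k)%N.
      rewrite ltn_neqAle ek andbT; apply: contraNneq D => ->.
      by rewrite ext_edgeE ?leqnn //= ?andbT; move: k0; clear; lia.
    have Rt : right_edge (ext p k) (e.+1 + k).
      by move: right; rewrite !nthE; [exact: id | |]; move: e2; clear; lia.
    have /eqP fx : lft p k e.+1 == e.+1 by rewrite lft_fixed // D Rt.
    have [j jb oj] := lft_offset p k_gt0 e.+1; exists j => //.
    by rewrite oj fx iotaE //; move: e2; clear; lia.
  have k0 := k_gt0; have ob := offset_bounds p k_gt0 jb.
  have := lft_fixed p k_gt0 ob; rewrite offset_lft // eqxx.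
  move: (offset p k j) ob => o ob /esym/andP[D Rt]; exists o.-1.
  have oE : o.-1.+1 = o by apply: prednK; case/andP: ob.
  rewrite oE iotaE; last by move: ob; clear; lia.
  split=> //; first by move: ob; clear; lia.
    rewrite !nthE; try by move: ob; clear; lia.
    have := ew o; rewrite (negbTE D) => ->; last by move: ob; clear; lia.
    by rewrite /= ltnSn.
  rewrite !nthE; try by move: ob; clear; lia.
  by move: Rt; rewrite /right_edge -{1}oE.
split=> [l /outP[j jb ->]|F' tF' CF'].
  have [F' [tF' st hF']] := window_constellation pw zp g0 ord jb.
  exists F', (wset (ext p k) (offset p k j) (offset p k j + k)); split=> //.
    exact: Cstable_chamber CP th0 tF' st.
  by apply: lists_map_walk; apply: offset_walk.
have [j jb hj] := toric_window pw zp g0 ord tF' (CF' _ C0).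
exists (wset (ext p k) (offset p k j) (offset p k j + k)).
exists [seq ext p k i | i <- index_iota (offset p k j) (offset p k j + k)]; split=> //.
  by apply/outP; exists j.
by apply: lists_map_walk; apply: offset_walk.
Qed.

End Statements.

Theorem proposition6p12 (R : realType) :
  [/\ (* (1) *)
      forall (k : nat) (xi : R[i]), k.-primitive_root xi ->
      forall F : constellation k xi, toric F ->
      exists C : 'rV[rat]_k -> Prop, simple_chamber xi C /\ Cstable C F,
      (* (2) *)
      exists alg : prog (List Box) (List (List Box)),
      forall (k : nat) (xi : R[i]), k.-primitive_root xi ->
      forall C : 'rV[rat]_k -> Prop, simple_chamber xi C ->
      forall F : constellation k xi, characteristic C F ->
      forall (Gam : {fset box}) (s : seq box), has_Gstair F Gam -> lists s Gam ->
      exists out : seq (seq box),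
        [/\ runs alg s out,
            forall l, l \in out ->
              exists (F' : constellation k xi) (Gam' : {fset box}),
                [/\ toric F', Cstable C F', has_Gstair F' Gam' & lists l Gam'] &
            forall F' : constellation k xi, toric F' -> Cstable C F' ->
              exists (Gam' : {fset box}) (l : seq box),
                [/\ l \in out, has_Gstair F' Gam' & lists l Gam']] &
      (* (3) *)
      forall (k : nat) (xi : R[i]), k.-primitive_root xi ->
      forall C : 'rV[rat]_k -> Prop, simple_chamber xi C ->
      forall F : constellation k xi, toric F -> same_generators_as_Cstair C F ->
      Cstable C F /\ characteristic C F].
Proof.
split.
- by move=> k xi xiP F tF; apply: toric_simple.
- exists stairs_prog => k xi xiP C [chC _] F chF Gam s hG sG.
  have [h1 h2] := stairs_prog_correct xiP chC chF hG sG.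
  by exists (ev stairs_prog s); split=> //; apply: runs_ev.
- move=> k xi xiP C [chC _] F tF sgF.
  have CF := same_generators_Cstable xiP chC tF sgF.
  by split.
Qed.
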